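(* Let $G$ be a finite nilpotent group, $J\in kG\otimes kG$ any twist, and $A=(kG)^J$. Then: (1) $A$ has an upper normal series all of whose factors are isomorphic to group algebras $k\mathbb Z_p$ with $p$ a prime dividing $\dim A$; (2) $A$ has a lower normal series all of whose factors are cocommutative. In particular, $A$ is semisolvable.
   Context: $k$ is an algebraically closed field of characteristic zero. For a twist $J$ in a Hopf algebra $A$, $A^J$ is the Hopf algebra with the same algebra and counit, comultiplication $\Delta^J(h)=J^{-1}\Delta(h)J$ and twisted antipode. A Hopf subalgebra $K\subseteq A$ is normal if stable under the adjoint action ${}^hx=\sum h_1xS(h_2)$; $K^+=K\cap\ker\epsilon$. A lower normal series of a finite dimensional Hopf algebra $A$ is a chain of Hopf subalgebras $k=A_n\subset A_{n-1}\subset\cdots\subset A_1\subset A_0=A$ with each $A_{i+1}$ normal in $A_i$; its factors are the quotient Hopf algebras $A_i/A_iA_{i+1}^+$. An upper normal series is defined inductively: $A_{(0)}=A$; for $i\geq1$, $A_i$ is a normal Hopf subalgebra of $A_{(i-1)}$ and $A_{(i)}=A_{(i-1)}/A_{(i-1)}A_i^+$, ending when $A_{(n)}=k$ (so $A_n=A_{(n-1)}$); its factors are the Hopf algebras $A_i$. $A$ is semisolvable if it has a lower or an upper normal series all of whose factors are commutative or cocommutative. *)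

(* Defs.v *)
(* Finite-dimensional Hopf algebras over a field F, given by
   structure constants in a fixed basis e_0, ..., e_(n-1).
   Elements of A are row vectors 'rV[F]_n, elements of A (x) A are n x n
   matrices (e_j (x) e_k <-> delta_mx j k), elements of A (x) A (x) A are
   functions 'I_n -> 'I_n -> 'I_n -> F.  Subspaces are matrix row spaces. *)
From HB Require Import structures.
From mathcomp Require Import all_boot all_order all_algebra all_fingroup all_solvable.
Unset Strict Implicit. Unset Printing Implicit Defensive.
Import Order.TTheory GRing.Theory.
Local Open Scope ring_scope.

Record hopf (F : fieldType) := Hopf {
  hdim : nat;
  hmul : 'I_hdim -> 'I_hdim -> 'rV[F]_hdim;
  hunit : 'rV[F]_hdim;
  hcomul : 'I_hdim -> 'M[F]_hdim;
  hcounit : 'I_hdim -> F;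
  hanti : 'I_hdim -> 'rV[F]_hdim
}.
Arguments hdim {F} h.
Arguments hmul {F} h _ _.
Arguments hunit {F} h.
Arguments hcomul {F} h _.
Arguments hcounit {F} h _.
Arguments hanti {F} h _.

Section HopfOps.
Context {F : fieldType} (H : hopf F).
Local Notation n := (hdim H).

Definition ebas (i : 'I_n) : 'rV[F]_n := delta_mx 0 i.
Definition tens (u v : 'rV[F]_n) : 'M[F]_n := u^T *m v.

Definition mulA (x y : 'rV[F]_n) : 'rV[F]_n :=
  \sum_(i < n) \sum_(j < n) (x 0 i * y 0 j) *: hmul H i j.
Definition comulA (x : 'rV[F]_n) : 'M[F]_n := \sum_(i < n) x 0 i *: hcomul H i.
Definition counitA (x : 'rV[F]_n) : F := \sum_(i < n) x 0 i * hcounit H i.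
Definition antiA (x : 'rV[F]_n) : 'rV[F]_n := \sum_(i < n) x 0 i *: hanti H i.

Definition mulT (X Y : 'M[F]_n) : 'M[F]_n :=
  \sum_(i < n) \sum_(j < n) \sum_(k < n) \sum_(l < n)
     (X i j * Y k l) *: tens (hmul H i k) (hmul H j l).
Definition unitT : 'M[F]_n := tens (hunit H) (hunit H).

Definition t3 := 'I_n -> 'I_n -> 'I_n -> F.
Definition mul3 (X Y : t3) : t3 := fun a b c =>
  \sum_(i < n) \sum_(j < n) \sum_(k < n) \sum_(l < n) \sum_(m < n) \sum_(o < n)
     X i j k * Y l m o * (hmul H i l) 0 a * (hmul H j m) 0 b * (hmul H k o) 0 c.
Definition comulL (T : 'M[F]_n) : t3 := fun a b c =>
  \sum_(j < n) T j c * hcomul H j a b.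
Definition comulR (T : 'M[F]_n) : t3 := fun a b c =>
  \sum_(j < n) T a j * hcomul H j b c.
Definition tensL1 (T : 'M[F]_n) : t3 := fun a b c => T a b * hunit H 0 c.
Definition tens1R (T : 'M[F]_n) : t3 := fun a b c => hunit H 0 a * T b c.
Definition counitL (T : 'M[F]_n) : 'rV[F]_n := \sum_(j < n) hcounit H j *: row j T.
Definition counitR (T : 'M[F]_n) : 'rV[F]_n := \sum_(k < n) hcounit H k *: (col k T)^T.

Definition is_bialg : Prop :=
  [/\ (forall x y z, mulA (mulA x y) z = mulA x (mulA y z)) /\
      (forall x, mulA (hunit H) x = x /\ mulA x (hunit H) = x),
      forall i a b c, comulL (hcomul H i) a b c = comulR (hcomul H i) a b c,
      forall i, counitL (hcomul H i) = ebas i /\ counitR (hcomul H i) = ebas i,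
      (forall x y, comulA (mulA x y) = mulT (comulA x) (comulA y))
         /\ comulA (hunit H) = unitT
    & (forall x y, counitA (mulA x y) = counitA x * counitA y)
         /\ counitA (hunit H) = 1 ].

Definition is_antipode : Prop :=
  forall i,
    \sum_(j < n) \sum_(k < n) hcomul H i j k *: mulA (antiA (ebas j)) (ebas k)
      = hcounit H i *: hunit H /\
    \sum_(j < n) \sum_(k < n) hcomul H i j k *: mulA (ebas j) (antiA (ebas k))
      = hcounit H i *: hunit H.

Definition is_hopf : Prop := is_bialg /\ is_antipode.

Definition tensSub (K : 'M[F]_n) : 'M[F]_(n * n) :=
  (\sum_(i < n) \sum_(j < n) <<mxvec (tens (row i K) (row j K))>>)%MS.

Definition hopf_sub (K : 'M[F]_n) : Prop :=
  [/\ (hunit H <= K)%MS,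
      forall x y, (x <= K)%MS -> (y <= K)%MS -> (mulA x y <= K)%MS,
      forall x, (x <= K)%MS -> (mxvec (comulA x) <= tensSub K)%MS
    & forall x, (x <= K)%MS -> (antiA x <= K)%MS ].

Definition adA (h x : 'rV[F]_n) : 'rV[F]_n :=
  \sum_(j < n) \sum_(k < n) comulA h j k *: mulA (mulA (ebas j) x) (antiA (ebas k)).

Definition normal_in (K L : 'M[F]_n) : Prop :=
  forall h x, (h <= L)%MS -> (x <= K)%MS -> (adA h x <= K)%MS.

Definition ker_counit : 'M[F]_n := kermx (\col_(i < n) hcounit H i).
Definition plusSub (K : 'M[F]_n) : 'M[F]_n := (K :&: ker_counit)%MS.
Definition lprod (L K : 'M[F]_n) : 'M[F]_n :=
  (\sum_(i < n) \sum_(j < n) <<mulA (row i L) (row j (plusSub K))>>)%MS.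

Definition commutative_on (K : 'M[F]_n) : Prop :=
  forall x y, (x <= K)%MS -> (y <= K)%MS -> mulA x y = mulA y x.
Definition cocommutative_on (K : 'M[F]_n) : Prop :=
  forall x, (x <= K)%MS -> (comulA x)^T = comulA x.

End HopfOps.

Definition commutative_hopf {F : fieldType} (H : hopf F) : Prop :=
  commutative_on H 1%:M.
Definition cocommutative_hopf {F : fieldType} (H : hopf F) : Prop :=
  cocommutative_on H 1%:M.

(* f : A1 -> A2 (acting on row vectors) restricted to the subspace K of A1
   is a morphism of Hopf algebras (K being a Hopf subalgebra of A1) *)
Definition hmorph_on {F : fieldType} (H1 H2 : hopf F) (K : 'M[F]_(hdim H1))
    (f : 'M[F]_(hdim H1, hdim H2)) : Prop :=
  [/\ forall x y, (x <= K)%MS -> (y <= K)%MS ->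
        mulA H2 (x *m f) (y *m f) = mulA H1 x y *m f,
      hunit H1 *m f = hunit H2,
      forall x, (x <= K)%MS -> comulA H2 (x *m f) = f^T *m comulA H1 x *m f,
      forall x, (x <= K)%MS -> counitA H2 (x *m f) = counitA H1 x
    & forall x, (x <= K)%MS -> antiA H2 (x *m f) = antiA H1 x *m f ].

Definition is_quotient {F : fieldType} (H1 : hopf F) (K I : 'M[F]_(hdim H1))
    (H2 : hopf F) (f : 'M[F]_(hdim H1, hdim H2)) : Prop :=
  [/\ is_hopf H2, hmorph_on H1 H2 K f, row_full (K *m f) & (K :&: kermx f == I)%MS ].

Definition groupalg (F : fieldType) (gT : finGroupType) : hopf F :=
  @Hopf F #|gT|
    (fun i j => delta_mx 0 (enum_rank (enum_val i * enum_val j)%g))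
    (delta_mx 0 (enum_rank (1%g : gT)))
    (fun i => delta_mx i i)
    (fun _ => 1)
    (fun i => delta_mx 0 (enum_rank ((enum_val i)^-1)%g)).

Definition iso_to_kZp {F : fieldType} (p : nat) (H : hopf F) (K : 'M[F]_(hdim H))
    : Prop :=
  exists f : 'M[F]_(hdim (groupalg F 'Z_p), hdim H),
    [/\ hmorph_on (groupalg F 'Z_p) H 1%:M f, row_free f & (f == K)%MS ].

Definition is_twist {F : fieldType} (H : hopf F) (J Jinv : 'M[F]_(hdim H)) : Prop :=
  [/\ mulT H J Jinv = unitT H /\ mulT H Jinv J = unitT H,
      forall a b c, mul3 H (comulL H J) (tensL1 H J) a b c
                  = mul3 H (comulR H J) (tens1R H J) a b c
    & counitL H J = hunit H /\ counitR H J = hunit H ].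

(* H^J: same algebra and counit, comultiplication J^-1 Delta(h) J; the
   antipode S is supplied (the antipode of a bialgebra is unique) *)
Definition twisted {F : fieldType} (H : hopf F) (J Jinv : 'M[F]_(hdim H))
    (S : 'I_(hdim H) -> 'rV[F]_(hdim H)) : hopf F :=
  @Hopf F (hdim H) (hmul H) (hunit H)
    (fun i => mulT H (mulT H Jinv (hcomul H i)) J) (hcounit H) S.

Definition lower_series {F : fieldType} (H : hopf F) (P : hopf F -> Prop) : Prop :=
  exists (m : nat) (K : nat -> 'M[F]_(hdim H)),
    [/\ (K 0%N == 1%:M)%MS, (K m == hunit H)%MS &
      forall i, (i < m)%N ->
        [/\ hopf_sub H (K i.+1), (K i.+1 <= K i)%MS, normal_in H (K i.+1) (K i)
          & exists (B : hopf F) (f : 'M[F]_(hdim H, hdim B)),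
              is_quotient H (K i) (lprod H (K i) (K i.+1)) B f /\ P B ] ].

Definition upper_series {F : fieldType} (H : hopf F)
    (P : forall B : hopf F, 'M[F]_(hdim B) -> Prop) : Prop :=
  exists (m : nat) (B : nat -> hopf F) (K : forall i, 'M[F]_(hdim (B i)))
         (pi : forall i, 'M[F]_(hdim (B i), hdim (B i.+1))),
    [/\ B 0%N = H, hdim (B m) = 1%N &
      forall i, (i < m)%N ->
        [/\ hopf_sub (B i) (K i), normal_in (B i) (K i) 1%:M,
            is_quotient (B i) 1%:M (lprod (B i) 1%:M (K i)) (B i.+1) (pi i)
          & P (B i) (K i) ] ].

Definition semisolvable {F : fieldType} (H : hopf F) : Prop :=
  lower_series H (fun B => commutative_hopf B \/ cocommutative_hopf B) \/
  upper_series H (fun B K => commutative_on B K \/ cocommutative_on B K).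

(* Main.v *)
(* For the upper series, a central subgroup Z of prime order stays central and
   group-like in the twisted algebra, and the quotient of A = (kG)^J by Z is
   again a twisted group algebra, of G/Z.

   For the lower series, put A and the Drinfeld double D(G) = k^G x kG side by
   side.  The tensor W = J^-1 (sum_h delta_h (x) h) J_21 in D(G) (x) A is the
   inverse of the twisted R-matrix, and the cocycle identity gives
   (id (x) Delta^J)(W) = W_12 W_13, while W_23 W_13 is (Delta (x) id)(W) for
   the coproduct of the twisted double.  So taking right legs of W sends
   functionals on D(G) to A compatibly with products and coproducts, and it is
   onto.  Functionals supported on a coset of a central quotient of the
   delta-part, and then functionals on kG transforming by a character of a
   normal subgroup, give families (M_q) of subcoalgebras of A indexed by a
   finite group, with M_q M_s in M_qs; for any such family M_1 is normal in
   sum_q M_q and the quotient is spanned by the group-like images of the M_q,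
   hence cocommutative.  Running down a central series of G first in the
   delta-part and then up in the characters leads from A to k. *)
Require Import Defs.
From HB Require Import structures.
From mathcomp Require Import all_boot all_order all_algebra all_fingroup all_solvable.
Set Implicit Arguments. Unset Strict Implicit. Unset Printing Implicit Defensive.
(* Restores the names of Defs.v that mathcomp shadows, such as [mulA]. *)
Import GRing.Theory Defs.
Local Open Scope ring_scope.

(** * Sweedler sums over structure constants *)

Lemma linear_comb (F : fieldType) (U V : lmodType F) (f : U -> V) (lf : linear f)
    (I : Type) r (P : pred I) (c : I -> F) (w : I -> U) :
  f (\sum_(i <- r | P i) c i *: w i) = \sum_(i <- r | P i) c i *: f (w i).
Proof.
pose g : {linear U -> V} := HB.pack f (GRing.isLinear.Build F _ _ *:%R f lf).
rewrite -[LHS]/(g _) raddf_sum; apply: eq_bigr => i _; exact: (linearZZ g).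
Qed.

Lemma linear_scale (F : fieldType) (U V : lmodType F) (f : U -> V) (lf : linear f) a x :
  f (a *: x) = a *: f x.
Proof.
pose g : {linear U -> V} := HB.pack f (GRing.isLinear.Build F _ _ *:%R f lf).
exact: (linearZZ g).
Qed.

Section Sweedler.
Variables (F : fieldType) (H : hopf F).
Local Notation n := (hdim H).
Local Notation mul := (mulA H).
Local Notation e := (ebas H).

Lemma ebas_sum (x : 'rV[F]_n) : x = \sum_i x 0 i *: e i.
Proof. exact: row_sum_delta. Qed.

Lemma tensZl a u v : tens H (a *: u) v = a *: tens H u v.
Proof. by rewrite /tens linearZ /= scalemxAl. Qed.

Lemma tensDl a u u' v : tens H (a *: u + u') v = a *: tens H u v + tens H u' v.
Proof. by rewrite /tens linearP mulmxDl scalemxAl. Qed.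

Lemma tensDr a u v v' : tens H u (a *: v + v') = a *: tens H u v + tens H u v'.
Proof. by rewrite /tens mulmxDr scalemxAr. Qed.

Lemma tensE u v i j : tens H u v i j = u 0 i * v 0 j.
Proof. by rewrite /tens mxE big_ord1 mxE. Qed.

Lemma tens_ebas i j : tens H (e i) (e j) = delta_mx i j.
Proof. by rewrite /tens /ebas trmx_delta mul_delta_mx. Qed.

Lemma mx_tens_sum (X : 'M[F]_n) : X = \sum_i \sum_j X i j *: tens H (e i) (e j).
Proof.
rewrite {1}[X]matrix_sum_delta; apply: eq_bigr => i _; apply: eq_bigr => j _.
by rewrite tens_ebas.
Qed.

Fact mulA_is_linear x : linear (mul x).
Proof.
move=> a y z; rewrite /mulA scaler_sumr -big_split; apply: eq_bigr => i _ /=.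
rewrite scaler_sumr -big_split; apply: eq_bigr => j _ /=.
by rewrite !mxE scalerA -scalerDl; congr (_ *: _); rewrite mulrDr mulrCA.
Qed.
HB.instance Definition _ x := GRing.isLinear.Build F _ _ *:%R (mul x) (mulA_is_linear x).

Lemma mulADl a x y z : mul (a *: x + y) z = a *: mul x z + mul y z.
Proof.
rewrite /mulA scaler_sumr -big_split; apply: eq_bigr => i _ /=.
rewrite scaler_sumr -big_split; apply: eq_bigr => j _ /=.
by rewrite !mxE scalerA -scalerDl; congr (_ *: _); rewrite mulrDl mulrA.
Qed.

Definition mulAr y x := mul x y.
Fact mulAr_is_linear y : linear (mulAr y).
Proof. by move=> a x z; apply: mulADl. Qed.
HB.instance Definition _ y :=
  GRing.isLinear.Build F _ _ *:%R (mulAr y) (mulAr_is_linear y).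

Lemma mulA_suml I r (P : pred I) (u : I -> 'rV[F]_n) v :
  mul (\sum_(i <- r | P i) u i) v = \sum_(i <- r | P i) mul (u i) v.
Proof. exact: (raddf_sum (mulAr v)). Qed.

Lemma mulAZl a x y : mul (a *: x) y = a *: mul x y.
Proof. exact: (linearZZ (mulAr y)). Qed.

Fact comulA_is_linear : linear (comulA H).
Proof.
move=> a y z; rewrite /comulA scaler_sumr -big_split; apply: eq_bigr => i _ /=.
by rewrite !mxE scalerA -scalerDl.
Qed.
HB.instance Definition _ := GRing.isLinear.Build F _ _ *:%R (comulA H) comulA_is_linear.

Fact antiA_is_linear : linear (antiA H).
Proof.
move=> a y z; rewrite /antiA scaler_sumr -big_split; apply: eq_bigr => i _ /=.
by rewrite !mxE scalerA -scalerDl.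
Qed.
HB.instance Definition _ := GRing.isLinear.Build F _ _ *:%R (antiA H) antiA_is_linear.

Fact counitA_is_linear : scalar (counitA H).
Proof.
move=> a y z; rewrite /counitA mulr_sumr -big_split; apply: eq_bigr => i _ /=.
by rewrite !mxE mulrDl mulrA.
Qed.
HB.instance Definition _ := GRing.isLinear.Build F _ _ *%R (counitA H) counitA_is_linear.

Lemma sum_ebas (V : lmodType F) (f : 'I_n -> V) (i : 'I_n) :
  \sum_j (e i) 0 j *: f j = f i.
Proof.
rewrite (bigD1 i) //= big1 ?addr0 => [|j ne]; first by rewrite mxE !eqxx scale1r.
by rewrite mxE eqxx (negPf ne) scale0r.
Qed.

Lemma mulA_ebas i j : mul (e i) (e j) = hmul H i j.
Proof.
rewrite /mulA -[RHS](sum_ebas (fun i => hmul H i j)); apply: eq_bigr => k _.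
rewrite -(sum_ebas (fun j => hmul H k j)) scaler_sumr.
by apply: eq_bigr => l _; rewrite scalerA.
Qed.

Lemma comulA_ebas i : comulA H (e i) = hcomul H i.
Proof. exact: sum_ebas. Qed.

Lemma antiA_ebas i : antiA H (e i) = hanti H i.
Proof. exact: sum_ebas. Qed.

Lemma counitA_ebas i : counitA H (e i) = hcounit H i.
Proof. exact: (@sum_ebas F^o). Qed.

Definition sw (V : lmodType F) (X : 'M[F]_n) (t : 'I_n -> 'I_n -> V) : V :=
  \sum_j \sum_k X j k *: t j k.

Section Sw.
Variable V : lmodType F.
Implicit Types t : 'I_n -> 'I_n -> V.

Lemma swP a X Y t : sw (a *: X + Y) t = a *: sw X t + sw Y t.
Proof.
rewrite /sw scaler_sumr -big_split; apply: eq_bigr => j _ /=.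
rewrite scaler_sumr -big_split; apply: eq_bigr => k _ /=.
by rewrite !mxE scalerDl scalerA.
Qed.

Lemma sw0 t : sw 0 t = 0.
Proof. by rewrite /sw big1 // => j _; rewrite big1 // => k _; rewrite mxE scale0r. Qed.

Lemma sw_sum I r (P : pred I) (X : I -> 'M_n) t :
  sw (\sum_(i <- r | P i) X i) t = \sum_(i <- r | P i) sw (X i) t.
Proof.
apply: (big_morph (fun X => sw X t)) => [Y Z|]; last exact: sw0.
by rewrite -[Y]scale1r swP !scale1r.
Qed.

Lemma swZ a X t : sw (a *: X) t = a *: sw X t.
Proof. by rewrite -[a *: X]addr0 swP sw0 addr0. Qed.

Lemma eq_sw X t t' : (forall j k, t j k = t' j k) -> sw X t = sw X t'.
Proof. by move=> E; apply: eq_bigr => j _; apply: eq_bigr => k _; rewrite E. Qed.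

Lemma sw_delta j k t : sw (delta_mx j k) t = t j k.
Proof.
rewrite /sw (bigD1 j) //= [X in _ + X]big1 ?addr0 => [|i ne]; last first.
  by rewrite big1 // => l _; rewrite mxE (negPf ne) scale0r.
rewrite (bigD1 k) //= [X in _ + X]big1 ?addr0 => [|i ne]; last first.
  by rewrite mxE eqxx (negPf ne) scale0r.
by rewrite mxE !eqxx scale1r.
Qed.

Lemma sw_tens (b : 'rV[F]_n -> 'rV[F]_n -> V) u v :
  (forall x, linear (b x)) -> (forall y, linear (b^~ y)) ->
  sw (tens H u v) (fun j k => b (e j) (e k)) = b u v.
Proof.
move=> lr ll.
rewrite {2}[u]ebas_sum (linear_comb (ll v)); apply: eq_bigr => j _.
rewrite {2}[v]ebas_sum (linear_comb (lr _)) scaler_sumr; apply: eq_bigr => k _.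
by rewrite tensE scalerA.
Qed.
End Sw.
End Sweedler.

Section TensorSubspaces.
Variables (F : fieldType) (H : hopf F).
Local Notation n := (hdim H).
Local Notation e := (ebas H).

Lemma linear_sw (V W : lmodType F) (f : V -> W) X (t : 'I_n -> 'I_n -> V) :
  linear f -> f (sw X t) = sw X (fun j k => f (t j k)).
Proof.
move=> lf; rewrite /sw.
under eq_bigr do rewrite -[\sum_(k < n) _]scale1r.
rewrite (linear_comb lf); apply: eq_bigr => j _.
by rewrite scale1r (linear_comb lf).
Qed.

Definition in_tens m1 m2 (U : 'M[F]_(m1, n)) (V : 'M_(m2, n)) (X : 'M[F]_n) :=
  (X <= V)%MS && (X^T <= U)%MS.

Lemma in_tensP m1 m2 (U : 'M[F]_(m1, n)) (V : 'M_(m2, n)) X :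
  reflect (exists Y : 'M_(m1, m2), X = U^T *m Y *m V) (in_tens U V X).
Proof.
apply: (iffP andP) => [[sV /submxP[E eE]]|[Y ->]]; last first.
  by split; [exact: submxMl | rewrite !trmx_mul trmxK mulmxA submxMl].
exists (E^T *m pinvmx V); rewrite -[LHS](mulmxKpV sV).
by rewrite -{1}[X]trmxK eE trmx_mul !mulmxA.
Qed.

Lemma in_tens_sum m1 m2 (U : 'M[F]_(m1, n)) (V : 'M_(m2, n)) X : in_tens U V X ->
  exists Y : 'M_(m1, m2),
    X = \sum_s \sum_t Y s t *: tens H (row s U) (row t V).
Proof.
case/in_tensP => Y ->; exists Y.
rewrite {1}[Y]matrix_sum_delta !(mulmx_sumr, mulmx_suml).
apply: eq_bigr => s _; rewrite !(mulmx_sumr, mulmx_suml); apply: eq_bigr => t _.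
rewrite -scalemxAr -scalemxAl; congr (_ *: _); rewrite /tens !rowE trmx_mul.
rewrite mulmxA -(mulmxA _ _ (delta_mx 0 t)) trmx_delta mul_delta_mx //.
Qed.

Lemma tens_in m1 m2 (U : 'M[F]_(m1, n)) (V : 'M_(m2, n)) u v :
  (u <= U)%MS -> (v <= V)%MS -> in_tens U V (tens H u v).
Proof.
move=> /submxP[a ->] /submxP[b ->]; apply/in_tensP; exists (a^T *m b).
by rewrite /tens trmx_mul !mulmxA.
Qed.

Lemma in_tensZ m1 m2 (U : 'M[F]_(m1, n)) (V : 'M_(m2, n)) a X :
  in_tens U V X -> in_tens U V (a *: X).
Proof. by move=> /andP[h1 h2]; rewrite /in_tens linearZ /= !scalemx_sub. Qed.

Lemma in_tens_bigsum m1 m2 (U : 'M[F]_(m1, n)) (V : 'M_(m2, n)) I r (P : pred I) X :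
  (forall i, P i -> in_tens U V (X i)) -> in_tens U V (\sum_(i <- r | P i) X i).
Proof.
move=> h; rewrite /in_tens linear_sum /= !summx_sub // => i /h /andP[] //.
Qed.

Lemma sw_in_tens m1 m2 m (U : 'M[F]_(m1, n)) (V : 'M_(m2, n)) (W : 'M_(m, n)) X
    (b : 'rV[F]_n -> 'rV[F]_n -> 'rV[F]_n) :
  (forall x, linear (b x)) -> (forall y, linear (b^~ y)) -> in_tens U V X ->
  (forall u v, (u <= U)%MS -> (v <= V)%MS -> (b u v <= W)%MS) ->
  (sw X (fun j k => b (e j) (e k)) <= W)%MS.
Proof.
move=> lr ll /in_tens_sum[Y ->] h; rewrite sw_sum summx_sub // => s _.
rewrite sw_sum summx_sub // => t _; rewrite swZ sw_tens //.
by rewrite scalemx_sub // h // row_sub.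
Qed.

Lemma in_tens_tensSub (K : 'M[F]_n) X : in_tens K K X -> (mxvec X <= tensSub H K)%MS.
Proof.
move=> /in_tens_sum[Y ->]; rewrite linear_sum summx_sub // => i _.
rewrite linear_sum summx_sub // => j _; rewrite linearZ scalemx_sub //.
by rewrite /tensSub (sumsmx_sup i) // (sumsmx_sup j) // genmxE.
Qed.

End TensorSubspaces.

Section Bialgebra.
Variables (F : fieldType) (H : hopf F) (hH : is_bialg H).
Local Notation n := (hdim H).
Local Notation e := (ebas H).
Local Notation mul := (mulA H).
Local Notation eps := (counitA H).
Local Notation D := (comulA H).

Lemma mulAA x y z : mul (mul x y) z = mul x (mul y z).
Proof. by case: hH => [[]]. Qed.

Lemma mul1A x : mul (hunit H) x = x.
Proof. by case: hH => [[_ /(_ x)[]]]. Qed.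

Lemma mulA1 x : mul x (hunit H) = x.
Proof. by case: hH => [[_ /(_ x)[]]]. Qed.

Lemma counitAM x y : eps (mul x y) = eps x * eps y.
Proof. by case: hH => _ _ _ _ []. Qed.

Lemma counitA1 : eps (hunit H) = 1.
Proof. by case: hH => _ _ _ _ []. Qed.

Section Sw.
Variable V : lmodType F.

Lemma sw_comulA x (t : 'I_n -> 'I_n -> V) :
  sw (D x) t = \sum_i x 0 i *: sw (hcomul H i) t.
Proof. by rewrite /comulA sw_sum; apply: eq_bigr => i _; rewrite swZ. Qed.

Lemma sw_coassoc x (t : 'I_n -> 'I_n -> 'I_n -> V) :
  sw (D x) (fun j k => sw (hcomul H j) (fun a b => t a b k)) =
  sw (D x) (fun j k => sw (hcomul H k) (fun a b => t j a b)).
Proof.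
rewrite !sw_comulA; apply: eq_bigr => i _; congr (_ *: _).
case: hH => _ coass _ _ _.
transitivity (\sum_a \sum_b \sum_c comulL H (hcomul H i) a b c *: t a b c).
  rewrite /sw exchange_big /=.
  under eq_bigr => k _ do
   (under eq_bigr => j _ do (rewrite scaler_sumr; under eq_bigr => a _ do rewrite scaler_sumr);
    rewrite exchange_big /=).
  rewrite exchange_big /=; apply: eq_bigr => a _.
  under eq_bigr => k _ do rewrite exchange_big /=.
  rewrite exchange_big /=; apply: eq_bigr => b _; apply: eq_bigr => k _.
  by rewrite scaler_suml; apply: eq_bigr => j _; rewrite scalerA.
transitivity (\sum_a \sum_b \sum_c comulR H (hcomul H i) a b c *: t a b c).
  by do 3!(apply: eq_bigr => ? _); rewrite coass.
apply: eq_bigr => a _; rewrite /sw.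
under [RHS]eq_bigr => k _ do
   (rewrite scaler_sumr; under eq_bigr => b _ do rewrite scaler_sumr).
rewrite [RHS]exchange_big /=; apply: eq_bigr => b _.
rewrite [RHS]exchange_big /=; apply: eq_bigr => c _.
by rewrite scaler_suml; apply: eq_bigr => j _; rewrite scalerA.
Qed.

Lemma sw_counitl x (v : 'I_n -> V) :
  sw (D x) (fun j k => hcounit H j *: v k) = \sum_k x 0 k *: v k.
Proof.
rewrite sw_comulA; apply: eq_bigr => i _; congr (_ *: _).
case: hH => _ _ /(_ i)[+ _] _ _ => /rowP E; rewrite /sw exchange_big /=.
rewrite -[RHS](sum_ebas v); apply: eq_bigr => k _; rewrite -E summxE scaler_suml.
by apply: eq_bigr => j _; rewrite scalerA !mxE mulrC.
Qed.

Lemma sw_counitr x (v : 'I_n -> V) :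
  sw (D x) (fun j k => hcounit H k *: v j) = \sum_j x 0 j *: v j.
Proof.
rewrite sw_comulA; apply: eq_bigr => i _; congr (_ *: _).
case: hH => _ _ /(_ i)[_ +] _ _ => /rowP E; rewrite /sw.
rewrite -[RHS](sum_ebas v); apply: eq_bigr => j _; rewrite -E summxE scaler_suml.
by apply: eq_bigr => k _; rewrite scalerA !mxE mulrC.
Qed.
End Sw.

Hypothesis hS : is_antipode H.
Local Notation S := (antiA H).

Lemma sw_antil x : sw (D x) (fun j k => mul (S (e j)) (e k)) = eps x *: hunit H.
Proof.
rewrite sw_comulA /counitA scaler_suml; apply: eq_bigr => i _.
by rewrite /sw (hS i).1 scalerA.
Qed.

Lemma sw_antir x : sw (D x) (fun j k => mul (e j) (S (e k))) = eps x *: hunit H.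
Proof.
rewrite sw_comulA /counitA scaler_suml; apply: eq_bigr => i _.
by rewrite /sw (hS i).2 scalerA.
Qed.

Lemma counit_anti x : eps (S x) = eps x.
Proof.
have := congr1 eps (sw_antil x); rewrite linearZ /= counitA1 mulr1 => <-.
rewrite (@linear_sw _ _ _ F^o eps) //; last exact: counitA_is_linear.
under eq_sw => j k do rewrite counitAM counitA_ebas mulrC.
rewrite (sw_counitr _ (fun j => eps (S (e j)) : F^o)).
rewrite {1}[x]ebas_sum (linear_comb (@antiA_is_linear _ H)).
by rewrite (@linear_comb _ _ F^o eps) //; exact: counitA_is_linear.
Qed.

Lemma anti_unique (T : 'I_n -> 'rV[F]_n) :
  (forall i, sw (hcomul H i) (fun j k => mul (T j) (e k)) = hcounit H i *: hunit H) ->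
  forall i, T i = S (e i).
Proof.
move=> hT i.
have l1 x : linear (mul x) by exact: mulA_is_linear.
transitivity (sw (D (e i)) (fun j k => hcounit H k *: T j)).
  by rewrite sw_counitr sum_ebas.
transitivity (sw (D (e i)) (fun j k => sw (hcomul H k) (fun a b =>
    mul (T j) (mul (e a) (S (e b)))))).
  apply: eq_sw => j k; rewrite -linear_sw //.
  by rewrite -comulA_ebas sw_antir linearZ /= mulA1 counitA_ebas.
rewrite -sw_coassoc.
transitivity (sw (D (e i)) (fun j k => hcounit H j *: S (e k))); last first.
  by rewrite sw_counitl sum_ebas.
apply: eq_sw => j k; under eq_sw => a b do rewrite -mulAA.
rewrite -(@linear_sw _ _ _ _ (fun x => mul x (S (e k)))); last exact: mulAr_is_linear.
by rewrite hT mulAZl mul1A.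
Qed.

(* [cmap] is x (x) y |-> x y_1 (x) y_2, with left inverse
   x (x) y |-> x S(y_1) (x) y_2. *)
Definition cmap (X : 'M[F]_n) : 'M_n :=
  sw X (fun j k => sw (hcomul H k) (fun a b => tens H (mul (e j) (e a)) (e b))).

Definition cinv (X : 'M[F]_n) : 'M_n :=
  sw X (fun j k => sw (hcomul H k) (fun a b => tens H (mul (e j) (S (e a))) (e b))).

Fact cmap_is_linear : linear cmap.
Proof. by move=> a X Y; apply: swP. Qed.
HB.instance Definition _ := GRing.isLinear.Build F _ _ *:%R cmap cmap_is_linear.

Fact cinv_is_linear : linear cinv.
Proof. by move=> a X Y; apply: swP. Qed.

Lemma cmap_tens u v :
  cmap (tens H u v) = sw (D v) (fun a b => tens H (mul u (e a)) (e b)).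
Proof.
rewrite /cmap -[RHS](@sw_tens _ _ _ (fun u v =>
  sw (D v) (fun a b => tens H (mul u (e a)) (e b)))).
- by apply: eq_sw => j k; rewrite comulA_ebas.
- by move=> x c y z; rewrite linearP swP.
- move=> y c x z; rewrite /sw scaler_sumr -big_split; apply: eq_bigr => j _ /=.
  rewrite scaler_sumr -big_split; apply: eq_bigr => k _ /=.
  by rewrite mulADl tensDl scalerDr !scalerA mulrC.
Qed.

Lemma cinv_tens u v :
  cinv (tens H u v) = sw (D v) (fun a b => tens H (mul u (S (e a))) (e b)).
Proof.
rewrite /cinv -[RHS](@sw_tens _ _ _ (fun u v =>
  sw (D v) (fun a b => tens H (mul u (S (e a))) (e b)))).
- by apply: eq_sw => j k; rewrite comulA_ebas.
- by move=> x c y z; rewrite linearP swP.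
- move=> y c x z; rewrite /sw scaler_sumr -big_split; apply: eq_bigr => j _ /=.
  rewrite scaler_sumr -big_split; apply: eq_bigr => k _ /=.
  by rewrite mulADl tensDl scalerDr !scalerA mulrC.
Qed.

Lemma cmapK X : cinv (cmap X) = X.
Proof.
have hb u v : cinv (cmap (tens H u v)) = tens H u v.
  rewrite cmap_tens (linear_sw _ _ cinv_is_linear).
  transitivity (sw (D v) (fun j k => sw (hcomul H k) (fun a b =>
     tens H (mul u (mul (e j) (S (e a)))) (e b)))).
    apply: eq_sw => j k; rewrite cinv_tens comulA_ebas.
    by apply: eq_sw => a b; rewrite mulAA.
  rewrite -sw_coassoc.
  transitivity (sw (D v) (fun j k => hcounit H j *: tens H u (e k))).
    apply: eq_sw => j k.
    rewrite -(@linear_sw _ _ _ _ (fun x => tens H (mul u x) (e k))).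
      by rewrite -comulA_ebas sw_antir linearZ /= mulA1 tensZl counitA_ebas.
    by move=> a x y; rewrite linearP tensDl.
  rewrite sw_counitl -(linear_comb (f := tens H u)); last by move=> a x y; rewrite tensDr.
  by rewrite -ebas_sum.
rewrite {1}[X](mx_tens_sum) {2}[X](mx_tens_sum) !raddf_sum /=.
have l0 := cinv_is_linear.
under eq_bigr => i _ do rewrite -[cmap _]scale1r.
rewrite (linear_comb l0); apply: eq_bigr => i _; rewrite scale1r raddf_sum /=.
under eq_bigr => j _ do rewrite linearZ.
by rewrite (linear_comb l0); apply: eq_bigr => j _; rewrite hb.
Qed.

Lemma cinv1 y : cinv (tens H (hunit H) y) = sw (D y) (fun a b => tens H (S (e a)) (e b)).
Proof. by rewrite cinv_tens; apply: eq_sw => a b; rewrite mul1A. Qed.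

End Bialgebra.

(** * Algebras spanned by group-likes *)

Section TensorAlgebra.
Variables (F : fieldType) (H : hopf F).
Local Notation n := (hdim H).
Local Notation e := (ebas H).
Local Notation mul := (mulA H).

Lemma mulT_sw X Y : mulT H X Y = sw X (fun i j => sw Y (fun k l =>
  tens H (mul (e i) (e k)) (mul (e j) (e l)))).
Proof.
apply: eq_bigr => i _; apply: eq_bigr => j _; rewrite scaler_sumr.
apply: eq_bigr => k _; rewrite scaler_sumr; apply: eq_bigr => l _.
by rewrite !mulA_ebas scalerA.
Qed.

Lemma mulTDl a X Y Z : mulT H (a *: X + Y) Z = a *: mulT H X Z + mulT H Y Z.
Proof. by rewrite !mulT_sw swP. Qed.

Lemma mulTDr a X Y Z : mulT H Z (a *: X + Y) = a *: mulT H Z X + mulT H Z Y.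
Proof.
rewrite !mulT_sw /sw scaler_sumr -big_split; apply: eq_bigr => i _ /=.
rewrite scaler_sumr -big_split; apply: eq_bigr => j _ /=.
by rewrite -![\sum_k _]/(sw _ _) swP scalerDr !scalerA mulrC.
Qed.

Lemma mulT_tens u v u' v' :
  mulT H (tens H u v) (tens H u' v') = tens H (mul u u') (mul v v').
Proof.
have L : forall u' v', linear (fun u => tens H (mul u u') v').
  by move=> x y a z t; rewrite mulADl tensDl.
rewrite mulT_sw.
transitivity (sw (tens H u v) (fun i j => tens H (mul (e i) u') (mul (e j) v'))).
  apply: eq_sw => i j.
  rewrite (sw_tens _ _ (b := fun x y => tens H (mul (e i) x) (mul (e j) y))) //.
    by move=> x a y z; rewrite linearP tensDr.
  by move=> x a y z; rewrite linearP tensDl.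
rewrite (sw_tens _ _ (b := fun x y => tens H (mul x u') (mul y v'))) //.
by move=> x a y z; rewrite mulADl tensDr.
Qed.

Lemma counitL_tens u v : counitL H (tens H u v) = counitA H u *: v.
Proof.
rewrite /counitL /counitA scaler_suml; apply: eq_bigr => j _.
by apply/rowP => k; rewrite !mxE big_ord1 !mxE mulrCA mulrA.
Qed.

Lemma counitR_tens u v : counitR H (tens H u v) = counitA H v *: u.
Proof.
rewrite /counitR /counitA scaler_suml; apply: eq_bigr => j _.
by apply/rowP => k; rewrite !mxE big_ord1 !mxE mulrA mulrC mulrA.
Qed.

Fact counitL_is_linear : linear (counitL H).
Proof.
move=> a X Y; rewrite /counitL scaler_sumr -big_split; apply: eq_bigr => j _ /=.
by rewrite linearP scalerDr !scalerA mulrC.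
Qed.

Fact counitR_is_linear : linear (counitR H).
Proof.
move=> a X Y; rewrite /counitR scaler_sumr -big_split; apply: eq_bigr => j _ /=.
by rewrite 2!linearP scalerDr !scalerA mulrC.
Qed.

Lemma comulL_tens u v a b c : comulL H (tens H u v) a b c = comulA H u a b * v 0 c.
Proof.
rewrite /comulL /comulA summxE mulr_suml; apply: eq_bigr => j _.
by rewrite tensE mxE -!mulrA (mulrC (v _ _)).
Qed.

Lemma comulR_tens u v a b c : comulR H (tens H u v) a b c = u 0 a * comulA H v b c.
Proof.
rewrite /comulR /comulA summxE mulr_sumr; apply: eq_bigr => j _.
by rewrite tensE mxE -!mulrA.
Qed.

Lemma comulLP k X Y a b c :
  comulL H (k *: X + Y) a b c = k * comulL H X a b c + comulL H Y a b c.
Proof.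
rewrite /comulL mulr_sumr -big_split; apply: eq_bigr => j _ /=.
by rewrite !mxE mulrDl mulrA.
Qed.

Lemma comulRP k X Y a b c :
  comulR H (k *: X + Y) a b c = k * comulR H X a b c + comulR H Y a b c.
Proof.
rewrite /comulR mulr_sumr -big_split; apply: eq_bigr => j _ /=.
by rewrite !mxE mulrDl mulrA.
Qed.

Lemma counitAE x : counitA H x = (x *m \col_i hcounit H i) 0 0.
Proof. by rewrite mxE; apply: eq_bigr => i _; rewrite mxE. Qed.

Lemma sub_ker_counit x : (x <= ker_counit H)%MS = (counitA H x == 0).
Proof.
rewrite /ker_counit; apply/sub_kermxP/eqP => [|h].
  by rewrite counitAE => ->; rewrite mxE.
by apply/rowP => i; rewrite ord1 -counitAE h mxE.
Qed.

Lemma sub_plusSub (K : 'M[F]_n) x :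
  (x <= plusSub H K)%MS = (x <= K)%MS && (counitA H x == 0).
Proof. by rewrite sub_capmx sub_ker_counit. Qed.

Lemma lprod_in (L K : 'M[F]_n) x y : (x <= L)%MS -> (y <= K)%MS ->
  counitA H y = 0 -> (mul x y <= lprod H L K)%MS.
Proof.
move=> /submxP[a ->] yK y0.
have /submxP[b ->] : (y <= plusSub H K)%MS by rewrite sub_plusSub yK y0 eqxx.
rewrite !mulmx_sum_row mulA_suml summx_sub // => i _.
rewrite mulAZl scalemx_sub // linear_sum summx_sub // => j _.
rewrite linearZ scalemx_sub // /lprod (sumsmx_sup i) // (sumsmx_sup j) //.
by rewrite genmxE.
Qed.

Lemma lprod_sub m (L K : 'M[F]_n) (W : 'M[F]_(m, n)) :
  (forall x y, (x <= L)%MS -> (y <= K)%MS -> counitA H y = 0 -> (mul x y <= W)%MS) ->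
  (lprod H L K <= W)%MS.
Proof.
move=> h; apply/sumsmx_subP => i _; apply/sumsmx_subP => j _; rewrite genmxE.
have := row_sub j (plusSub H K); rewrite sub_plusSub => /andP[h1 /eqP h2].
by apply: h => //; exact: row_sub.
Qed.

End TensorAlgebra.

Section GroupLikeSpan.
Variables (F : fieldType) (B : hopf F) (Q : finGroupType).
Variable b : Q -> 'rV[F]_(hdim B).
Hypothesis b_span : (1%:M <= \sum_q <<b q>>)%MS.
Hypothesis bM : forall q s, mulA B (b q) (b s) = b (q * s)%g.
Hypothesis b1 : hunit B = b 1%g.
Hypothesis bD : forall q, comulA B (b q) = tens B (b q) (b q).
Hypothesis bE : forall q, counitA B (b q) = 1.
Hypothesis bS : forall q, antiA B (b q) = b q^-1%g.

Lemma span_ext (V : lmodType F) (f g : 'rV[F]_(hdim B) -> V) :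
  linear f -> linear g -> (forall q, f (b q) = g (b q)) -> forall x, f x = g x.
Proof.
move=> lf lg fg x; have : (x <= \sum_q <<b q>>)%MS.
  by apply: submx_trans b_span; exact: submx1.
case/sub_sumsmxP => u ->.
have /fin_all_exists[c cE] q : exists c, u q *m <<b q>>%MS = c *: b q.
  by apply/sub_rVP; rewrite (submx_trans (submxMl _ _)) // genmxE.
under eq_bigr => q _ do rewrite cE.
by rewrite (linear_comb lf) (linear_comb lg); apply: eq_bigr => q _; rewrite fg.
Qed.

Lemma grouplike_hopf : is_hopf B.
Proof.
have lm x : linear (mulA B x) by exact: mulA_is_linear.
have lr y : linear (mulA B ^~ y) by exact: mulAr_is_linear.
have mA x y z : mulA B (mulA B x y) z = mulA B x (mulA B y z).
  apply: (@span_ext _ (fun x => mulA B (mulA B x y) z)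
    (fun x => mulA B x (mulA B y z))) x => [a u v|a u v|q].
  - by rewrite !mulADl.
  - by rewrite !mulADl.
  apply: (@span_ext _ (fun y => mulA B (mulA B (b q) y) z)
    (fun y => mulA B (b q) (mulA B y z))) y => [a u v|a u v|s].
  - by rewrite linearP mulADl.
  - by rewrite !mulADl linearP.
  apply: (@span_ext _ (fun y => mulA B (mulA B (b q) (b s)) y)
    (fun y => mulA B (b q) (mulA B (b s) y))) z => [a u v|a u v|t].
  - by rewrite linearP.
  - by rewrite !linearP.
  by rewrite !bM mulgA.
have ce i : hcomul B i = comulA B (ebas B i) by rewrite comulA_ebas.
split.
  split.
  - split=> // x; split.
      apply: (@span_ext _ (fun x => mulA B (hunit B) x) id) x => //.
      by move=> q; rewrite b1 bM mul1g.
    apply: (@span_ext _ (fun x => mulA B x (hunit B)) id) x => //.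
    by move=> q; rewrite b1 bM mulg1.
  - move=> i j k l; rewrite ce.
    apply: (@span_ext F^o (fun x => comulL B (comulA B x) j k l)
        (fun x => comulR B (comulA B x) j k l)) => [a u v|a u v|q].
    + by rewrite linearP comulLP.
    + by rewrite linearP comulRP.
    by rewrite bD comulL_tens comulR_tens bD !tensE mulrA.
  - move=> i; rewrite ce; split.
      apply: (@span_ext _ (fun x => counitL B (comulA B x)) id) => // [a u v|q].
        by rewrite linearP counitL_is_linear.
      by rewrite bD counitL_tens bE scale1r.
    apply: (@span_ext _ (fun x => counitR B (comulA B x)) id) => // [a u v|q].
      by rewrite linearP counitR_is_linear.
    by rewrite bD counitR_tens bE scale1r.
  - split; last by rewrite b1 bD /unitT b1.
    move=> x y.
    apply: (@span_ext _ (fun x => comulA B (mulA B x y))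
      (fun x => mulT B (comulA B x) (comulA B y))) x => [a u v|a u v|q].
    + by rewrite mulADl linearP.
    + by rewrite linearP mulTDl.
    apply: (@span_ext _ (fun y => comulA B (mulA B (b q) y))
      (fun y => mulT B (comulA B (b q)) (comulA B y))) y => [a u v|a u v|s].
    + by rewrite !linearP.
    + by rewrite linearP mulTDr.
    by rewrite bM !bD mulT_tens !bM.
  - split; last by rewrite b1 bE.
    move=> x y.
    apply: (@span_ext F^o (fun x => counitA B (mulA B x y))
       (fun x => counitA B x * counitA B y)) x => [a u v|a u v|q].
    + by rewrite mulADl linearP.
    + by rewrite linearP mulrDl -mulrA.
    apply: (@span_ext F^o (fun y => counitA B (mulA B (b q) y))
       (fun y => counitA B (b q) * counitA B y)) y => [a u v|a u v|s].
    + by rewrite !linearP.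
    + by rewrite linearP mulrDr mulrCA.
    by rewrite bM !bE mulr1.
have key (T : 'rV[F]_(hdim B) -> 'rV[F]_(hdim B) -> 'rV[F]_(hdim B)) :
    (forall x, linear (T x)) -> (forall x, linear (T ^~ x)) ->
    (forall q, T (b q) (b q) = hunit B) -> forall i,
    sw (hcomul B i) (fun j k => T (ebas B j) (ebas B k)) = hcounit B i *: hunit B.
  move=> l1 l2 h i; rewrite -comulA_ebas -counitA_ebas.
  apply: (@span_ext _ (fun x => sw (comulA B x) (fun j k => T (ebas B j) (ebas B k)))
    (fun x => counitA B x *: hunit B)) => [a u v|a u v|q].
  - by rewrite linearP swP.
  - by rewrite linearP scalerDl scalerA.
  by rewrite bD sw_tens // bE scale1r h.
move=> i; split.
  apply: (key (fun x y => mulA B (antiA B x) y)) => //.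
  - by move=> x a u v; rewrite linearP mulADl.
  - by move=> q; rewrite bS bM mulVg b1.
apply: (key (fun x y => mulA B x (antiA B y))) => //.
- by move=> x a u v; rewrite !linearP.
- by move=> q; rewrite bS bM mulgV b1.
Qed.

Lemma grouplike_cocomm : cocommutative_hopf B.
Proof.
move=> x _; apply: (@span_ext _ (fun x => (comulA B x)^T) (comulA B)) => [a u v|a u v|q].
- by rewrite !linearP.
- by rewrite linearP.
by rewrite bD /tens trmx_mul trmxK.
Qed.

End GroupLikeSpan.

(** * Normal Hopf subalgebras from group gradings *)

Section GradedStep.
Variables (F : fieldType) (H : hopf F) (hH : is_bialg H) (hS : is_antipode H).
Local Notation n := (hdim H).
Local Notation e := (ebas H).
Local Notation mul := (mulA H).
Local Notation eps := (counitA H).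
Local Notation D := (comulA H).
Local Notation S := (antiA H).

Variables (Q : finGroupType) (M : Q -> 'M[F]_n) (w : Q -> 'rV[F]_n).
Hypothesis M1 : (hunit H <= M 1%g)%MS.
Hypothesis MM : forall q s x y,
  (x <= M q)%MS -> (y <= M s)%MS -> (mul x y <= M (q * s)%g)%MS.
Hypothesis MD : forall q x, (x <= M q)%MS -> in_tens (M q) (M q) (D x).
Hypothesis Mw : forall q, (w q <= M q)%MS.
Hypothesis epsw : forall q, eps (w q) = 1.

Let lm x : linear (mul x). Proof. exact: mulA_is_linear. Qed.
Let lr x : linear (mul^~ x). Proof. exact: mulAr_is_linear. Qed.

Definition tsp m1 m2 (U : 'M[F]_(m1, n)) (V : 'M_(m2, n)) :=
  lin_mx (mulmx U^T \o mulmxr V).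

Lemma tspE m1 m2 (U : 'M[F]_(m1, n)) (V : 'M_(m2, n)) X :
  (mxvec X <= tsp U V)%MS = in_tens U V X.
Proof.
apply/submxP/in_tensP => -[Y].
  rewrite -(vec_mxK Y) mul_vec_lin => /(can_inj mxvecK) -> /=.
  by exists (vec_mx Y); rewrite mulmxA.
by move=> ->; exists (mxvec Y); rewrite mul_vec_lin /= mulmxA.
Qed.

Lemma cmap_in q s X : in_tens (M q) (M s) X -> in_tens (M (q * s)%g) (M s) (cmap X).
Proof.
case/in_tens_sum => Y ->; rewrite raddf_sum; apply: in_tens_bigsum => i _.
rewrite raddf_sum; apply: in_tens_bigsum => j _ /=; rewrite linearZ; apply: in_tensZ.
rewrite /= cmap_tens; have [Z ->] := in_tens_sum (MD (row_sub j (M s))).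
rewrite sw_sum; apply: in_tens_bigsum => k _.
rewrite sw_sum; apply: in_tens_bigsum => l _; rewrite swZ; apply: in_tensZ.
rewrite (sw_tens _ _ (b := fun x y => tens H (mul (row i (M q)) x) y)).
- by apply: tens_in; rewrite ?MM ?row_sub.
- by move=> x a y z; rewrite tensDr.
- by move=> x a y z; rewrite linearP tensDl.
Qed.

Lemma anti_graded q x : (x <= M q)%MS -> (S x <= M q^-1%g)%MS.
Proof.
move=> xq.
pose C := lin_mx (@cmap F H); pose rk s := \rank (tsp (M s) (M q)).
pose C' := lin_mx (HB.pack (@cinv F H) (GRing.isLinear.Build F _ _ *:%R _
   (@cinv_is_linear F H)) : {linear 'M[F]_n -> 'M[F]_n}).
have CC' : C *m C' = 1%:M.
  apply/row_matrixP => i; rewrite rowE mulmxA -(vec_mxK (delta_mx 0 i)).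
  by rewrite !mul_vec_lin /= cmapK // vec_mxK rowE mulmx1.
have Cfree : row_free C by apply/row_freeP; exists C'.
have sC s : (tsp (M s) (M q) *m C <= tsp (M (s * q)%g) (M q))%MS.
  apply/row_subP => i; rewrite row_mul -(vec_mxK (row i _)) mul_vec_lin tspE.
  by rewrite cmap_in // -tspE vec_mxK row_sub.
have rkS s : (rk s <= rk (s * q)%g)%N.
  by rewrite /rk -(mxrankMfree _ Cfree) mxrankS.
have rk1 m : (rk 1%g <= rk (q ^+ m)%g)%N.
  elim: m => [|m IH]; first by rewrite expg0.
  by rewrite expgSr (leq_trans IH).
have eqC : (tsp (M q^-1%g) (M q) *m C == tsp (M 1%g) (M q))%MS.
  have := sC q^-1%g; rewrite mulVg => sV.
  rewrite -(mxrank_leqif_eq sV) mxrankMfree // eqn_leq; apply/andP; split.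
    by have := rkS q^-1%g; rewrite mulVg.
  by have := rk1 (#[q]%g).-1; rewrite -invg_expg.
have /submxP[Y] : (mxvec (tens H (hunit H) x) <= tsp (M q^-1%g) (M q) *m C)%MS.
  by rewrite (eqmxP eqC) tspE tens_in.
rewrite mulmxA -(vec_mxK (Y *m _)) mul_vec_lin => /(can_inj mxvecK) E.
have : in_tens (M q^-1%g) (M q) (vec_mx (Y *m tsp (M q^-1%g) (M q))).
  by rewrite -tspE vec_mxK submxMl.
set X := vec_mx _ in E *; case/andP => _ XT.
have EX : X = sw (D x) (fun a b => tens H (S (e a)) (e b)).
  by rewrite -cinv1 // E cmapK.
suff -> : S x = (\row_j hcounit H j) *m X^T by rewrite mulmx_sub.
rewrite EX (linear_sw (f := fun X => (\row_j hcounit H j) *m X^T)); last first.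
  by move=> a U V; rewrite !linearP.
transitivity (sw (D x) (fun j k => hcounit H k *: S (e j))).
  rewrite sw_counitr // -(linear_comb (@antiA_is_linear _ H)) -?ebas_sum //.
apply: eq_sw => j k; rewrite /tens trmx_mul trmxK mulmxA.
rewrite -[hcounit H k *: _]mul_scalar_mx; congr (_ *m _).
rewrite /ebas trmx_delta [RHS]mx11_scalar [LHS]mx11_scalar; congr _%:M.
rewrite -colE !mxE eqxx mulr1n //.
Qed.

Lemma hopf_sub_M1 : hopf_sub H (M 1%g).
Proof.
split=> // [x y hx hy|x hx|x hx]; first by rewrite -[1%g]mulg1 MM.
  by apply: in_tens_tensSub; apply: MD.
by rewrite -[1%g]invg1 anti_graded.
Qed.

Definition Mtot : 'M[F]_n := (\sum_q <<M q>>)%MS.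

Lemma M_sub q : (M q <= Mtot)%MS.
Proof. by rewrite (sumsmx_sup q) // genmxE. Qed.

Lemma Mtot_dec x : (x <= Mtot)%MS ->
  exists2 y : Q -> 'rV[F]_n, x = \sum_q y q & forall q, (y q <= M q)%MS.
Proof.
case/sub_sumsmxP => u ->; exists (fun q => u q *m <<M q>>%MS) => // q.
by rewrite (submx_trans (submxMl _ _)) // genmxE.
Qed.

Lemma Mtot_mul x y : (x <= Mtot)%MS -> (y <= Mtot)%MS -> (mul x y <= Mtot)%MS.
Proof.
move=> /Mtot_dec[u -> hu] /Mtot_dec[v -> hv].
rewrite mulA_suml summx_sub // => q _; rewrite linear_sum summx_sub // => s _.
by rewrite (submx_trans _ (M_sub (q * s)%g)) // MM.
Qed.

Lemma normal_M1 : normal_in H (M 1%g) Mtot.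
Proof.
move=> h x /Mtot_dec[u -> hu] hx.
rewrite /adA -[X in (X <= _)%MS]/(sw (D _) (fun j k => mul (mul (e j) x) (S (e k)))).
rewrite linear_sum sw_sum summx_sub // => q _.
apply: (sw_in_tens (b := fun u v => mul (mul u x) (S v)) _ _ (MD (hu q))).
- by move=> y a z t; rewrite !linearP.
- by move=> y a z t; rewrite !mulADl.
move=> y z hy hz; rewrite -(mulgV q) MM ?anti_graded //.
by rewrite -[q]mulg1 MM.
Qed.

Let I := lprod H Mtot (M 1%g).

Lemma M_mod_I q x : (x <= M q)%MS -> (x - eps x *: w q <= I)%MS.
Proof.
move=> hx.
have -> : x - eps x *: w q = sw (D (w q)) (fun j k =>
    mul (e j) (mul (S (e k)) x - (eps (e k) * eps x) *: hunit H)).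
  transitivity (sw (D (w q)) (fun j k => mul (mul (e j) (S (e k))) x) -
                sw (D (w q)) (fun j k => hcounit H k *: (eps x *: e j))).
    rewrite -(@linear_sw _ _ _ _ (fun y => mul y x)) //.
    rewrite sw_antir // epsw scale1r mul1A // sw_counitr //.
    congr (_ - _); rewrite {1}[w q]ebas_sum scaler_sumr.
    by apply: eq_bigr => j _; rewrite !scalerA mulrC.
  rewrite /sw -sumrB; apply: eq_bigr => j _; rewrite -sumrB; apply: eq_bigr => k _.
  rewrite -scalerBr; congr (_ *: _); rewrite linearB /= [mul _ (_ *: _)]linearZ /= mulA1 // mulAA //.
  by rewrite counitA_ebas scalerA.
apply: (sw_in_tens (b := fun u v => mul u (mul (S v) x - (eps v * eps x) *: hunit H))
   _ _ (MD (Mw q))).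
- move=> y a z t; rewrite -linearP; congr (mul y _).
  rewrite !linearP mulADl /= mulrDl scalerDl -mulrA -scalerA scalerBr.
  by rewrite opprD addrACA.
- by move=> y a z t; rewrite mulADl.
move=> u v hu hv; apply: lprod_in; first exact: submx_trans hu (M_sub q).
  rewrite addmx_sub // -?scaleNr ?scalemx_sub //.
  by rewrite -(mulVg q) MM // anti_graded.
by rewrite linearB linearZ /= counitAM // counit_anti // counitA1 // mulr1 subrr.
Qed.

Lemma I_dec x : (x <= I)%MS -> exists2 y : Q -> 'rV[F]_n,
  x = \sum_q y q & forall q, (y q <= M q)%MS /\ eps (y q) = 0.
Proof.
have sI : (I <= \sum_q <<plusSub H (M q)>>)%MS.
  apply: lprod_sub => a b /Mtot_dec[u -> hu] hb b0.
  rewrite mulA_suml summx_sub // => q _; rewrite (sumsmx_sup q) // genmxE.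
  have := MM (hu q) hb; rewrite mulg1 sub_plusSub => -> /=.
  by rewrite counitAM // b0 mulr0 eqxx.
move=> /submx_trans/(_ sI)/sub_sumsmxP[u ->].
exists (fun q => u q *m <<plusSub H (M q)>>%MS) => // q.
have : (u q *m <<plusSub H (M q)>> <= plusSub H (M q))%MS.
  by rewrite (submx_trans (submxMl _ _)) // genmxE.
by rewrite sub_plusSub => /andP[-> /eqP].
Qed.

Lemma I_sub : (I <= Mtot)%MS.
Proof.
by apply: lprod_sub => a b ha hb _; rewrite Mtot_mul // (submx_trans hb) ?M_sub.
Qed.

Let Y := Mtot *m cokermx I.
Let d := \rank Y.
Let f : 'M[F]_(n, d) := cokermx I *m pinvmx (row_base Y).

Lemma f_full : row_full (Mtot *m f).
Proof.
rewrite /row_full eqn_leq rank_leq_col /f mulmxA -/Y.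
have e1 : Y *m pinvmx (row_base Y) *m row_base Y = Y.
  by rewrite mulmxKpV // eq_row_base.
by rewrite -[X in (X <= _)%N]/(\rank Y) -{1}e1 mxrankM_maxl.
Qed.

Lemma f_ker (x : 'rV[F]_n) : (x <= Mtot)%MS -> (x *m f == 0) = (x <= I)%MS.
Proof.
move=> hx; rewrite submxE /f mulmxA; apply/eqP/eqP => [E|->]; last by rewrite mul0mx.
have hY : (x *m cokermx I <= row_base Y)%MS by rewrite eq_row_base submxMr.
by rewrite -(mulmxKpV hY) E mul0mx.
Qed.

Let b q := w q *m f.

Lemma f_M q (x : 'rV[F]_n) : (x <= M q)%MS -> x *m f = eps x *: b q.
Proof.
move=> hx; apply/eqP; rewrite -subr_eq0 scalemxAl -mulmxBl f_ker ?M_mod_I //.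
by rewrite (submx_trans _ (M_sub q)) // addmx_sub // -scaleNr scalemx_sub.
Qed.

Lemma f_I_mul x y : (x <= I)%MS -> (y <= Mtot)%MS ->
  mul x y *m f = 0 /\ mul y x *m f = 0.
Proof.
move=> /I_dec[u -> hu] /Mtot_dec[v -> hv]; split.
  rewrite mulA_suml mulmx_suml big1 // => q _; rewrite linear_sum mulmx_suml big1 // => s _.
  have [h1 h2] := hu q; rewrite (f_M (MM h1 (hv s))) counitAM //.
  by rewrite h2 mul0r scale0r.
rewrite mulA_suml mulmx_suml big1 // => q _; rewrite linear_sum mulmx_suml big1 // => s _.
have [h1 h2] := hu s; rewrite (f_M (MM (hv q) h1)) counitAM //.
by rewrite h2 mulr0 scale0r.
Qed.

Lemma f_tens m (u v : 'rV[F]_n) (g : 'M[F]_(n, m)) :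
  g^T *m tens H u v *m g = (u *m g)^T *m (v *m g).
Proof. by rewrite /tens trmx_mul !mulmxA. Qed.

Lemma f_D q x : (x <= M q)%MS -> f^T *m D x *m f = eps x *: ((b q)^T *m b q).
Proof.
move=> hx; have [Z E] := in_tens_sum (MD hx).
have Ee : eps x = sw (D x) (fun j k => hcounit H j * hcounit H k : F^o).
  rewrite (@sw_counitl _ _ hH F^o x (fun k => hcounit H k : F^o)) //.
have Et u v : sw (tens H u v) (fun j k => hcounit H j * hcounit H k : F^o) = eps u * eps v.
  rewrite -[RHS](@sw_tens _ _ F^o (fun u v => eps u * eps v)).
  - by apply: eq_sw => j k; rewrite !counitA_ebas.
  - by move=> y a z t; rewrite linearP mulrDr mulrCA.
  - by move=> y a z t; rewrite linearP mulrDl -mulrA.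
rewrite Ee E sw_sum mulmx_sumr mulmx_suml scaler_suml; apply: eq_bigr => i _.
rewrite sw_sum mulmx_sumr mulmx_suml scaler_suml; apply: eq_bigr => j _.
rewrite swZ Et -scalemxAr -scalemxAl f_tens.
rewrite (f_M (row_sub i (M q))) (f_M (row_sub j (M q))) [(_ *: b q)^T]linearZ /=
  -scalemxAl -scalemxAr !scalerA; congr (_ *: _).
Qed.

Lemma f_S q x : (x <= M q)%MS -> S x *m f = eps x *: b q^-1%g.
Proof. by move=> hx; rewrite (f_M (anti_graded hx)) counit_anti. Qed.

Lemma graded_quotient : exists (B : hopf F) (g : 'M[F]_(n, hdim B)),
  is_quotient H Mtot I B g /\ cocommutative_hopf B.
Proof.
have /row_fullP[T TK] := f_full; pose g := T *m Mtot.
have gf : g *m f = 1%:M by rewrite /g -mulmxA.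
have gK u : (u *m g <= Mtot)%MS by rewrite /g mulmxA submxMl.
pose B := @Hopf F d (fun i j => mul (row i g) (row j g) *m f) (hunit H *m f)
  (fun i => f^T *m D (row i g) *m f) (fun i => eps (row i g))
  (fun i => S (row i g) *m f).
have BM u v : mulA B u v = mul (u *m g) (v *m g) *m f.
  rewrite (mulmx_sum_row u g) (mulmx_sum_row v g) mulA_suml mulmx_suml; apply: eq_bigr => i _.
  rewrite mulAZl -scalemxAl linear_sum mulmx_suml scaler_sumr; apply: eq_bigr => j _.
  by rewrite linearZ /= -scalemxAl scalerA.
have BD u : comulA B u = f^T *m D (u *m g) *m f.
  rewrite (mulmx_sum_row u g) [D _]linear_sum /= mulmx_sumr mulmx_suml; apply: eq_bigr => i _.
  by rewrite [D _]linearZ /= -scalemxAr -scalemxAl.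
have BE u : counitA B u = eps (u *m g).
  rewrite (mulmx_sum_row u g) [eps _]linear_sum /=; apply: eq_bigr => i _.
  by rewrite linearZ.
have BS u : antiA B u = S (u *m g) *m f.
  rewrite (mulmx_sum_row u g) [S _]linear_sum /= mulmx_suml; apply: eq_bigr => i _.
  by rewrite [S _]linearZ /= -scalemxAl.
have fgI (x : 'rV[F]_n) : (x <= Mtot)%MS -> (x *m f *m g - x <= I)%MS.
  move=> hx; rewrite -f_ker; last by rewrite addmx_sub // -?scaleN1r ?scalemx_sub.
  by rewrite mulmxBl -(mulmxA _ g f) gf mulmx1 subrr.
have dec (x : 'rV[F]_n) : (x <= Mtot)%MS -> exists2 i, (i <= I)%MS & x *m f *m g = x + i.
  by move=> /fgI h; exists (x *m f *m g - x) => //; rewrite addrCA subrr addr0.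
have mM x y : (x <= Mtot)%MS -> (y <= Mtot)%MS ->
    mulA B (x *m f) (y *m f) = mul x y *m f.
  move=> hx hy; rewrite BM; have [i hi ->] := dec x hx; have [j hj ->] := dec y hy.
  rewrite -[x]scale1r mulADl !scale1r !linearD /= !mulmxDl.
  rewrite (f_I_mul hj hx).2 (f_I_mul hi hy).1.
  by rewrite (f_I_mul hi (submx_trans hj I_sub)).1 !addr0.
have mD x : (x <= Mtot)%MS -> comulA B (x *m f) = f^T *m D x *m f.
  move=> hx; rewrite BD; have [i /I_dec[u -> hu] ->] := dec x hx.
  rewrite linearD /= mulmxDr mulmxDl [X in _ + X](_ : _ = 0) ?addr0 //.
  rewrite [D _]linear_sum /= mulmx_sumr mulmx_suml big1 // => q _.
  by have [h1 h2] := hu q; rewrite (f_D h1) h2 scale0r.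
have mE x : (x <= Mtot)%MS -> counitA B (x *m f) = eps x.
  move=> hx; rewrite BE; have [i /I_dec[u -> hu] ->] := dec x hx.
  rewrite linearD linear_sum /= big1 ?addr0 // => q _.
  by have [] := hu q.
have mS x : (x <= Mtot)%MS -> antiA B (x *m f) = S x *m f.
  move=> hx; rewrite BS; have [i /I_dec[u -> hu] ->] := dec x hx.
  rewrite linearD /= mulmxDl [X in _ + X](_ : _ = 0) ?addr0 //.
  rewrite [S _]linear_sum /= mulmx_suml big1 // => q _.
  by have [h1 h2] := hu q; rewrite (f_S h1) h2 scale0r.
have wK q : (w q <= Mtot)%MS by exact: submx_trans (Mw q) (M_sub q).
have bspan : (1%:M <= \sum_q <<b q : 'rV_(hdim B)>>)%MS.
  apply/row_subP => i; rewrite -gf row_mul.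
  have /Mtot_dec[u -> hu] : (row i g <= Mtot)%MS by rewrite rowE gK.
  rewrite mulmx_suml summx_sub // => q _; rewrite (f_M (hu q)) scalemx_sub //.
  by rewrite (sumsmx_sup q) // genmxE.
have bM q s : mulA B (b q) (b s) = b (q * s)%g.
  by rewrite mM // (f_M (MM (Mw q) (Mw s))) counitAM // !epsw mulr1 scale1r.
have b1 : hunit B = b 1%g.
  by rewrite -[hunit B]/(hunit H *m f) (f_M M1) counitA1 // scale1r.
have bD q : comulA B (b q) = tens B (b q) (b q).
  by rewrite mD // (f_D (Mw q)) epsw scale1r.
have bE q : counitA B (b q) = 1 by rewrite mE.
have bS q : antiA B (b q) = b q^-1%g.
  by rewrite mS // (f_S (Mw q)) epsw scale1r.
exists B, f; split; last exact: (grouplike_cocomm bspan bD).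
split.
- exact: (grouplike_hopf bspan).
- by split.
- exact: f_full.
apply/andP; split.
  apply/row_subP => i; have := row_sub i (Mtot :&: kermx f)%MS.
  rewrite sub_capmx => /andP[h1 /sub_kermxP h2].
  by rewrite -f_ker // h2.
rewrite sub_capmx I_sub; apply/sub_kermxP; apply/row_matrixP => i.
rewrite row_mul row0; apply/eqP; rewrite f_ker ?row_sub //.
by rewrite (submx_trans (row_sub _ _)) ?I_sub.
Qed.

End GradedStep.

(** * The twisted R-matrix in the Drinfeld double *)

(* The Drinfeld double of the group algebra F[gT]: the value at [(x, u)] is the
   coefficient of [delta_x u], and [(delta_x u) (delta_y v)] is [delta_x u v]
   when [y = x ^ u], and [0] otherwise. *)
Definition dbl (F : fieldType) (gT : finGroupType) := {ffun gT * gT -> F^o}.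
HB.instance Definition _ F gT := GRing.Lmodule.on (dbl F gT).

Section Double.
Variables (F : fieldType) (gT : finGroupType).
Local Notation D := (dbl F gT).
Implicit Types f g h : D.

Definition dmul f g : D :=
  [ffun q => \sum_v f (q.1, v) * g ((q.1 ^ v)%g, (v^-1 * q.2)%g)].

Definition sec (s : gT -> gT) : D := [ffun q => (q.2 == s q.1)%:R].

Lemma dmul_secl s g x u : dmul (sec s) g (x, u) = g ((x ^ s x)%g, ((s x)^-1 * u)%g).
Proof.
rewrite ffunE (bigD1 (s x)) //= ffunE eqxx mul1r big1 ?addr0 // => v /negPf ne.
by rewrite ffunE /= ne mul0r.
Qed.

Lemma dmulA : associative dmul.
Proof.
move=> f g h; apply/ffunP => -[x u]; rewrite !ffunE /=.
under eq_bigr => v _ do rewrite ffunE mulr_sumr.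
under [RHS]eq_bigr => v _ do rewrite ffunE mulr_suml.
rewrite [RHS]exchange_big /=; apply: eq_bigr => v _.
rewrite [RHS](reindex_inj (mulgI v)) /=; apply: eq_bigr => t _.
by rewrite mulrA mulKg -conjgM invMg mulgA.
Qed.

Lemma dmul1 : left_id (sec (fun=> 1%g)) dmul.
Proof. by move=> g; apply/ffunP => -[x u]; rewrite dmul_secl conjg1 invg1 mul1g. Qed.

Lemma d1mul : right_id (sec (fun=> 1%g)) dmul.
Proof.
move=> g; apply/ffunP => -[x u]; rewrite ffunE (bigD1 u) //= ffunE /= mulVg eqxx.
rewrite mulr1 big1 ?addr0 // => v /negPf ne; rewrite ffunE /= -eq_mulVg1 ne.
by rewrite mulr0.
Qed.

Lemma dmulDl : left_distributive dmul +%R.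
Proof.
move=> f g h; apply/ffunP => x; rewrite !ffunE -big_split; apply: eq_bigr => v _ /=.
by rewrite ffunE mulrDl.
Qed.

Lemma dmulDr : right_distributive dmul +%R.
Proof.
move=> f g h; apply/ffunP => x; rewrite !ffunE -big_split; apply: eq_bigr => v _ /=.
by rewrite ffunE mulrDr.
Qed.

Lemma d1_neq0 : sec (fun=> 1%g) != 0.
Proof.
apply/eqP => /ffunP/(_ (1%g, 1%g)); rewrite !ffunE eqxx => /eqP.
by rewrite oner_eq0.
Qed.

HB.instance Definition _ := GRing.Zmodule_isNzRing.Build D
  dmulA dmul1 d1mul dmulDl dmulDr d1_neq0.

Lemma dscaleAl (a : F) f g : a *: (f * g) = (a *: f) * g.
Proof.
apply/ffunP => x; rewrite !ffunE [LHS]scaler_sumr; apply: eq_bigr => v _.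
by rewrite ffunE; exact: mulrA.
Qed.
HB.instance Definition _ := GRing.Lmodule_isLalgebra.Build F D dscaleAl.

Lemma dscaleAr (a : F) f g : a *: (f * g) = f * (a *: g).
Proof.
apply/ffunP => x; rewrite !ffunE [LHS]scaler_sumr; apply: eq_bigr => v _.
by rewrite ffunE; exact: mulrCA.
Qed.
HB.instance Definition _ := GRing.Lalgebra_isAlgebra.Build F D dscaleAr.

Lemma secM s t : sec s * sec t = sec (fun x => s x * t (x ^ s x))%g.
Proof.
apply/ffunP => -[x u]; rewrite dmul_secl !ffunE /=; congr (nat_of_bool _)%:R.
by apply/eqP/eqP => [<-|->]; rewrite ?mulKVg ?mulKg.
Qed.

Lemma eq_sec s t : s =1 t -> sec s = sec t.
Proof. by move=> E; apply/ffunP => x; rewrite !ffunE E. Qed.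

Definition rd (V : lmodType F) x (Phi : gT -> V) f : V := \sum_u f (x, u) *: Phi u.

Lemma rd_is_linear (V : lmodType F) x (Phi : gT -> V) : linear (rd x Phi).
Proof.
move=> a f g; rewrite /rd scaler_sumr -big_split; apply: eq_bigr => u _ /=.
by rewrite !ffunE scalerDl scalerA.
Qed.

Lemma rd_sec (V : lmodType F) x (Phi : gT -> V) s : rd x Phi (sec s) = Phi (s x).
Proof.
rewrite /rd (bigD1 (s x)) //= ffunE eqxx scale1r big1 ?addr0 // => u /negPf ne.
by rewrite ffunE /= ne scale0r.
Qed.

End Double.

Lemma mul_swap (S : pzRingType) (A B C D B' C' : S) :
  A * B = C * D -> B * B' = 1 -> C' * C = 1 -> D * B' = C' * A.
Proof. by move=> E hB hC; rewrite -[D]mul1r -hC -(mulrA C') -E -!mulrA hB mulr1. Qed.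

Lemma mul_inv_eq (S : pzRingType) (A B C D A' B' C' D' : S) :
  A * B = C * D -> A * A' = 1 -> B * B' = 1 -> C' * C = 1 -> D' * D = 1 ->
  B' * A' = D' * C'.
Proof.
move=> E hA hB hC hD.
have h : C' * A = D * B' by rewrite (mul_swap E hB hC).
by rewrite -[B']mul1r -hD -(mulrA D') -h -!mulrA hA mulr1.
Qed.

(* Twists of F[gT] and their inverses, as functions on [gT * gT]; the
   identities hold in any algebra after substituting multiplicative maps. *)
Section Twist.
Variables (F : fieldType) (gT : finGroupType).
Variables (j j' : gT * gT -> F).

Definition tw_inv (j j' : gT * gT -> F) := forall (V : lmodType F) (Phi : gT -> gT -> V),
  \sum_p \sum_q (j p * j' q) *: Phi (p.1 * q.1)%g (p.2 * q.2)%g = Phi 1%g 1%g.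

Definition tw_cocycle := forall (V : lmodType F) (Phi : gT -> gT -> gT -> V),
  \sum_p \sum_q (j p * j q) *: Phi (p.1 * q.1)%g (p.1 * q.2)%g p.2 =
  \sum_p \sum_q (j p * j q) *: Phi p.1 (p.2 * q.1)%g (p.2 * q.2)%g.

Definition tw_norm (j : gT * gT -> F) := forall (V : lmodType F) (Phi : gT -> V),
  \sum_p j p *: Phi p.1 = Phi 1%g /\ \sum_p j p *: Phi p.2 = Phi 1%g.

Hypotheses (jj' : tw_inv j j') (j'j : tw_inv j' j) (jc : tw_cocycle) (jn : tw_norm j).

Lemma tw_norm_inv : tw_norm j'.
Proof.
move=> V Phi; split.
  rewrite -(j'j (fun a _ => Phi a)); apply: eq_bigr => p _.
  under eq_bigr => q _ do rewrite -scalerA.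
  by rewrite -scaler_sumr (jn (fun a => Phi (p.1 * a)%g)).1 mulg1.
rewrite -(j'j (fun _ a => Phi a)); apply: eq_bigr => p _.
under eq_bigr => q _ do rewrite -scalerA.
by rewrite -scaler_sumr (jn (fun a => Phi (p.2 * a)%g)).2 mulg1.
Qed.

Section Eval.
Variable S : algType F.
Implicit Types E : gT -> S.

Definition ev (j : gT * gT -> F) E1 E2 : S := \sum_p j p *: (E1 p.1 * E2 p.2).

Definition mmap E := E 1%g = 1 /\ forall x y, E (x * y)%g = E x * E y.
Definition ecomm E1 E2 := forall x y, E1 x * E2 y = E2 y * E1 x.
Definition emul E1 E2 := fun x => E1 x * E2 x.

Lemma evM (j1 j2 : gT * gT -> F) E1 E2 E3 E4 : ev j1 E1 E2 * ev j2 E3 E4 =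
  \sum_p \sum_q (j1 p * j2 q) *: (E1 p.1 * E2 p.2 * (E3 q.1 * E4 q.2)).
Proof.
rewrite /ev mulr_suml; apply: eq_bigr => p _; rewrite mulr_sumr.
by apply: eq_bigr => q _; rewrite -scalerAl -scalerAr scalerA.
Qed.

Lemma ev_inv (j1 j2 : gT * gT -> F) E1 E2 : tw_inv j1 j2 ->
  mmap E1 -> mmap E2 -> ecomm E1 E2 -> ev j1 E1 E2 * ev j2 E1 E2 = 1.
Proof.
move=> j12 [E11 E1M] [E21 E2M] c; rewrite evM.
rewrite -(mul1r 1) -{1}E11 -E21 -(j12 _ (fun a b => E1 a * E2 b)).
apply: eq_bigr => p _; apply: eq_bigr => q _; congr (_ *: _).
by rewrite E1M E2M !mulrA; congr (_ * _); rewrite -!mulrA c.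
Qed.

Lemma ev_comm (k : gT * gT -> F) E1 E2 z :
  (forall x, E1 x * z = z * E1 x) -> (forall x, E2 x * z = z * E2 x) ->
  ev k E1 E2 * z = z * ev k E1 E2.
Proof.
move=> c1 c2; rewrite /ev mulr_suml mulr_sumr; apply: eq_bigr => p _.
by rewrite -scalerAl -scalerAr -mulrA c2 mulrA c1 mulrA.
Qed.

Lemma ev_cocycle E1 E2 E3 : mmap E1 -> mmap E2 -> mmap E3 ->
  ecomm E1 E2 -> ecomm E1 E3 -> ecomm E2 E3 ->
  ev j (emul E1 E2) E3 * ev j E1 E2 = ev j E1 (emul E2 E3) * ev j E2 E3.
Proof.
move=> [_ E1M] [_ E2M] [_ E3M] c12 c13 c23; rewrite !evM /emul.
transitivity (\sum_p \sum_q (j p * j q) *: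
   (E1 (p.1 * q.1)%g * E2 (p.1 * q.2)%g * E3 p.2)).
  apply: eq_bigr => p _; apply: eq_bigr => q _; congr (_ *: _).
  rewrite E1M E2M -!mulrA; congr (_ * _).
  rewrite !mulrA -[_ * E3 _ * E1 _ * _]mulrA -[_ * E3 p.2 * _]mulrA.
  rewrite -[E3 _ * (_ * _)](_ : E1 q.1 * E2 q.2 * E3 p.2 = _); last first.
    by rewrite mulrA -c13 -!mulrA c23.
  by rewrite !mulrA c12.
rewrite (jc (fun a b c => E1 a * E2 b * E3 c)).
apply: eq_bigr => p _; apply: eq_bigr => q _; congr (_ *: _).
rewrite E2M E3M -!mulrA; congr (_ * (_ * _)).
by rewrite !mulrA; congr (_ * _); rewrite c23.
Qed.

Section Twisted.
Variables E1 E2 E3 : gT -> S.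
Hypotheses (m1 : mmap E1) (m2 : mmap E2) (m3 : mmap E3).
Hypotheses (c12 : ecomm E1 E2) (c13 : ecomm E1 E3) (c23 : ecomm E2 E3).

Let csym E E' : ecomm E E' -> ecomm E' E. Proof. by move=> c x y; rewrite c. Qed.

Let mm E E' : mmap E -> mmap E' -> ecomm E E' -> mmap (emul E E').
Proof.
move=> [e1 eM] [e1' eM'] c; split; first by rewrite /emul e1 e1' mulr1.
by move=> x y; rewrite /emul eM eM' -!mulrA; congr (_ * _); rewrite !mulrA c.
Qed.

Let cm E E' E'' : ecomm E E'' -> ecomm E' E'' -> ecomm (emul E E') E''.
Proof. by move=> c c' x y; rewrite /emul -mulrA c' mulrA c mulrA. Qed.

Let evC k E E' E'' : ecomm E E' -> ev k (emul E E') E'' = ev k (emul E' E) E''.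
Proof. by move=> c; apply: eq_bigr => p _; rewrite /emul c. Qed.

Let evC' k E E' E'' : ecomm E E' -> ev k E'' (emul E E') = ev k E'' (emul E' E).
Proof. by move=> c; apply: eq_bigr => p _; rewrite /emul c. Qed.

Lemma ev_cocycle_inv :
  ev j' E2 E3 * ev j' E1 (emul E2 E3) = ev j' E1 E2 * ev j' (emul E1 E2) E3.
Proof.
have c21 := csym c12; have c31 := csym c13.
apply: (@mul_inv_eq _ (ev j E1 (emul E2 E3)) (ev j E2 E3)
            (ev j (emul E1 E2) E3) (ev j E1 E2)).
  - by rewrite (ev_cocycle m1 m2 m3).
  - by apply: ev_inv => //; [exact: mm | exact: csym (cm c21 c31)].
  - exact: ev_inv.
  - by apply: ev_inv => //; [exact: mm | exact: cm].
  - exact: ev_inv.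
Qed.

(* In both lemmas [w] is an untwisted R-matrix and [j'(x,y) w j(y,x)] the
   inverse of the twisted one. *)
Lemma twisted_mul w23 w13 :
  (forall x, E1 x * w23 = w23 * E1 x) ->
  (forall x, E2 x * E3 x * w23 = w23 * (E2 x * E3 x)) ->
  (forall x, E2 x * w13 = w13 * E2 x) ->
  (forall x, E1 x * E3 x * w13 = w13 * (E1 x * E3 x)) ->
  (ev j' E2 E3 * w23 * ev j E3 E2) * (ev j' E1 E3 * w13 * ev j E3 E1) =
  ev j' E1 E2 * (ev j' (emul E1 E2) E3 * (w23 * w13) * ev j E3 (emul E1 E2)) *
  ev j E1 E2.
Proof.
move=> k1 k23 k2 k13.
have c21 := csym c12; have c31 := csym c13; have c32 := csym c23.
have a1 : ev j E3 E2 * ev j' E1 E3 = ev j' E1 (emul E2 E3) * ev j (emul E1 E3) E2.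
  apply: (@mul_swap _ _ (ev j E1 E3) (ev j E1 (emul E2 E3))).
  - by rewrite (ev_cocycle m1 m3 m2) // (evC' _ _ c23).
  - exact: ev_inv.
  - by apply: ev_inv => //; [exact: mm | exact: csym (cm c21 c31)].
have a2 := ev_cocycle_inv.
have a3 : ev j (emul E1 E3) E2 * ev j E3 E1 = ev j E3 (emul E1 E2) * ev j E1 E2.
  by rewrite (evC _ _ c13) (ev_cocycle m3 m1 m2).
have b1 : w23 * ev j' E1 (emul E2 E3) = ev j' E1 (emul E2 E3) * w23.
  by rewrite ev_comm.
have b2 : w13 * ev j (emul E1 E3) E2 = ev j (emul E1 E3) E2 * w13.
  by rewrite ev_comm.
rewrite !mulrA -[_ * ev j E3 E2 * _]mulrA a1 !mulrA.
rewrite -[_ * w23 * ev _ _ _]mulrA b1 !mulrA a2.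
by rewrite -[_ * _ * w13]mulrA -b2 -!mulrA a3 !mulrA.
Qed.

Lemma twisted_comul w12 w13 :
  (forall x, E3 x * w12 = w12 * E3 x) ->
  (forall x, E1 x * E2 x * w12 = w12 * (E1 x * E2 x)) ->
  (forall x, E2 x * w13 = w13 * E2 x) ->
  (forall x, E1 x * E3 x * w13 = w13 * (E1 x * E3 x)) ->
  (ev j' E1 E2 * w12 * ev j E2 E1) * (ev j' E1 E3 * w13 * ev j E3 E1) =
  ev j' E2 E3 * (ev j' E1 (emul E2 E3) * (w12 * w13) * ev j (emul E2 E3) E1) *
  ev j E2 E3.
Proof.
move=> k3 k12 k2 k13.
have c21 := csym c12; have c31 := csym c13; have c32 := csym c23.
have a1 : ev j E2 E1 * ev j' E1 E3 = ev j' (emul E1 E2) E3 * ev j E2 (emul E1 E3).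
  apply: (@mul_swap _ _ (ev j E1 E3) (ev j (emul E1 E2) E3)).
  - by rewrite (evC _ _ c12) (ev_cocycle m2 m1 m3).
  - exact: ev_inv.
  - by apply: ev_inv => //; [exact: mm | exact: cm].
have a2 := esym ev_cocycle_inv.
have a3 : ev j E2 (emul E1 E3) * ev j E3 E1 = ev j (emul E2 E3) E1 * ev j E2 E3.
  by rewrite (evC' _ _ c13) -(ev_cocycle m2 m3 m1).
have b1 : w12 * ev j' (emul E1 E2) E3 = ev j' (emul E1 E2) E3 * w12.
  by rewrite ev_comm.
have b2 : w13 * ev j E2 (emul E1 E3) = ev j E2 (emul E1 E3) * w13.
  by rewrite ev_comm.
rewrite !mulrA -[_ * ev j E2 E1 * _]mulrA a1 !mulrA.
rewrite -[_ * w12 * ev _ _ _]mulrA b1 !mulrA a2.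
by rewrite -[_ * _ * w13]mulrA -b2 -!mulrA a3 !mulrA.
Qed.
End Twisted.
End Eval.
End Twist.

Section Reading.
Variables (F : fieldType) (gT : finGroupType) (V : lmodType F).
Implicit Types (f g : dbl F gT) (Phi : gT -> V).

Lemma rd_mul x Phi f g :
  rd x Phi (f * g) = rd x (fun u => rd (x ^ u)%g (fun v => Phi (u * v)%g) g) f.
Proof.
rewrite /rd; under eq_bigr => u _ do rewrite ffunE scaler_suml.
rewrite exchange_big /=; apply: eq_bigr => v _; rewrite scaler_sumr.
rewrite (reindex_inj (mulgI v)) /=; apply: eq_bigr => u _.
by rewrite mulKg scalerA.
Qed.

Definition csec (u : gT) : dbl F gT := sec F (fun=> u).

Lemma csecM u v : csec u * csec v = csec (u * v)%g.
Proof. exact: secM. Qed.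

Lemma rd_ev (hT : finGroupType) x Phi k (a b : hT -> gT) :
  rd x Phi (ev k (fun u => csec (a u)) (fun u => csec (b u))) =
  \sum_p k p *: Phi (a p.1 * b p.2)%g.
Proof.
rewrite (linear_comb (rd_is_linear x Phi)); apply: eq_bigr => p _.
by rewrite csecM rd_sec.
Qed.

Lemma rd_conj (hT : finGroupType) x Phi k k' (a b c d : hT -> gT) f :
  rd x Phi (ev k (fun u => csec (a u)) (fun u => csec (b u)) * f *
            ev k' (fun u => csec (c u)) (fun u => csec (d u))) =
  \sum_p k p *: \sum_q k' q *:
    rd (x ^ (a p.1 * b p.2))%g (fun u => Phi (a p.1 * b p.2 * u * (c q.1 * d q.2))%g) f.
Proof.
rewrite -mulrA rd_mul rd_ev; apply: eq_bigr => p _; congr (_ *: _).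
rewrite rd_mul /rd; under eq_bigr => u _ do rewrite -/(rd _ _ _) rd_ev scaler_sumr.
rewrite exchange_big; apply: eq_bigr => q _ /=; rewrite scaler_sumr.
by apply: eq_bigr => u _; rewrite !scalerA mulrC mulgA.
Qed.

Lemma rd_conj_sec (hT : finGroupType) x Phi k k' (a b c d : hT -> gT) s :
  rd x Phi (ev k (fun u => csec (a u)) (fun u => csec (b u)) * sec F s *
            ev k' (fun u => csec (c u)) (fun u => csec (d u))) =
  \sum_p k p *: \sum_q k' q *:
    Phi (a p.1 * b p.2 * s (x ^ (a p.1 * b p.2)) * (c q.1 * d q.2))%g.
Proof.
rewrite rd_conj; apply: eq_bigr => p _; congr (_ *: _).
by apply: eq_bigr => q _; rewrite rd_sec.
Qed.
End Reading.

Section TwistedR.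
Variables (F : fieldType) (gT : finGroupType) (j j' : gT * gT -> F).
Hypotheses (jj' : tw_inv j j') (j'j : tw_inv j' j) (jc : tw_cocycle j) (jn : tw_norm j).

(* With [J^-1 = \sum j' p p.1 (x) p.2] and [J = \sum j q q.1 (x) q.2], the tensor
   [J^-1 (\sum_h delta_h (x) h) J_21] is the sum over [k] of the
   [delta_k p.1 q.2 (x) p.2 (k ^ p.1) q.1]; [wread k] applies a bilinear map to
   its [delta_k] component. *)
Definition wread (V : lmodType F) k (Psi : gT -> gT -> V) : V :=
  \sum_p j' p *: \sum_q j q *: Psi (p.1 * q.2)%g (p.2 * (k ^ p.1) * q.1)%g.

Lemma eq_wr (V : lmodType F) k (Psi Psi' : gT -> gT -> V) :
  (forall u g, Psi u g = Psi' u g) -> wread k Psi = wread k Psi'.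
Proof.
by move=> E; apply: eq_bigr => p _; congr (_ *: _); apply: eq_bigr => q _; rewrite E.
Qed.

Local Notation G3 := (gT * gT * gT)%type.
Let E1 (x : gT) : dbl F G3 := csec F ((x, 1), 1)%g.
Let E2 (x : gT) : dbl F G3 := csec F ((1, x), 1)%g.
Let E3 (x : gT) : dbl F G3 := csec F ((1, 1), x)%g.
Let w13 : dbl F G3 := sec F (fun x => ((1, 1), x.1.1)%g).
Let w23 : dbl F G3 := sec F (fun x => ((1, 1), x.1.2)%g).
Let w12 : dbl F G3 := sec F (fun x => ((1, x.1.1), 1)%g).

Let G3eq (a b : G3) : a.1.1 = b.1.1 -> a.1.2 = b.1.2 -> a.2 = b.2 -> a = b.
Proof. by case: a b => [[? ?] ?] [[? ?] ?] /= -> -> ->. Qed.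

Ltac sec_tac := rewrite /emul /E1 /E2 /E3 /w12 /w13 /w23 /csec ?secM;
  apply: eq_sec => ?; apply: G3eq; rewrite /= ?(invg1, mul1g, mulg1) -?conjgC //=.

Let m1 : mmap E1. Proof. by split => // x y; sec_tac. Qed.
Let m2 : mmap E2. Proof. by split => // x y; sec_tac. Qed.
Let m3 : mmap E3. Proof. by split => // x y; sec_tac. Qed.
Let c12 : ecomm E1 E2. Proof. by move=> x y; sec_tac. Qed.
Let c13 : ecomm E1 E3. Proof. by move=> x y; sec_tac. Qed.
Let c23 : ecomm E2 E3. Proof. by move=> x y; sec_tac. Qed.

Let ev_ext k (A B A' B' : gT -> dbl F G3) : A =1 A' -> B =1 B' -> ev k A B = ev k A' B'.
Proof. by move=> a b; apply: eq_bigr => p _; rewrite a b. Qed.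

Lemma wr_mul (V : lmodType F) k k' (Phi : gT -> gT -> gT -> V) :
  wread k' (fun u' g' => wread k (fun u g => Phi u u' (g' * g)%g)) =
  \sum_p j' p *: \sum_q j q *: wread ((k' ^ p.2) * (k ^ p.1))%g
     (fun v g => Phi (p.1 * v * q.1)%g (p.2 * v * q.2)%g g).
Proof.
have T : (ev j' E2 E3 * w23 * ev j E3 E2) * (ev j' E1 E3 * w13 * ev j E3 E1) =
  ev j' E1 E2 * (ev j' (emul E1 E2) E3 * (w23 * w13) * ev j E3 (emul E1 E2)) *
  ev j E1 E2.
  by apply: (twisted_mul jj' j'j jc) => // x; sec_tac.
have e12 : emul E1 E2 =1 fun x => csec F ((x, x), 1)%g by move=> x; sec_tac.
rewrite (ev_ext _ e12 (frefl _)) (ev_ext _ (frefl _) e12) in T.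
have {T} := congr1 (rd ((k, k'), 1)%g (fun t : G3 => Phi t.1.1 t.1.2 t.2)) T.
rewrite /E1 /E2 /E3 /w23 /w13 rd_mul rd_conj_sec rd_conj secM => T.
move: T; set L := LHS; set R := RHS => T.
transitivity L.
  apply: eq_bigr => p _; congr (_ *: _); apply: eq_bigr => q _; congr (_ *: _).
  rewrite rd_conj_sec; apply: eq_bigr => p' _; congr (_ *: _).
  by apply: eq_bigr => q' _; congr (_ *: Phi _ _ _); rewrite /= ?(invg1, mul1g, mulg1).
rewrite T; apply: eq_bigr => p _; congr (_ *: _).
apply: eq_bigr => q _; congr (_ *: _).
rewrite rd_conj_sec; apply: eq_bigr => p' _; congr (_ *: _).
apply: eq_bigr => q' _; congr (_ *: Phi _ _ _);
  rewrite /= /conjg ?(invg1, mul1g, mulg1) ?(invMg, mulgA, mulgK) //.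
Qed.

Lemma wr_comul (V : lmodType F) k (Phi : gT -> gT -> gT -> V) :
  wread k (fun u g => wread (k ^ u)%g (fun u' g' => Phi (u * u')%g g g')) =
  \sum_p j' p *: \sum_q j q *: wread k
     (fun u g => Phi u (p.1 * g * q.1)%g (p.2 * g * q.2)%g).
Proof.
have T : (ev j' E1 E2 * w12 * ev j E2 E1) * (ev j' E1 E3 * w13 * ev j E3 E1) =
  ev j' E2 E3 * (ev j' E1 (emul E2 E3) * (w12 * w13) * ev j (emul E2 E3) E1) *
  ev j E2 E3.
  by apply: (twisted_comul jj' j'j jc) => // x; sec_tac.
have e23 : emul E2 E3 =1 fun x => csec F ((1, x), x)%g by move=> x; sec_tac.
rewrite (ev_ext _ e23 (frefl _)) (ev_ext _ (frefl _) e23) in T.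
have {T} := congr1 (rd ((k, 1), 1)%g (fun t : G3 => Phi t.1.1 t.1.2 t.2)) T.
rewrite /E1 /E2 /E3 /w12 /w13 rd_mul rd_conj_sec rd_conj secM => T.
move: T; set L := LHS; set R := RHS => T.
transitivity L.
  apply: eq_bigr => p _; congr (_ *: _); apply: eq_bigr => q _; congr (_ *: _).
  rewrite rd_conj_sec; apply: eq_bigr => p' _; congr (_ *: _).
  apply: eq_bigr => q' _; congr (_ *: Phi _ _ _);
  by rewrite /= /conjg ?(invg1, mul1g, mulg1) ?(invMg, mulgA, mulgK).
rewrite T; apply: eq_bigr => p _; congr (_ *: _).
apply: eq_bigr => q _; congr (_ *: _).
rewrite rd_conj_sec; apply: eq_bigr => p' _; congr (_ *: _).
apply: eq_bigr => q' _; congr (_ *: Phi _ _ _);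
  rewrite /= /conjg ?(invg1, mul1g, mulg1) ?(invMg, mulgA, mulgK) //.
Qed.

Lemma wrP (V : lmodType F) k a (Psi Psi' : gT -> gT -> V) :
  wread k (fun u g => a *: Psi u g + Psi' u g) = a *: wread k Psi + wread k Psi'.
Proof.
rewrite /wread scaler_sumr -big_split; apply: eq_bigr => p _ /=.
rewrite scalerA mulrC -scalerA -scalerDr; congr (_ *: _).
rewrite scaler_sumr -big_split; apply: eq_bigr => q _ /=.
by rewrite scalerDr !scalerA mulrC.
Qed.

Let jn' : tw_norm j' := tw_norm_inv j'j jn.

Lemma wr_counit (V : lmodType F) k (Phi : gT -> V) : wread k (fun u _ => Phi u) = Phi 1%g.
Proof.
rewrite /wread -[RHS](jn' Phi).1; apply: eq_bigr => p _; congr (_ *: _).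
by rewrite (jn (fun a => Phi (p.1 * a)%g)).2 mulg1.
Qed.

Lemma wr_forget (V : lmodType F) k (Phi : gT -> V) :
  wread k (fun _ g => Phi g) = \sum_p j' p *: Phi (p.2 * (k ^ p.1))%g.
Proof.
apply: eq_bigr => p _; congr (_ *: _).
by rewrite (jn (fun a => Phi (p.2 * (k ^ p.1) * a)%g)).1 mulg1.
Qed.

Lemma wr1_forget (V : lmodType F) (Phi : gT -> V) : wread 1%g (fun _ g => Phi g) = Phi 1%g.
Proof.
rewrite wr_forget -[RHS](jn' Phi).2.
by apply: eq_bigr => p _; rewrite conj1g mulg1.
Qed.

(* Reads the inverse cocycle identity
   (Delta (x) id)(J^-1) = J_12 J^-1_23 (id (x) Delta)(J^-1)
   through x (x) y (x) z |-> z y^-1 k x. *)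
Lemma wr_forget_factor (V : lmodType F) k (Phi : gT -> V) :
  wread k (fun _ g => Phi g) =
  \sum_q j q *: \sum_p j' p *: Phi (p.2 * p.1^-1 * (q.2^-1 * k * q.1))%g.
Proof.
have T : ev j' (emul E1 E2) E3 = ev j E1 E2 * (ev j' E2 E3 * ev j' E1 (emul E2 E3)).
  by rewrite (ev_cocycle_inv jj' j'j jc m1 m2 m3) // mulrA ev_inv // mul1r.
have e12 : emul E1 E2 =1 fun x => csec F ((x, x), 1)%g by move=> x; sec_tac.
have e23 : emul E2 E3 =1 fun x => csec F ((1, x), x)%g by move=> x; sec_tac.
rewrite (ev_ext _ e12 (frefl _)) (ev_ext _ (frefl _) e23) in T.
have {T} := congr1 (rd (1%g : G3) (fun t : G3 => Phi (t.2 * t.1.2^-1 * k * t.1.1)%g)) T.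
rewrite /E1 /E2 /E3 !rd_mul !rd_ev; set L := LHS; set R := RHS => T.
rewrite wr_forget; transitivity L.
  apply: eq_bigr => p _; congr (_ *: Phi _).
  by rewrite /= /conjg ?(invg1, mul1g, mulg1) ?(invMg, mulgA).
rewrite T; apply: eq_bigr => q _; congr (_ *: _).
rewrite rd_mul rd_ev; apply: eq_bigr => p _; congr (_ *: _).
rewrite rd_ev.
transitivity (\sum_r j' r *: Phi (p.2 * p.1^-1 * (q.2^-1 * k * q.1) * r.1)%g); last first.
  by rewrite (jn' (fun a => Phi (p.2 * p.1^-1 * (q.2^-1 * k * q.1) * a)%g)).1 mulg1.
apply: eq_bigr => r _; congr (_ *: Phi _).
by rewrite /= /conjg ?(invg1, mul1g, mulg1) ?(invMg, mulgA, mulgK, mulgKV).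
Qed.

Lemma wr_span (V : lmodType F) (Phi : gT -> V) h :
  \sum_p j p *: \sum_s j' s *:
    wread (s.2^-1 * (p.2^-1 * p.1 * h) * s.1)%g (fun _ g => Phi g) = Phi h.
Proof.
pose T m := \sum_p j' p *: Phi (p.2 * p.1^-1 * m)%g.
transitivity (\sum_p j p *: T (p.2^-1 * p.1 * h)%g).
  apply: eq_bigr => p _; congr (_ *: _).
  transitivity (\sum_s \sum_q (j' s * j q) *:
     T ((s.2 * q.2)^-1 * (p.2^-1 * p.1 * h) * (s.1 * q.1))%g).
    apply: eq_bigr => s _; rewrite wr_forget_factor scaler_sumr; apply: eq_bigr => q _.
    by rewrite scalerA /T; congr (_ *: _); apply: eq_bigr => r _; rewrite invMg !mulgA.
  rewrite (j'j (fun a b => T (b^-1 * (p.2^-1 * p.1 * h) * a)%g)).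
  by rewrite invg1 mul1g mulg1.
have := wr1_forget (fun g => Phi (g * h)%g); rewrite mul1g => <-.
rewrite wr_forget_factor; apply: eq_bigr => q _; congr (_ *: _).
by apply: eq_bigr => p _; rewrite mulg1 !mulgA.
Qed.
End TwistedR.

(** * Twisted group algebras *)

Section MulTAssoc.
Variables (F : fieldType) (H : hopf F).

Lemma mx_ext (V : lmodType F) (f g : 'M[F]_(hdim H) -> V) : linear f -> linear g ->
  (forall u v, f (tens H u v) = g (tens H u v)) -> forall X, f X = g X.
Proof.
move=> lf lg fg X; rewrite (mx_tens_sum X).
under eq_bigr => i _ do rewrite -[\sum_j _]scale1r.
rewrite (linear_comb lf) (linear_comb lg); apply: eq_bigr => i _.
rewrite (linear_comb lf) (linear_comb lg); congr (_ *: _).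
by apply: eq_bigr => j _; rewrite fg.
Qed.

Lemma mulTA : associative (mulA H) -> associative (mulT H).
Proof.
move=> mA X Y Z.
apply: (@mx_ext _ (fun X => mulT H X (mulT H Y Z)) (fun X => mulT H (mulT H X Y) Z)) X
  => [a x y|a x y|u v]; rewrite ?mulTDl //.
apply: (@mx_ext _ (fun Y => mulT H (tens H u v) (mulT H Y Z))
  (fun Y => mulT H (mulT H (tens H u v) Y) Z)) Y => [a x y|a x y|u' v'];
  rewrite ?(mulTDl, mulTDr) //.
apply: (@mx_ext _ (fun Z => mulT H (tens H u v) (mulT H (tens H u' v') Z))
  (fun Z => mulT H (mulT H (tens H u v) (tens H u' v')) Z)) Z => [a x y|a x y|u'' v''];
  rewrite ?(mulTDl, mulTDr) //.
by rewrite !mulT_tens !mA.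
Qed.

Lemma mul1T : left_id (hunit H) (mulA H) -> left_id (unitT H) (mulT H).
Proof.
move=> h; apply: (@mx_ext _ (mulT H (unitT H)) id) => // [a x y|u v].
  by rewrite mulTDr.
by rewrite /unitT mulT_tens !h.
Qed.

Lemma mulT1 : right_id (hunit H) (mulA H) -> right_id (unitT H) (mulT H).
Proof.
move=> h; apply: (@mx_ext _ (fun X => mulT H X (unitT H)) id) => // [a x y|u v].
  by rewrite mulTDl.
by rewrite /unitT mulT_tens !h.
Qed.
End MulTAssoc.

Section GroupAlgebra.
Variables (F : fieldType) (gT : finGroupType).
Local Notation H := (groupalg F gT).
Local Notation n := (hdim H).

Definition gbas (g : gT) : 'rV[F]_n := ebas H (enum_rank g).

Lemma be_mul g h : mulA H (gbas g) (gbas h) = gbas (g * h)%g.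
Proof. by rewrite mulA_ebas /= !enum_rankK. Qed.

Lemma hunit_be : hunit H = gbas 1%g. Proof. by []. Qed.

Lemma ebas_be i : ebas H i = gbas (enum_val i).
Proof. by rewrite /gbas enum_valK. Qed.

Lemma be_comul g : comulA H (gbas g) = tens H (gbas g) (gbas g).
Proof. by rewrite comulA_ebas tens_ebas. Qed.

Lemma be_counit g : counitA H (gbas g) = 1.
Proof. by rewrite counitA_ebas. Qed.

Lemma be_anti g : antiA H (gbas g) = gbas g^-1%g.
Proof. by rewrite antiA_ebas /= enum_rankK. Qed.

Lemma sum_rank (V : nmodType) (f : 'I_n -> V) : \sum_i f i = \sum_g f (enum_rank g).
Proof. by rewrite (reindex (@enum_rank gT)) //; exact/onW_bij/enum_rank_bij. Qed.

Lemma be_sum (x : 'rV[F]_n) : x = \sum_g x 0 (enum_rank g) *: gbas g.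
Proof.
by rewrite {1}[x]ebas_sum sum_rank.
Qed.

Lemma be_span : (1%:M <= \sum_g <<gbas g>>)%MS.
Proof.
apply/row_subP => i; rewrite row1 -[delta_mx 0 i]/(ebas H i) ebas_be.
by rewrite (sumsmx_sup (enum_val i)) // genmxE.
Qed.

Lemma groupalg_hopf : is_hopf H.
Proof.
exact: (grouplike_hopf be_span be_mul hunit_be be_comul be_counit be_anti).
Qed.

Lemma sw_pair (V : lmodType F) X (t : 'I_n -> 'I_n -> V) :
  sw (H := H) X t = \sum_(p : gT * gT) X (enum_rank p.1) (enum_rank p.2) *:
    t (enum_rank p.1) (enum_rank p.2).
Proof.
rewrite /sw sum_rank; under eq_bigr => g _ do rewrite sum_rank.
by rewrite pair_bigA.
Qed.

Definition tw (X : 'M[F]_n) (p : gT * gT) : F := X (enum_rank p.1) (enum_rank p.2).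

Lemma tens_sum (X : 'M[F]_n) : X = \sum_p tw X p *: tens H (gbas p.1) (gbas p.2).
Proof.
rewrite -(sw_pair X (fun i j => tens H (ebas H i) (ebas H j))).
exact: mx_tens_sum.
Qed.

Lemma sw_tens_be (V : lmodType F) g h (t : 'I_n -> 'I_n -> V) :
  sw (tens H (gbas g) (gbas h)) t = t (enum_rank g) (enum_rank h).
Proof. by rewrite tens_ebas sw_delta. Qed.

Lemma mulT_pair X Y : mulT H X Y = \sum_p \sum_q (tw X p * tw Y q) *:
  tens H (gbas (p.1 * q.1)%g) (gbas (p.2 * q.2)%g).
Proof.
rewrite mulT_sw sw_pair; apply: eq_bigr => p _; rewrite sw_pair scaler_sumr.
by apply: eq_bigr => q _; rewrite scalerA !be_mul.
Qed.

Lemma tw_invP X Y : mulT H X Y = unitT H -> tw_inv (tw X) (tw Y).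
Proof.
move=> E V Phi.
have := congr1 (fun X => sw (H := H) X (fun i j => Phi (enum_val i) (enum_val j))) E.
rewrite /unitT hunit_be sw_tens_be !enum_rankK => <-.
rewrite mulT_pair sw_sum; apply: eq_bigr => p _; rewrite sw_sum; apply: eq_bigr => q _.
by rewrite swZ sw_tens_be !enum_rankK.
Qed.

Lemma tw_normP X : counitL H X = hunit H -> counitR H X = hunit H -> tw_norm (tw X).
Proof.
move=> hL hR V Phi; pose f (x : 'rV[F]_n) := \sum_i x 0 i *: Phi (enum_val i).
have lf : linear f.
  move=> a x y; rewrite /f scaler_sumr -big_split; apply: eq_bigr => i _ /=.
  by rewrite !mxE scalerDl scalerA.
have fb g : f (gbas g) = Phi g by rewrite /f sum_ebas enum_rankK.
split.
  rewrite -[RHS]fb -hunit_be -hR (tens_sum X).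
  rewrite (linear_comb (counitR_is_linear (H:=H))) (linear_comb lf).
  apply: eq_bigr => p _; rewrite -tens_sum counitR_tens be_counit scale1r fb //.
rewrite -[RHS]fb -hunit_be -hL (tens_sum X).
rewrite (linear_comb (counitL_is_linear (H:=H))) (linear_comb lf).
by apply: eq_bigr => p _; rewrite -tens_sum counitL_tens be_counit scale1r fb.
Qed.

Definition sw3 (V : lmodType F) (X : t3 H) (t : gT -> gT -> gT -> V) : V :=
  \sum_a \sum_b \sum_c X (enum_rank a) (enum_rank b) (enum_rank c) *: t a b c.

Lemma sum_hmul (V : lmodType F) (g h : gT) (f : gT -> V) :
  \sum_a (hmul H (enum_rank g) (enum_rank h)) 0 (enum_rank a) *: f a = f (g * h)%g.
Proof.
rewrite (bigD1 (g * h)%g) //= !enum_rankK mxE !eqxx scale1r big1 ?addr0 // => a ne.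
by rewrite mxE eqxx (inj_eq enum_rank_inj) (negPf ne) scale0r.
Qed.

Lemma sum3 (V : nmodType) (f : gT * gT * gT -> V) :
  \sum_i f i = \sum_a \sum_b \sum_c f (a, b, c).
Proof.
rewrite (pair_bigA _ (fun a b => \sum_c f (a, b, c))).
by rewrite pair_bigA; apply: eq_bigr => -[[a b] c].
Qed.

Lemma sw3_mul3 (V : lmodType F) X Y (t : gT -> gT -> gT -> V) :
  sw3 (mul3 H X Y) t = sw3 X (fun a b c => sw3 Y (fun a' b' c' =>
     t (a * a')%g (b * b')%g (c * c')%g)).
Proof.
pose r := @enum_rank gT.
have E a b c : mul3 H X Y (r a) (r b) (r c) =
  \sum_(i : gT * gT * gT) \sum_(k : gT * gT * gT)
   X (r i.1.1) (r i.1.2) (r i.2) * Y (r k.1.1) (r k.1.2) (r k.2) *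
   (hmul H (r i.1.1) (r k.1.1)) 0 (r a) * (hmul H (r i.1.2) (r k.1.2)) 0 (r b) *
   (hmul H (r i.2) (r k.2)) 0 (r c).
  rewrite sum3 /=.
  rewrite /mul3 sum_rank; apply: eq_bigr => i _.
  rewrite sum_rank; apply: eq_bigr => i' _.
  rewrite sum_rank; apply: eq_bigr => i'' _.
  rewrite sum3 /=.
  rewrite sum_rank; apply: eq_bigr => k _.
  rewrite sum_rank; apply: eq_bigr => k' _.
  by rewrite sum_rank; apply: eq_bigr => k'' _.
rewrite /sw3.
transitivity (\sum_(s : gT * gT * gT) \sum_(i : gT * gT * gT) \sum_(k : gT * gT * gT)
   (X (r i.1.1) (r i.1.2) (r i.2) * Y (r k.1.1) (r k.1.2) (r k.2) *
   (hmul H (r i.1.1) (r k.1.1)) 0 (r s.1.1) * (hmul H (r i.1.2) (r k.1.2)) 0 (r s.1.2) *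
   (hmul H (r i.2) (r k.2)) 0 (r s.2)) *: t s.1.1 s.1.2 s.2).
  rewrite sum3 /=.
  do 3!(apply: eq_bigr => ? _); rewrite E scaler_suml.
  by apply: eq_bigr => i _; rewrite scaler_suml.
rewrite exchange_big sum3 /=.
apply: eq_bigr => i _; apply: eq_bigr => i' _; apply: eq_bigr => i'' _.
rewrite exchange_big sum3 /=.
rewrite scaler_sumr; apply: eq_bigr => k _; rewrite scaler_sumr; apply: eq_bigr => k' _.
rewrite scaler_sumr; apply: eq_bigr => k'' _.
rewrite sum3 /=.
rewrite scalerA -(sum_hmul _ _ (fun a => t a _ _)) scaler_sumr; apply: eq_bigr => a _.
rewrite -(sum_hmul _ _ (fun a => t _ a _)) !scaler_sumr; apply: eq_bigr => b _.
rewrite -(sum_hmul _ _ (fun a => t _ _ a)) !scaler_sumr; apply: eq_bigr => c _.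
by rewrite !scalerA.
Qed.

Lemma sum_delta (V : lmodType F) (g : gT) (f : gT -> V) :
  \sum_a (enum_rank a == enum_rank g)%:R *: f a = f g.
Proof.
rewrite (bigD1 g) //= eqxx scale1r big1 ?addr0 // => a ne.
by rewrite (inj_eq enum_rank_inj) (negPf ne) scale0r.
Qed.

Lemma sw3_comulL (V : lmodType F) X (t : gT -> gT -> gT -> V) :
  sw3 (comulL H X) t = \sum_p tw X p *: t p.1 p.1 p.2.
Proof.
rewrite -(pair_bigA _ (fun a b => tw X (a, b) *: t a a b)) /=; apply: eq_bigr => a _.
rewrite exchange_big; apply: eq_bigr => c _ /=.
rewrite -(sum_delta a (fun b => t a b c)) scaler_sumr; apply: eq_bigr => b _.
rewrite /comulL sum_rank (bigD1 a) //= big1 ?addr0 => [|i /negPf ne].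
  by rewrite mxE eqxx scalerA.
by rewrite mxE (inj_eq enum_rank_inj) eq_sym ne mulr0.
Qed.

Lemma sw3_comulR (V : lmodType F) X (t : gT -> gT -> gT -> V) :
  sw3 (comulR H X) t = \sum_p tw X p *: t p.1 p.2 p.2.
Proof.
rewrite -(pair_bigA _ (fun a b => tw X (a, b) *: t a b b)) /=; apply: eq_bigr => a _.
apply: eq_bigr => b _ /=.
rewrite -(sum_delta b (fun c => t a b c)) scaler_sumr; apply: eq_bigr => c _.
rewrite /comulR sum_rank (bigD1 b) //= big1 ?addr0 => [|i /negPf ne].
  by rewrite mxE eqxx scalerA.
by rewrite mxE (inj_eq enum_rank_inj) eq_sym ne mulr0.
Qed.

Lemma sw3_tensL1 (V : lmodType F) X (t : gT -> gT -> gT -> V) :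
  sw3 (tensL1 H X) t = \sum_p tw X p *: t p.1 p.2 1%g.
Proof.
rewrite -(pair_bigA _ (fun a b => tw X (a, b) *: t a b 1%g)) /=; apply: eq_bigr => a _.
apply: eq_bigr => b _ /=.
rewrite -(sum_delta 1%g (fun c => t a b c)) scaler_sumr; apply: eq_bigr => c _.
by rewrite /tensL1 mxE eqxx scalerA.
Qed.

Lemma sw3_tens1R (V : lmodType F) X (t : gT -> gT -> gT -> V) :
  sw3 (tens1R H X) t = \sum_p tw X p *: t 1%g p.1 p.2.
Proof.
transitivity (\sum_b \sum_c tw X (b, c) *: t 1%g b c); last by rewrite pair_bigA.
rewrite /sw3 -(sum_delta 1%g (fun a => \sum_b \sum_c tw X (b, c) *: t a b c)).
apply: eq_bigr => a _; rewrite scaler_sumr; apply: eq_bigr => b _.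
rewrite scaler_sumr; apply: eq_bigr => c _.
by rewrite /tens1R mxE eqxx scalerA.
Qed.

Lemma tw_cocycleP X :
  (forall a b c, mul3 H (comulL H X) (tensL1 H X) a b c
               = mul3 H (comulR H X) (tens1R H X) a b c) ->
  tw_cocycle (tw X).
Proof.
move=> E V Phi.
have : sw3 (mul3 H (comulL H X) (tensL1 H X)) Phi =
       sw3 (mul3 H (comulR H X) (tens1R H X)) Phi.
  by do 3!(apply: eq_bigr => ? _); rewrite E.
rewrite !sw3_mul3 sw3_comulL sw3_comulR => E'.
transitivity (\sum_p tw X p *: \sum_q tw X q *:
   Phi (p.1 * q.1)%g (p.1 * q.2)%g (p.2 * 1)%g).
  apply: eq_bigr => p _; rewrite scaler_sumr; apply: eq_bigr => q _.
  by rewrite scalerA mulg1.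
under eq_bigr => p _ do rewrite -(sw3_tensL1 X (fun a b c =>
  Phi (p.1 * a)%g (p.1 * b)%g (p.2 * c)%g)).
rewrite E'; apply: eq_bigr => p _; rewrite sw3_tens1R scaler_sumr.
by apply: eq_bigr => q _; rewrite scalerA mulg1.
Qed.

End GroupAlgebra.

Section TwistedGroupAlgebra.
Variables (F : fieldType) (gT : finGroupType).
Local Notation H := (groupalg F gT).
Local Notation n := (hdim H).
Variables (J Jinv : 'M[F]_n) (hJ : is_twist H J Jinv) (S : 'I_n -> 'rV[F]_n).
Local Notation A := (twisted H J Jinv S).
Local Notation be := (@gbas F gT).
Local Notation wr := (wread (tw J) (tw Jinv)).

Let jj' : tw_inv (tw J) (tw Jinv). Proof. by apply: tw_invP; case: hJ => [[]]. Qed.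
Let j'j : tw_inv (tw Jinv) (tw J). Proof. by apply: tw_invP; case: hJ => [[]]. Qed.
Let jc : tw_cocycle (tw J). Proof. by apply: tw_cocycleP; case: hJ. Qed.
Let jn : tw_norm (tw J). Proof. by apply: tw_normP; case: hJ => _ _ []. Qed.

Lemma linear_wr (V W : lmodType F) (f : V -> W) k (Psi : gT -> gT -> V) :
  linear f -> f (wr k Psi) = wr k (fun u g => f (Psi u g)).
Proof.
move=> lf; rewrite /wread (linear_comb lf); apply: eq_bigr => p _.
by rewrite (linear_comb lf).
Qed.

Lemma wr_lincomb (V : lmodType F) (I : Type) r (P : pred I) (c : I -> F) k
    (Psi : I -> gT -> gT -> V) :
  wr k (fun u g => \sum_(i <- r | P i) c i *: Psi i u g) =
  \sum_(i <- r | P i) c i *: wr k (Psi i).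
Proof.
elim: r => [|i r IH].
  rewrite big_nil /wread big1 // => p _; rewrite big1 ?scaler0 // => q _.
  by rewrite big_nil scaler0.
rewrite big_cons; case: ifP => Pi; last first.
  by rewrite -IH; apply: eq_wr => u g; rewrite big_cons Pi.
by rewrite -IH -wrP; apply: eq_wr => u g; rewrite big_cons Pi.
Qed.

Lemma comulA_beE g :
  comulA A (be g) = mulT H (mulT H Jinv (tens H (be g) (be g))) J.
Proof. by rewrite tens_ebas; exact: comulA_ebas. Qed.

Lemma comulA_be g : comulA A (be g) =
  \sum_p tw Jinv p *: \sum_q tw J q *:
    tens H (be (p.1 * g * q.1)%g) (be (p.2 * g * q.2)%g).
Proof.
rewrite comulA_beE [Jinv in LHS]tens_sum [J in LHS]tens_sum.
have l1 Y : linear (fun X => mulT H X Y) by move=> a X Z; rewrite mulTDl.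
have l2 Y : linear (mulT H Y) by move=> a X Z; rewrite mulTDr.
rewrite (linear_comb (l1 _)) (linear_comb (l1 _)); apply: eq_bigr => p _; congr (_ *: _).
rewrite mulT_tens (linear_comb (l2 _)); apply: eq_bigr => q _; congr (_ *: _).
by rewrite mulT_tens !be_mul.
Qed.

Lemma wr_comulA (V : lmodType F) k (Xi : gT -> 'M[F]_n -> V) :
  (forall u, linear (Xi u)) ->
  wr k (fun u g => Xi u (comulA A (be g))) =
  wr k (fun u g => wr (k ^ u)%g (fun u' g' => Xi (u * u')%g (tens H (be g) (be g')))).
Proof.
move=> lX.
rewrite (wr_comul jj' j'j jc k (fun u g h => Xi u (tens H (be g) (be h)))).
transitivity (wr k (fun u g => \sum_p tw Jinv p *: \sum_q tw J q *:
   Xi u (tens H (be (p.1 * g * q.1)%g) (be (p.2 * g * q.2)%g)))).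
  apply: eq_wr => u g; rewrite comulA_be (linear_comb (lX u)); apply: eq_bigr => p _.
  by rewrite (linear_comb (lX u)).
rewrite wr_lincomb; apply: eq_bigr => p _; congr (_ *: _).
by rewrite wr_lincomb.
Qed.

Definition theta k (phi : gT -> F) : 'rV[F]_n := wr k (fun u g => phi u *: be g).

Lemma theta_ext (V : lmodType F) (f g : 'rV[F]_n -> V) : linear f -> linear g ->
  (forall k phi, f (theta k phi) = g (theta k phi)) -> forall x, f x = g x.
Proof.
move=> lf lg fg x; rewrite [x]be_sum (linear_comb lf) (linear_comb lg).
apply: eq_bigr => h _; congr (_ *: _).
rewrite -(wr_span jj' j'j jc jn be h) (linear_comb lf) (linear_comb lg).
apply: eq_bigr => p _; congr (_ *: _).
rewrite (linear_comb lf) (linear_comb lg); apply: eq_bigr => s _; congr (_ *: _).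
have E k : wr k (fun _ g => be g) = theta k (fun=> 1).
  by apply: eq_wr => u a; rewrite scale1r.
by rewrite E fg.
Qed.

Lemma theta_mul k k' phi phi' :
  mulA H (theta k' phi') (theta k phi) =
  \sum_p tw Jinv p *: \sum_q tw J q *:
    theta ((k' ^ p.2) * (k ^ p.1))%g
      (fun v => phi (p.1 * v * q.1)%g * phi' (p.2 * v * q.2)%g).
Proof.
rewrite -(wr_mul jj' j'j jc k k' (fun u u' g => (phi u * phi' u') *: be g)).
rewrite [in LHS]/theta (linear_wr (f := fun x => mulA H x (theta k phi))); last first.
  by move=> a x y; rewrite mulADl.
apply: eq_wr => u' g'; rewrite mulAZl /theta linear_wr; last exact: mulA_is_linear.
rewrite (linear_wr (f := fun x => phi' u' *: x)); last first.
  by move=> a x y; rewrite scalerDr !scalerA mulrC.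
by apply: eq_wr => u g; rewrite linearZ /= be_mul scalerA mulrC.
Qed.

Lemma theta_comul k phi :
  comulA A (theta k phi) = wr k (fun u g => wr (k ^ u)%g (fun u' g' =>
    phi (u * u')%g *: tens H (be g) (be g'))).
Proof.
rewrite -(wr_comulA k (Xi := fun u X => phi u *: X)).
  rewrite /theta (linear_wr _ _ (@comulA_is_linear F A)).
  by apply: eq_wr => u g; rewrite linearZ.
by move=> u a X Y; rewrite scalerDr !scalerA mulrC.
Qed.

Lemma theta_counit k phi : counitA A (theta k phi) = phi 1%g.
Proof.
rewrite /theta (@linear_wr _ F^o (counitA A)); last exact: counitA_is_linear.
rewrite -[RHS](wr_counit j'j jn k (phi : gT -> F^o)); apply: (@eq_wr _ _ _ _ F^o) => u g.
rewrite linearZ /= -[counitA A (be g)]/(counitA H (be g)) be_counit.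
exact: mulr1.
Qed.

Lemma theta_one : theta 1%g (fun=> 1) = hunit A.
Proof.
rewrite -[hunit A]/(be 1%g) -(wr1_forget j'j jn).
by apply: eq_wr => u g; rewrite scale1r.
Qed.

Lemma groupalg_mulA : associative (mulA H).
Proof. by move=> x y z; case: (groupalg_hopf F gT) => [[[h _]]]; rewrite h. Qed.

Lemma groupalg_mul1 : left_id (hunit H) (mulA H) /\ right_id (hunit H) (mulA H).
Proof. by split=> x; case: (groupalg_hopf F gT) => [[[_ /(_ x)[]]]]. Qed.

Lemma twisted_bialg : is_bialg A.
Proof.
have [u1 u2] := groupalg_mul1; have tA := mulTA groupalg_mulA.
have [JJ' J'J] : mulT H J Jinv = unitT H /\ mulT H Jinv J = unitT H by case: hJ.
have hG := groupalg_hopf F gT.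
have ce i : hcomul A i = comulA A (ebas A i) by rewrite comulA_ebas.
split.
- by case: hG => [[[]]].
- move=> i a b c; rewrite ce.
  apply: (@theta_ext F^o (fun x => comulL A (comulA A x) a b c)
    (fun x => comulR A (comulA A x) a b c)) => [t x y|t x y|k phi].
  + by rewrite linearP comulLP.
  + by rewrite linearP comulRP.
  rewrite !theta_comul.
  have lL : linear (fun X => comulL A X a b c : F^o) by move=> t x y; rewrite comulLP.
  have lR : linear (fun X => comulR A X a b c : F^o) by move=> t x y; rewrite comulRP.
  rewrite (linear_wr _ _ lL) (linear_wr _ _ lR).
  pose Xi u (X : 'M[F]_n) : F^o := wr (k ^ u)%g (fun u' g' =>
     (phi (u * u')%g * (X a b * (be g') 0 c)) : F^o).
  pose Xi' u g u' (X : 'M[F]_n) : F^o := phi (u * u')%g * ((be g) 0 a * X b c).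
  have lXi u : linear (Xi u).
    move=> t X Y; rewrite /Xi -wrP; apply: (@eq_wr _ _ _ _ F^o) => v g; rewrite !mxE.
    by rewrite mulrDl mulrDr -mulrA mulrCA.
  have lXi' u g u' : linear (Xi' u g u').
    move=> t X Y; rewrite /Xi' !mxE.
    by rewrite !mulrDr; congr (_ + _); rewrite (mulrCA _ t) (mulrCA _ t).
  transitivity (wr k (fun u g => Xi u (comulA A (be g)))).
    apply: (@eq_wr _ _ _ _ F^o) => u g; rewrite (linear_wr _ _ lL).
    apply: (@eq_wr _ _ _ _ F^o) => u' g'.
    by rewrite (linear_scale lL) comulL_tens.
  rewrite (wr_comulA _ lXi); apply: (@eq_wr _ _ _ _ F^o) => u g.
  rewrite (linear_wr _ _ lR).
  transitivity (wr (k ^ u)%g (fun u' g' => Xi' u g u' (comulA A (be g')))).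
    rewrite (wr_comulA _ (lXi' u g)); apply: (@eq_wr _ _ _ _ F^o) => u' g'.
    rewrite /Xi conjgM; apply: (@eq_wr _ _ _ _ F^o) => u'' g''.
    by rewrite /Xi' !tensE mulgA !mulrA.
  apply: (@eq_wr _ _ _ _ F^o) => u' g'.
  by rewrite (linear_scale lR) comulR_tens.
- move=> i; rewrite ce; split.
    apply: (@theta_ext _ (fun x => counitL A (comulA A x)) id) => // [a x y|k phi].
      by rewrite linearP counitL_is_linear.
    rewrite theta_comul (linear_wr _ _ (@counitL_is_linear F A)).
    transitivity (wr k (fun u _ => wr (k ^ u)%g (fun u' g' => phi (u * u')%g *: be g'))).
      apply: eq_wr => u g; rewrite (linear_wr _ _ (@counitL_is_linear F A)).
      apply: eq_wr => u' g'; rewrite (linear_scale (@counitL_is_linear F A)).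
      by rewrite counitL_tens -[counitA A _]/(counitA H _) be_counit scale1r.
    rewrite wr_counit // conjg1; apply: eq_wr => u g; by rewrite mul1g.
  apply: (@theta_ext _ (fun x => counitR A (comulA A x)) id) => // [a x y|k phi].
    by rewrite linearP counitR_is_linear.
  rewrite theta_comul (linear_wr _ _ (@counitR_is_linear F A)).
  apply: eq_wr => u g; rewrite (linear_wr _ _ (@counitR_is_linear F A)).
  transitivity (wr (k ^ u)%g (fun u' _ => phi (u * u')%g *: be g)).
    apply: eq_wr => u' g'; rewrite (linear_scale (@counitR_is_linear F A)).
    by rewrite counitR_tens -[counitA A _]/(counitA H _) be_counit scale1r.
  by rewrite (wr_counit j'j jn _ (fun u' => phi (u * u')%g *: be g)) mulg1.
- split; last first.
    rewrite -[hunit A]/(be 1%g) comulA_beE -[tens H _ _]/(unitT H).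
    by rewrite (mulT1 u2) J'J.
  move=> x y.
  apply: (@span_ext _ H _ _ (@be_span F gT) _ (fun x => comulA A (mulA A x y))
     (fun x => mulT A (comulA A x) (comulA A y))) x => [a u v|a u v|g].
  + by rewrite mulADl linearP.
  + by rewrite linearP mulTDl.
  apply: (@span_ext _ H _ _ (@be_span F gT) _ (fun y => comulA A (mulA A (be g) y))
     (fun y => mulT A (comulA A (be g)) (comulA A y))) y => [a u v|a u v|h].
  + by rewrite !linearP.
  + by rewrite linearP mulTDr.
  rewrite -[mulA A _ _]/(mulA H (be g) (be h)) be_mul !comulA_beE.
  rewrite -[mulT A _ _]/(mulT H _ _) -be_mul -mulT_tens.
  by rewrite -!tA (tA J) JJ' (mul1T u1).
- by case: hG => [[_ _ _ _ [h1 h2]] _].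
Qed.
End TwistedGroupAlgebra.

Section EquivariantSubspaces.
Variables (F : fieldType) (gT : finGroupType).
Local Notation H := (groupalg F gT).
Local Notation n := (hdim H).
Variables (J Jinv : 'M[F]_n) (hJ : is_twist H J Jinv) (S : 'I_n -> 'rV[F]_n).
Local Notation A := (twisted H J Jinv S).
Local Notation be := (@gbas F gT).
Local Notation wr := (wread (tw J) (tw Jinv)).
Local Notation theta := (theta J Jinv).

Definition eqv (Z : {set gT}) (chi phi : gT -> F) :=
  forall z v, z \in Z -> phi (z * v)%g = chi z * phi v.

Definition eqv_defect (chi : gT -> F) z : 'M[F]_n := \matrix_(i, l)
  ((enum_val i == (z * enum_val l)%g)%:R - (i == l)%:R * chi z).

Definition eqv_mx (Z : {set gT}) (chi : gT -> F) : 'M[F]_n :=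
  (\bigcap_(z in Z) kermx (eqv_defect chi z))%MS.

Lemma eqv_mxP Z chi (x : 'rV[F]_n) :
  reflect (eqv Z chi (fun g => x 0 (enum_rank g))) (x <= eqv_mx Z chi)%MS.
Proof.
have E z (l : 'I_n) : (x *m eqv_defect chi z) 0 l =
    x 0 (enum_rank (z * enum_val l)%g) - chi z * x 0 l.
  rewrite mxE; under eq_bigr => i _ do rewrite mxE mulrBr.
  rewrite sumrB; congr (_ - _).
    rewrite (bigD1 (enum_rank (z * enum_val l)%g)) //= enum_rankK eqxx mulr1.
    rewrite big1 ?addr0 // => i ne; rewrite -(inj_eq enum_rank_inj) enum_valK.
    by rewrite (negPf ne) mulr0.
  rewrite (bigD1 l) //= eqxx mul1r mulrC big1 ?addr0 // => i /negPf ->.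
  by rewrite mul0r mulr0.
apply: (iffP sub_bigcapmxP) => [h z v zZ|h z zZ].
  have /sub_kermxP/rowP/(_ (enum_rank v)) := h z zZ.
  by rewrite E enum_rankK mxE => /eqP; rewrite subr_eq0 => /eqP.
apply/sub_kermxP/rowP => l; rewrite E mxE h // enum_valK.
exact: subrr.
Qed.

Definition theta_mx k : 'M[F]_n := \matrix_i theta k (fun g => (g == enum_val i)%:R).

Lemma mul_theta_mx k (x : 'rV[F]_n) :
  x *m theta_mx k = theta k (fun g => x 0 (enum_rank g)).
Proof.
rewrite mulmx_sum_row; under eq_bigr => i _ do rewrite rowK.
rewrite /theta -wr_lincomb; apply: eq_wr => u g.
rewrite (bigD1 (enum_rank u)) //= enum_rankK eqxx scale1r big1 ?addr0 // => i ne.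
by rewrite -(inj_eq enum_rank_inj) enum_valK eq_sym (negPf ne) scale0r scaler0.
Qed.

Lemma theta_dec k phi :
  theta k phi = \sum_v phi v *: theta k (fun g => (g == v)%:R).
Proof.
rewrite /theta -wr_lincomb; apply: eq_wr => u g.
rewrite (bigD1 u) //= eqxx scale1r big1 ?addr0 // => i ne.
by rewrite eq_sym (negPf ne) scale0r scaler0.
Qed.

Lemma wr_sum (V : lmodType F) (I : finType) k (Psi : I -> gT -> gT -> V) :
  wr k (fun u g => \sum_i Psi i u g) = \sum_i wr k (Psi i).
Proof.
under [RHS]eq_bigr => i _ do rewrite -[wr k _]scale1r.
rewrite -wr_lincomb; apply: eq_wr => u g.
by apply: eq_bigr => i _; rewrite scale1r.
Qed.

Definition equiv_sub (C Z : {set gT}) (chi : gT -> F) : 'M[F]_n :=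
  (\sum_(k in C) <<eqv_mx Z chi *m theta_mx k>>)%MS.

Lemma esub_in (C Z : {set gT}) chi k phi : k \in C -> eqv Z chi phi ->
  (theta k phi <= equiv_sub C Z chi)%MS.
Proof.
move=> kC ephi; pose x : 'rV[F]_n := \row_i phi (enum_val i).
have Ex : (fun g => x 0 (enum_rank g)) =1 phi by move=> g; rewrite mxE enum_rankK.
rewrite /equiv_sub (sumsmx_sup k) // genmxE.
have -> : theta k phi = x *m theta_mx k.
  by rewrite mul_theta_mx; apply: eq_wr => u g; rewrite Ex.
by rewrite submxMr //; apply/eqv_mxP => z v zZ; rewrite !Ex ephi.
Qed.

Lemma esub_dec (C Z : {set gT}) chi (x : 'rV[F]_n) : (x <= equiv_sub C Z chi)%MS ->
  exists2 phi : gT -> gT -> F, x = \sum_(k in C) theta k (phi k) &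
    forall k, eqv Z chi (phi k).
Proof.
case/sub_sumsmxP => u ->.
have /fin_all_exists[y yE] k : exists y : 'rV[F]_n,
    u k *m <<eqv_mx Z chi *m theta_mx k>>%MS = y *m theta_mx k /\ (y <= eqv_mx Z chi)%MS.
  have : (u k *m <<eqv_mx Z chi *m theta_mx k>> <= eqv_mx Z chi *m theta_mx k)%MS.
    by rewrite (submx_trans (submxMl _ _)) // genmxE.
  by case/submxP => y ->; exists (y *m eqv_mx Z chi); rewrite mulmxA submxMl.
exists (fun k g => y k 0 (enum_rank g)) => [|k].
  by apply: eq_bigr => k _; rewrite (yE k).1 mul_theta_mx.
exact/eqv_mxP/(yE k).2.
Qed.

Lemma esub_sub m (W : 'M[F]_(m, n)) (C Z : {set gT}) chi :
  (forall k phi, k \in C -> eqv Z chi phi -> (theta k phi <= W)%MS) ->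
  (equiv_sub C Z chi <= W)%MS.
Proof.
move=> h; apply/row_subP => i; have /esub_dec[phi -> hphi] := row_sub i (equiv_sub C Z chi).
by rewrite summx_sub // => k kC; apply: h.
Qed.

Definition esub_ok (C Z : {set gT}) (chi : gT -> F) :=
  [/\ forall k g, k \in C -> (k ^ g)%g \in C,
      forall z g, z \in Z -> (z ^ g)%g \in Z /\ chi (z ^ g)%g = chi z
    & forall z k, z \in Z -> k \in C -> (k ^ z)%g = k].

Lemma eqv_shift (C Z : {set gT}) chi phi u v : esub_ok C Z chi -> eqv Z chi phi ->
  eqv Z chi (fun x => phi (u * x * v)%g).
Proof.
move=> [_ hZ _] hphi z x zZ; have [z1 z2] := hZ z u^-1%g zZ.
have -> : (u * (z * x) * v = z ^ u^-1 * (u * x * v))%g.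
  by rewrite conjgE invgK !mulgA mulgKV.
by rewrite hphi // z2.
Qed.

Lemma esub_mul (C C' C'' Z : {set gT}) chi chi' chi'' x y :
  esub_ok C Z chi -> esub_ok C' Z chi' ->
  (forall k' k, k' \in C' -> k \in C -> (k' * k)%g \in C'') ->
  (forall z, z \in Z -> chi'' z = chi' z * chi z) ->
  (x <= equiv_sub C' Z chi')%MS -> (y <= equiv_sub C Z chi)%MS ->
  (mulA A x y <= equiv_sub C'' Z chi'')%MS.
Proof.
move=> ok ok' CC cc /esub_dec[phi' -> hphi'] /esub_dec[phi -> hphi].
rewrite mulA_suml summx_sub // => k' k'C; rewrite linear_sum summx_sub // => k kC /=.
change (mulA A) with (mulA H); rewrite theta_mul //.
rewrite summx_sub // => p _; rewrite scalemx_sub // summx_sub // => q _.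
rewrite scalemx_sub //; apply: esub_in.
  by apply: CC; [case: ok' | case: ok] => h _ _; apply: h.
move=> z v zZ; rewrite (eqv_shift _ _ ok (hphi k)) // (eqv_shift _ _ ok' (hphi' k')) //.
by rewrite cc // mulrACA (mulrC (chi' z)).
Qed.

Lemma wr_ind (V : lmodType F) (P : V -> Prop) k (Psi : gT -> gT -> V) :
  P 0 -> (forall a x y, P x -> P y -> P (a *: x + y)) ->
  (forall u g, P (Psi u g)) -> P (wr k Psi).
Proof.
move=> P0 PD h; have PZ a x : P x -> P (a *: x).
  by move=> Px; rewrite -[_ *: _]addr0; apply: PD.
have PS (I : finType) (f : I -> V) : (forall i, P (f i)) -> P (\sum_i f i).
  move=> hf; elim/big_ind: _ => // x y; rewrite -{2}[x]scale1r; exact: PD.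
by apply: (PS) => p; apply: (PZ); apply: (PS) => q; apply: (PZ).
Qed.

Lemma esub_comul (C Z : {set gT}) chi x : esub_ok C Z chi -> (x <= equiv_sub C Z chi)%MS ->
  in_tens (equiv_sub C Z chi) (equiv_sub C Z chi) (comulA A x).
Proof.
move=> ok; have [okC okZ okCZ] := ok => /esub_dec[phi -> hphi].
rewrite linear_sum in_tens_bigsum // => k kC /=.
have l1 g : linear (tens H (be g)) by move=> a y z; rewrite tensDr.
have l2 y : linear (fun x => tens H x y) by move=> a z t; rewrite tensDl.
have -> : comulA A (theta k (phi k)) =
    wr k (fun u g => tens H (be g) (theta (k ^ u)%g (fun v => phi k (u * v)%g))).
  rewrite theta_comul //; apply: eq_wr => u g.
  rewrite [in RHS]/theta (linear_wr _ _ _ _ (l1 g)); apply: eq_wr => u' g'.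
  by rewrite (linear_scale (l1 g)).
apply/andP; split.
  apply: (wr_ind (P := fun X : 'M[F]_n => (X <= equiv_sub C Z chi)%MS)).
  - exact: sub0mx.
  - by move=> a X Y hX hY; rewrite addmx_sub // scalemx_sub.
  move=> u g; rewrite /tens mulmx_sub // esub_in ?okC // => z v zZ.
  by have := eqv_shift u 1%g ok (hphi k) v zZ; rewrite !mulg1.
pose r m v' : 'rV[F]_n := theta m (fun u' => (u' == v')%:R).
have -> : wr k (fun u g => tens H (be g) (theta (k ^ u)%g (fun v => phi k (u * v)%g))) =
  \sum_m \sum_v' tens H (theta k (fun u => ((k ^ u)%g == m)%:R * phi k (u * v')%g))
                        (r m v').
  transitivity (wr k (fun u g => \sum_m \sum_v'
     (((k ^ u)%g == m)%:R * phi k (u * v')%g) *: tens H (be g) (r m v'))).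
    apply: eq_wr => u g; rewrite (bigD1 (k ^ u)%g) //= [X in _ + X]big1 ?addr0; last first.
      move=> m ne; rewrite big1 // => v' _.
      by rewrite eq_sym (negPf ne) mul0r scale0r.
    rewrite theta_dec (linear_comb (l1 g)); apply: eq_bigr => v' _.
    by rewrite eqxx mul1r.
  rewrite wr_sum; apply: eq_bigr => m _; rewrite wr_sum; apply: eq_bigr => v' _.
  rewrite [in RHS]/theta (linear_wr _ _ _ _ (l2 _)); apply: eq_wr => u g.
  by rewrite (linear_scale (l2 _)).
rewrite !linear_sum summx_sub // => m _; rewrite linear_sum summx_sub // => v' _.
rewrite /= /tens trmx_mul trmxK mulmx_sub // esub_in // => z u zZ.
have := eqv_shift 1%g v' ok (hphi k) u zZ; rewrite !mul1g => ->.
by rewrite conjgM (okCZ z k zZ kC) mulrCA.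
Qed.

Lemma esub_one (C Z : {set gT}) chi : 1%g \in C -> (forall z, z \in Z -> chi z = 1) ->
  (hunit A <= equiv_sub C Z chi)%MS.
Proof.
by move=> C1 c1; rewrite -(theta_one hJ S) esub_in // => z v /c1 ->; rewrite mulr1.
Qed.

Lemma esub_counit (C Z : {set gT}) chi (k : gT) : k \in C ->
  1%g \in Z -> chi 1%g = 1 ->
  (forall z z', z \in Z -> (z' \in Z) = ((z * z')%g \in Z)) ->
  (forall z z', z \in Z -> z' \in Z -> chi (z * z')%g = chi z * chi z') ->
  exists2 w, (w <= equiv_sub C Z chi)%MS & counitA A w = 1.
Proof.
move=> kC Z1 c1 ZM cM; exists (theta k (fun v => (v \in Z)%:R * chi v)); last first.
  by rewrite theta_counit // Z1 c1 mulr1.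
rewrite esub_in // => z v zZ; rewrite -(ZM z v zZ); case: (boolP (v \in Z)) => [vZ|_].
  by rewrite !mul1r cM.
by rewrite !mul0r mulr0.
Qed.

Lemma esub_total : (1%:M <= equiv_sub setT [set 1%g] (fun=> 1))%MS.
Proof.
set W := equiv_sub _ _ _.
suff E : forall x : 'rV[F]_n, x *m cokermx W = 0.
  by apply/row_subP => i; rewrite submxE E.
apply: (@theta_ext _ _ _ _ hJ _ (fun x : 'rV[F]_n => x *m cokermx W) (fun=> 0)).
- by move=> a x y; rewrite mulmxDl scalemxAl.
- by move=> a x y; rewrite scaler0 addr0.
move=> k phi; apply/eqP; rewrite -submxE esub_in // => z v /set1P ->.
by rewrite !mul1g mul1r.
Qed.

End EquivariantSubspaces.

(** * Central series and the lower normal series *)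

Section CentralSeries.
Local Open Scope group_scope.
Variable gT : finGroupType.
Local Notation G := [set: gT]%G.

Definition central_step (N N' : {group gT}) :=
  [/\ N \subset N', (N <| G)%g, (N' <| G)%g, ([~: N', G] \subset N)%g
    & prime #|N' : N|%g].

Lemma central_step_exists (N : {group gT}) : nilpotent G -> (N <| G)%g ->
  N :!=: G -> exists N' : {group gT}, central_step N N'.
Proof.
move=> nilG nN NG; have nT (X : {set gT}) : X \subset 'N(N)%g.
  by rewrite (subset_trans (subsetT X)) // normal_norm.
have nilQ : nilpotent (G / N)%g by rewrite quotient_nil.
have Z1 : ('Z(G / N) != 1)%g.
  rewrite center_nil_eq1 //; apply: contra NG => /eqP E.
  rewrite eqEsubset subsetT /= -quotient_sub1 ?nT //.
  by rewrite E.
have [x xZ ox] : exists2 x, (x \in 'Z(G / N))%g & prime #[x]%g.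
  have pp : prime (pdiv #|'Z(G / N)%g|) by rewrite pdiv_prime // cardG_gt1.
  by have [x xZ ox] := Cauchy pp (pdiv_dvd _); exists x; rewrite // ox.
have xG : (<[x]> \subset G / N)%g.
  by rewrite cycle_subG (subsetP (center_sub _)).
have qE : (coset N @*^-1 <[x]> / N = <[x]>)%g.
  by rewrite cosetpreK.
have sN : N \subset (coset N @*^-1 <[x]>)%g by rewrite sub_cosetpre.
have nN' : (coset N @*^-1 <[x]> <| G)%g.
  have := cosetpre_normal <[x]>%G (G / N)%G.
  rewrite quotientGK // => ->.
  by apply: sub_center_normal; rewrite cycle_subG.
exists (coset N @*^-1 <[x]>)%G; split=> //.
  rewrite -quotient_cents2 ?nT // qE.
  have := subset_trans _ (subset_trans (subsetIr _ _) (subxx _)).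
  by rewrite cycle_subG; move: xZ => /setIP[].
by rewrite -card_quotient ?nT // qE.
Qed.

Lemma central_series (N : {group gT}) : nilpotent G -> (N <| G)%g ->
  exists m (Z : nat -> {group gT}), [/\ Z 0%N = N, Z m = G &
    forall i, (i < m)%N -> central_step (Z i) (Z i.+1)].
Proof.
move=> nilG; move: {2}#|G : N|%g (leqnn #|G : N|%g) => c.
elim: c N => [|c IH] N; first by rewrite leqNgt indexg_gt0.
move=> hc nN; have [/eqP E|NG] := boolP (N :==: G).
  by exists 0%N, (fun=> N); split=> //; apply: val_inj.
have [N' st] := central_step_exists nilG nN NG; have [s1 _ nN' _ pr] := st.
have [|m [Z [Z0 Zm ZS]]] := IH N' _ nN'.
  rewrite -ltnS (leq_trans _ hc) // -(Lagrange_index (subsetT N') s1) ltn_Pmulr //.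
  exact: prime_gt1.
exists m.+1, (fun i => if i is i'.+1 then Z i' else N); split=> // -[|i] hi //=.
  by rewrite Z0.
exact: ZS.
Qed.
End CentralSeries.

Section PrimeCharacters.
Variables (F : closedFieldType) (hchar : [pchar F] =i pred0).

Lemma prim_root_exists p : prime p -> exists w : F, p.-primitive_root w.
Proof.
move=> pp; have p1 := prime_gt1 pp.
pose P : {poly F} := \poly_(i < p) 1.
have sP : size P = p.
  by rewrite size_poly_eq ?oner_neq0.
have /closed_rootP[w rw] : size P != 1%N by rewrite sP; case: p p1 {pp P sP} => [|[|]].
have Pe (x : F) : P.[x] = \sum_(i < p) x ^+ i.
  by rewrite horner_poly; apply: eq_bigr => i _; rewrite mul1r.
have wp : w ^+ p = 1.
  by apply/eqP; rewrite -subr_eq0 subrX1 -Pe (eqP rw) mulr0.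
have w1 : w != 1.
  apply: contraTneq rw => ->; rewrite rootE Pe.
  under eq_bigr => i _ do rewrite expr1n.
  rewrite sumr_const card_ord; apply/negP => p0.
  by have := hchar p; rewrite !inE pp p0.
have [m mw mp] := prim_order_exists (prime_gt0 pp) wp.
exists w; case/primeP: pp => _ /(_ _ mp)/orP[] /eqP E; last by rewrite -E.
by move: w1; rewrite -(prim_expr_order mw) E expr1 eqxx.
Qed.

Section Character.
Local Open Scope group_scope.
Variables (gT : finGroupType) (N N' : {group gT}) (st : central_step N N').
Local Notation p := #|N' : N|.

Let pr : prime p. Proof. by case: st. Qed.
Let nT (X : {set gT}) : X \subset 'N(N).
Proof. by case: st => _ /normal_norm nG _ _ _; rewrite (subset_trans (subsetT X)). Qed.
Let cM x y : coset N (x * y) = coset N x * coset N y.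
Proof. by rewrite morphM ?(subsetP (nT setT)) ?inE. Qed.

Lemma coset_central z g : z \in N' -> coset N (z ^ g) = coset N z.
Proof.
case: st => _ _ _ cN _ zN.
have : [~ z, g] \in N by rewrite (subsetP cN) // mem_commg ?inE.
by move=> h; rewrite conjg_mulR cM (coset_id h) mulg1.
Qed.

Lemma coset_eq1 z : (coset N z == 1) = (z \in N).
Proof.
apply/eqP/idP => [|/coset_id //]; apply: coset_idr.
by rewrite (subsetP (nT setT)) ?inE.
Qed.

Lemma prime_character : exists chi : 'Z_p -> gT -> F,
  [/\ forall q z z', z \in N' -> z' \in N' -> chi q (z * z') = (chi q z * chi q z')%R,
      forall q s z, z \in N' -> chi (q * s) z = (chi q z * chi s z)%R
      /\ chi 1 z = 1%R,
      forall q z g, z \in N' -> chi q (z ^ g) = chi q z,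
      forall q z, z \in N -> chi q z = 1%R &
      forall z, z \in N' -> (\sum_q chi q z = (z \in N)%:R * p%:R)%R].
Proof.
have [w wp] := prim_root_exists pr; have [sN _ _ _ _] := st.
have p1 := prime_gt1 pr.
have [x xE] : exists x, N' / N = <[x]>.
  by apply/cyclicP/prime_cyclic; rewrite card_quotient ?nT.
have ox : #[x] = p by rewrite /order -xE card_quotient ?nT.
pose l z := odflt 0%N (omap val [pick i : 'I_p | coset N z == x ^+ i]).
have lE z : z \in N' -> coset N z = x ^+ l z.
  move=> zN; rewrite /l; case: pickP => [i /eqP //|h].
  have : coset N z \in <[x]> by rewrite -xE mem_quotient.
  case/cyclePmin => i; rewrite ox => hi E.
  by have := h (Ordinal hi); rewrite /= E eqxx.
pose c z : F := (w ^+ l z)%R.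
have cE z n : z \in N' -> coset N z = x ^+ n -> (c z = w ^+ n)%R.
  move=> zN E; apply/eqP; rewrite (eq_prim_root_expr wp) -ox -eq_expg_mod_order.
  by rewrite -lE // E.
have c1 z : z \in N -> c z = 1%R.
  move=> zN; rewrite (cE z 0%N) ?expr0 ?(subsetP sN) //.
  by rewrite expg0 coset_id.
have cMul z z' : z \in N' -> z' \in N' -> c (z * z') = (c z * c z')%R.
  move=> zN zN'; rewrite (cE _ (l z + l z')%N) ?groupM // ?exprD //.
  by rewrite cM (lE z) // (lE z') // expgD.
have cp z : (c z ^+ p = 1)%R by rewrite -exprM mulnC exprM (prim_expr_order wp) expr1n.
have c_eq1 z : z \in N' -> (c z == 1%R) = (z \in N).
  move=> zN; apply/idP/idP => [|/c1 ->]; last exact: eqxx.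
  rewrite -(prim_order_dvd wp) -ox order_dvdn -lE // coset_eq1 //.
have zpE : (Zp_trunc p).+2 = p by rewrite Zp_cast.
exists (fun q z => (c z ^+ (q : nat))%R); split.
- by move=> q z z' zN zN'; rewrite cMul // exprMn.
- move=> q s z zN; split; last by [].
  rewrite -exprD -[(q * s)%g]/(Zp_add q s) /=.
  have cp' : (c z ^+ (Zp_trunc p).+2 = 1)%R by rewrite zpE.
  by rewrite (expr_mod _ cp').
- move=> q z g zN; rewrite (cE (z ^ g) (l z)) ?coset_central // ?lE //.
  by case: st => _ _ /normal_norm nN' _ _; rewrite memJ_norm // (subsetP nN') ?inE.
- by move=> q z /c1 ->; rewrite expr1n.
move=> z zN; have [zNN|zNN] := boolP (z \in N).
  under eq_bigr => q _ do rewrite c1 // expr1n.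
  by rewrite sumr_const card_ord zpE mul1r.
rewrite mul0r.
rewrite (_ : (\sum_(q : 'Z_p) c z ^+ q = \sum_(i < p) c z ^+ i)%R); last by rewrite -[in RHS]zpE.
have := subrX1 (c z) p; rewrite cp subrr => /esym/eqP.
by rewrite mulf_eq0 subr_eq0 c_eq1 // (negPf zNN) => /eqP.
Qed.
End Character.
End PrimeCharacters.

Definition lower_step (F : fieldType) (H : hopf F) (K L : 'M[F]_(hdim H)) :=
  [/\ hopf_sub H L, (L <= K)%MS, normal_in H L K &
    exists (B : hopf F) (f : 'M[F]_(hdim H, hdim B)),
      is_quotient H K (lprod H K L) B f /\ cocommutative_hopf B].

Arguments lower_step {F} H K L.

Section LowerSeries.
Variables (F : closedFieldType) (hchar : [pchar F] =i pred0).
Variables (gT : finGroupType).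
Local Notation H := (groupalg F gT).
Local Notation n := (hdim H).
Variables (J Jinv : 'M[F]_n) (hJ : is_twist H J Jinv) (S : 'I_n -> 'rV[F]_n).
Local Notation A := (twisted H J Jinv S).
Hypothesis hS : is_antipode A.
Local Notation esub := (equiv_sub J Jinv).
Local Notation theta := (theta J Jinv).
Local Notation one := (fun=> 1 : F).

Lemma esub_eq (C C' Z Z' : {set gT}) chi chi' :
  (esub C Z chi == esub C' Z' chi')%MS -> esub C Z chi = esub C' Z' chi'.
Proof.
have gE B W x : <<esub B W x>>%MS = esub B W x.
  by rewrite /equiv_sub genmx_sums; apply: eq_bigr => k _; rewrite genmx_id.
by move=> /genmxP; rewrite !gE.
Qed.

Lemma graded_lower_step (Q : finGroupType) (C : Q -> {set gT}) (Z : {set gT})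
    (chi : Q -> gT -> F) (C0 Z0 : {set gT}) chi0 :
  (forall q, esub_ok (C q) Z (chi q)) ->
  (forall q s k l, k \in C q -> l \in C s -> (k * l)%g \in C (q * s)%g) ->
  (forall q s z, z \in Z -> chi (q * s)%g z = chi q z * chi s z) ->
  1%g \in C 1%g -> (forall z, z \in Z -> chi 1%g z = 1) ->
  (forall q, exists k, k \in C q) ->
  (forall q, chi q 1%g = 1) -> 1%g \in Z ->
  (forall z z', z \in Z -> (z' \in Z) = ((z * z')%g \in Z)) ->
  (forall q z z', z \in Z -> z' \in Z -> chi q (z * z')%g = chi q z * chi q z') ->
  (forall q, (esub (C q) Z (chi q) <= esub C0 Z0 chi0)%MS) ->
  (esub C0 Z0 chi0 <= \sum_q <<esub (C q) Z (chi q)>>)%MS ->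
  lower_step A (esub C0 Z0 chi0) (esub (C 1%g) Z (chi 1%g)).
Proof.
move=> ok CM cM C1 c1 Cn c11 Z1 ZM chM sub1 sub2.
have hA := twisted_bialg hJ S.
pose M q : 'M[F]_(hdim A) := esub (C q) Z (chi q).
have /fin_all_exists2[w wM we] q : exists2 w : 'rV[F]_(hdim A),
    (w <= M q)%MS & counitA A w = 1.
  by have [k kC] := Cn q; apply: (esub_counit hJ S kC) => //; apply: chM.
have M1 : (hunit A <= M 1%g)%MS by apply: esub_one.
have MM q s x y : (x <= M q)%MS -> (y <= M s)%MS -> (mulA A x y <= M (q * s)%g)%MS.
  by apply: esub_mul => //; [exact: CM | exact: cM].
have MD q x : (x <= M q)%MS -> in_tens (M q) (M q) (comulA A x).
  exact: esub_comul.
have E : esub C0 Z0 chi0 = Mtot M.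
  have -> : Mtot M = <<Mtot M>>%MS.
    by rewrite /Mtot genmx_sums; apply: eq_bigr => q _; rewrite genmx_id.
  have <- : <<esub C0 Z0 chi0>>%MS = esub C0 Z0 chi0.
    by rewrite /equiv_sub genmx_sums; apply: eq_bigr => k _; rewrite genmx_id.
  apply/genmxP/andP; split=> //; apply/sumsmx_subP => q _; rewrite genmxE.
  exact: sub1.
rewrite E; split.
- exact: (hopf_sub_M1 hA hS M1 MM MD).
- exact: (@M_sub _ _ _ M 1%g).
- exact: (normal_M1 hA hS M1 MM MD).
exact: (graded_quotient hA hS M1 MM MD wM we).
Qed.

Lemma lower_step_group (N N' : {group gT}) : central_step N N' ->
  lower_step A (esub N' [set 1%g] one) (esub N [set 1%g] one).
Proof.
move=> st; have [sN nN nN' cN pr] := st.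
have nT (x : gT) : x \in 'N(N)%g by have := subsetP (normal_norm nN) x; rewrite inE => ->.
have cM (x y : gT) : coset N (x * y)%g = (coset N x * coset N y)%g.
  by rewrite morphM ?nT.
pose C (q : subg_of (N' / N)%G) := [set k | coset N k == sgval q].
have Csub q k : k \in C q -> k \in N'.
  rewrite inE => /eqP E; have := subgP q; rewrite -E => kq.
  have : k \in (coset N @*^-1 (N' / N))%g by rewrite inE nT /= inE.
  by rewrite quotientGK // /normal sN; apply/subsetP => y _; apply: nT.
have -> : esub N [set 1%g] one = esub (C 1%g) [set 1%g] one.
  congr esub; apply/setP => k; rewrite inE -(coset_eq1 st).
  by [].
apply: (graded_lower_step (C := C) (chi := fun=> one)) => //.
- move=> q; split=> [k g kC|z g /set1P ->|z k /set1P -> _].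
  + by have := kC; rewrite !inE (coset_central st) // (Csub q).
  + by rewrite conj1g inE eqxx.
  + by rewrite conjg1.
- by move=> q s k l; rewrite !inE cM => /eqP -> /eqP ->.
- by move=> q s z _; rewrite mulr1.
- by rewrite inE (coset_eq1 st) group1.
- move=> q; have /morphimP[k kn kN E] := subgP q.
  by exists k; rewrite inE E.
- by move=> z z' /set1P ->; rewrite mul1g.
- by move=> q z z' _ _; rewrite mulr1.
- move=> q; apply: esub_sub => k phi kC hphi; apply: esub_in => //.
  exact: Csub kC.
apply: esub_sub => k phi kC hphi.
have kq : coset N k \in (N' / N)%g by rewrite mem_quotient.
rewrite (sumsmx_sup (subg (N' / N)%G (coset N k))) // genmxE.
by apply: esub_in => //; rewrite inE subgK.
Qed.

Lemma lower_step_char (N N' : {group gT}) : central_step N N' ->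
  lower_step A (esub [set 1%g] N one) (esub [set 1%g] N' one).
Proof.
move=> st; have [sN nN nN' cN pr] := st.
have [chi [cMul cM cJ c1 csum]] := prime_character hchar st.
set p := #|N' : N|%g in pr chi cMul cM cJ c1 csum *.
have p0 : (p%:R : F) != 0.
  by apply/negP => h; have := hchar p; rewrite !inE pr h.
have n0 (m : nat) : (0 < m)%N -> (m%:R : F) != 0.
  move=> m0; apply/negP => h; have [q qq] := natf0_pchar m0 h.
  by have := hchar q; rewrite qq inE.
have -> : esub [set 1%g] N' one = esub [set 1%g] N' (chi 1%g).
  apply: esub_eq; apply/andP; split; apply: esub_sub => k phi kC hphi;
    apply: esub_in => // z v zN; rewrite hphi //; by rewrite (cM 1%g 1%g z zN).2.
have jN g z : z \in N' -> (z ^ g)%g \in N'.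
  by move=> zN; rewrite memJ_norm // (subsetP (normal_norm nN')) ?inE.
have gM z z' : z \in N' -> (z' \in N') = ((z * z')%g \in N').
  by move=> zN; rewrite groupMl.
apply: (graded_lower_step (C := fun=> [set 1%g]) (chi := chi)) => //.
- move=> q; split=> [k g /set1P ->|z g zN|z k _ /set1P ->]; last by rewrite conj1g.
    by rewrite conj1g inE.
  by rewrite jN // cJ.
- by move=> q s k l /set1P -> /set1P ->; rewrite mulg1 inE.
- by move=> q s z zN; rewrite (cM q s z zN).1.
- by move=> z zN; rewrite (cM 1%g 1%g z zN).2.
- by move=> q; exists 1%g; rewrite inE.
- by move=> q; rewrite c1 ?group1.
- move=> q; apply: esub_sub => k phi kC hphi; apply: esub_in => // z v zN.
  by rewrite hphi ?(subsetP sN) // c1.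
apply: esub_sub => k phi kC hphi.
pose a : F := (#|N'|%:R)^-1.
pose psi q v := a * \sum_(z in N') chi q z^-1%g * phi (z * v)%g.
have hpsi q : eqv N' (chi q) (psi q).
  move=> y v yN; rewrite /psi mulrCA; congr (_ * _); rewrite mulr_sumr.
  rewrite (reindex_inj (mulIg y^-1%g)) /=; apply: eq_big => z.
    by rewrite groupMr ?groupV.
  move=> zN; have zN' : z \in N' by rewrite -(groupMr z (groupVr yN)).
  by rewrite mulgA mulgKV invMg invgK cMul ?groupV // mulrA.
have Epsi v : phi v = \sum_q psi q v.
  rewrite /psi -mulr_sumr exchange_big /=.
  transitivity (a * \sum_(z in N') (z \in N)%:R * p%:R * phi v).
    rewrite -!mulr_suml; have -> : \sum_(z in N') (z \in N)%:R = #|N|%:R :> F.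
      transitivity (\sum_(z in N') if z \in N then 1 else 0 : F).
        by apply: eq_bigr => z _; case: ifP.
      rewrite -big_mkcondr -sumr_const; apply: eq_bigl => z.
      by apply/andb_idl/(subsetP sN).
    by rewrite -natrM Lagrange // mulKf ?n0 // mulrA mulVf ?n0 ?cardG_gt0 // mul1r.
  congr (_ * _); apply: eq_bigr => z zN; rewrite -mulr_suml csum ?groupV //.
  case: (boolP (z \in N)) => zNN; last by rewrite !mul0r.
  by rewrite hphi //= !mul1r.
have -> : theta k phi = \sum_q theta k (psi q).
  rewrite -wr_sum; apply: eq_wr => u g; rewrite Epsi scaler_suml //.
rewrite summx_sub // => q _; rewrite (sumsmx_sup q) // genmxE.
exact: esub_in.
Qed.

Lemma lower_series_nilpotent : nilpotent [set: gT] ->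
  lower_series A (fun B => cocommutative_hopf B).
Proof.
move=> nilG.
have n1 : (1 <| [set: gT])%g by rewrite normal1.
have [m [Z [Z0 Zm ZS]]] := central_series (N := 1%G) nilG n1.
pose K i : 'M[F]_(hdim A) := if (i <= m)%N then esub (Z (m - i)%N) [set 1%g] one
  else esub [set 1%g] (Z (i - m)%N) one.
have K2 i : (m <= i)%N -> K i = esub [set 1%g] (Z (i - m)%N) one.
  rewrite leq_eqVlt /K => /orP[/eqP <-|mi]; last by rewrite leqNgt mi.
  by rewrite leqnn subnn Z0.
exists (m + m)%N, K; split.
- rewrite /K leq0n subn0 Zm submx1; exact: esub_total.
- rewrite K2 ?leq_addr // addnK Zm; apply/andP; split.
    apply: esub_sub => k phi /set1P -> hphi.
    have -> : theta 1%g phi = phi 1%g *: hunit A.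
      rewrite -(theta_one hJ S) /theta.
      rewrite (linear_wr J Jinv (f := fun x => phi 1%g *: x)).
        apply: eq_wr => u g; rewrite scale1r; congr (_ *: _).
        by have := hphi u 1%g (in_setT _); rewrite mulg1 mul1r.
      by move=> a x y; rewrite scalerDr !scalerA mulrC.
    by rewrite scalemx_sub.
  by apply: esub_one => //; rewrite inE.
move=> i hi; suff [h1 h2 h3 [B [f [h4 h5]]]] : lower_step A (K i) (K i.+1).
  by split=> //; exists B, f.
have [im|mi] := ltnP i m.
  rewrite /K (ltnW im) im -(subnSK im); apply: lower_step_group; apply: ZS.
  by rewrite ltn_subrL (leq_ltn_trans _ im).
rewrite !K2 ?(leq_trans mi) // subSn //.
by apply: lower_step_char; apply: ZS; rewrite ltn_subLR.
Qed.
End LowerSeries.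

(** * Central quotients and the upper normal series *)

Section Push.
Variables (F : fieldType) (H1 H2 : hopf F) (f : 'M[F]_(hdim H1, hdim H2)).

Lemma push_tens u v : f^T *m tens H1 u v *m f = tens H2 (u *m f) (v *m f).
Proof. by rewrite /tens trmx_mul !mulmxA. Qed.

Lemma sw_push (V : lmodType F) (b : 'rV[F]_(hdim H2) -> 'rV[F]_(hdim H2) -> V) X :
  (forall x, linear (b x)) -> (forall y, linear (b^~ y)) ->
  sw (f^T *m X *m f) (fun j k => b (ebas H2 j) (ebas H2 k)) =
  sw X (fun j k => b (ebas H1 j *m f) (ebas H1 k *m f)).
Proof.
move=> lr ll.
apply: (@mx_ext _ H1 _ (fun X => sw (f^T *m X *m f) (fun j k => b (ebas H2 j) (ebas H2 k)))
  (fun X => sw X (fun j k => b (ebas H1 j *m f) (ebas H1 k *m f)))).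
- by move=> a Y Z; rewrite mulmxDr mulmxDl -scalemxAr -scalemxAl swP.
- by move=> a Y Z; rewrite swP.
move=> u v; rewrite push_tens sw_tens //.
rewrite (sw_tens _ _ (b := fun x y => b (x *m f) (y *m f))) //.
  by move=> x a y z; rewrite mulmxDl -scalemxAl lr.
by move=> x a y z; rewrite mulmxDl -scalemxAl ll.
Qed.

Lemma push_is_linear : linear (fun X : 'M[F]_(hdim H1) => f^T *m X *m f).
Proof. by move=> a Y Z; rewrite mulmxDr mulmxDl -scalemxAr -scalemxAl. Qed.
End Push.

Lemma twist_cocycle (F : fieldType) (gT : finGroupType)
    (X : 'M[F]_(hdim (groupalg F gT))) : tw_cocycle (tw X) ->
  forall a b c, mul3 (groupalg F gT) (comulL _ X) (tensL1 _ X) a b c =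
                mul3 (groupalg F gT) (comulR _ X) (tens1R _ X) a b c.
Proof.
move=> jc a b c.
pose Phi x y z : F^o := ((x == enum_val a) && (y == enum_val b) && (z == enum_val c))%:R.
have sE (Y : t3 (groupalg F gT)) : sw3 Y Phi = Y a b c.
  rewrite /sw3 (bigD1 (enum_val a)) //= [X in _ + X]big1 ?addr0; last first.
    by move=> i /negPf ne; rewrite big1 // => j _; rewrite big1 // => k _;
    rewrite /Phi ne /= scaler0.
  rewrite (bigD1 (enum_val b)) //= [X in _ + X]big1 ?addr0; last first.
    by move=> j /negPf ne; rewrite big1 // => k _; rewrite /Phi ne andbF scaler0.
  rewrite (bigD1 (enum_val c)) //= [X in _ + X]big1 ?addr0; last first.
    by move=> k /negPf ne; rewrite /Phi ne andbF scaler0.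
  by rewrite /Phi !eqxx !enum_valK; exact: mulr1.
rewrite -!sE !sw3_mul3 sw3_comulL sw3_comulR.
have := jc _ Phi.
set L := LHS; set R := RHS => E.
transitivity L.
  apply: eq_bigr => p _; rewrite sw3_tensL1 scaler_sumr; apply: eq_bigr => q _.
  by rewrite scalerA mulg1.
rewrite E; apply: eq_bigr => p _; rewrite sw3_tens1R scaler_sumr.
by apply: eq_bigr => q _; rewrite scalerA mulg1.
Qed.

Section CentralQuotient.
Variables (F : fieldType) (gT hT : finGroupType) (phi : gT -> hT) (s : hT -> gT).
Hypothesis phiM : forall x y, phi (x * y)%g = (phi x * phi y)%g.
Hypothesis phis : forall x, phi (s x) = x.
Variable Z : {group gT}.
Hypothesis phiZ : forall x, (phi x == 1%g) = (x \in Z).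
Hypothesis Zc : forall z x, z \in Z -> (z * x)%g = (x * z)%g.
Local Notation H := (groupalg F gT).
Local Notation H' := (groupalg F hT).
Local Notation n := (hdim H).
Local Notation n' := (hdim H').
Variables (J Jinv : 'M[F]_n) (hJ : is_twist H J Jinv) (S : 'I_n -> 'rV[F]_n).
Local Notation A := (twisted H J Jinv S).
Hypothesis hS : is_antipode A.

Definition quo_mx : 'M[F]_(n, n') := \matrix_i gbas F (phi (enum_val i)).
Local Notation f := quo_mx.

Lemma be_quo g : gbas F g *m f = gbas F (phi g).
Proof. by rewrite /gbas -rowE rowK enum_rankK. Qed.

Let phi1 : phi 1%g = 1%g.
Proof. by apply/eqP; rewrite phiZ group1. Qed.

Lemma be_ext (V : lmodType F) (g h : 'rV[F]_n -> V) : linear g -> linear h ->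
  (forall x, g (gbas F x) = h (gbas F x)) -> forall x, g x = h x.
Proof. exact: (span_ext (@be_span F gT)). Qed.

Lemma quo_mul x y : mulA H' (x *m f) (y *m f) = mulA H x y *m f.
Proof.
apply: (be_ext (g := fun x => mulA H' (x *m f) (y *m f))
  (h := fun x => mulA H x y *m f)) x => [a u v|a u v|g].
- by rewrite mulmxDl -scalemxAl mulADl.
- by rewrite mulADl mulmxDl -scalemxAl.
apply: (be_ext (g := fun y => mulA H' (gbas F g *m f) (y *m f))
  (h := fun y => mulA H (gbas F g) y *m f)) y => [a u v|a u v|h].
- by rewrite mulmxDl -scalemxAl linearP.
- by rewrite linearP mulmxDl -scalemxAl.
by rewrite !be_mul !be_quo be_mul phiM.
Qed.

Let push (X : 'M[F]_n) : 'M[F]_n' := f^T *m X *m f.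

Lemma quo_mulT X Y : mulT H' (push X) (push Y) = push (mulT H X Y).
Proof.
have lp := push_is_linear (H1 := H) (H2 := H') f.
apply: (@mx_ext _ H _ (fun X => mulT H' (push X) (push Y))
  (fun X => push (mulT H X Y))) X => [a u v|a u v|u v].
- by rewrite /push lp mulTDl.
- by rewrite mulTDl /push lp.
apply: (@mx_ext _ H _ (fun Y => mulT H' (push (tens H u v)) (push Y))
  (fun Y => push (mulT H (tens H u v) Y))) Y => [a x y|a x y|u' v'].
- by rewrite /push lp mulTDr.
- by rewrite mulTDr /push lp.
rewrite /push !(push_tens (H1 := H) (H2 := H')) !mulT_tens.
by rewrite (push_tens (H1 := H) (H2 := H')) !quo_mul.
Qed.

Lemma quo_unit : hunit H *m f = hunit H'.
Proof. by rewrite hunit_be be_quo phi1. Qed.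

Lemma sum_tw_push (V : lmodType F) X (Phi : hT * hT -> V) :
  \sum_p tw (push X) p *: Phi p = \sum_p tw X p *: Phi (phi p.1, phi p.2).
Proof.
pose t (i k : 'I_n') := Phi (enum_val i, enum_val k).
transitivity (sw (H := H') (push X) t).
  by rewrite sw_pair; apply: eq_bigr => -[a b] _; rewrite /t !enum_rankK.
have lp := push_is_linear (H1 := H) (H2 := H') f.
rewrite {1}[X]tens_sum /push (linear_comb lp) sw_sum; apply: eq_bigr => p _.
rewrite swZ (push_tens (H1 := H) (H2 := H')) !be_quo.
by rewrite sw_tens_be /t !enum_rankK.
Qed.

Lemma quo_twist : is_twist H' (push J) (push Jinv).
Proof.
have [[h1 h2] h3 [h4 h5]] := hJ.
have pu : push (unitT H) = unitT H'.
  by rewrite /push /unitT (push_tens (H1 := H) (H2 := H')) quo_unit.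
split; first by rewrite !quo_mulT h1 h2 pu.
  apply: twist_cocycle => V Phi.
  have jc := tw_cocycleP h3.
  have E (t : hT * hT -> hT * hT -> V) :
      \sum_p \sum_q (tw (push J) p * tw (push J) q) *: t p q =
      \sum_p \sum_q (tw J p * tw J q) *: t (phi p.1, phi p.2) (phi q.1, phi q.2).
    transitivity (\sum_p tw (push J) p *: \sum_q tw (push J) q *: t p q).
      apply: eq_bigr => p _; rewrite scaler_sumr; apply: eq_bigr => q _.
      by rewrite scalerA.
    rewrite sum_tw_push; apply: eq_bigr => p _; rewrite sum_tw_push scaler_sumr.
    by apply: eq_bigr => q _; rewrite scalerA.
  rewrite !E /=; have := jc V (fun a b c => Phi (phi a) (phi b) (phi c)).
  set L := LHS; set R := RHS => LR.
  transitivity L.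
    by apply: eq_bigr => p _; apply: eq_bigr => q _; rewrite !phiM.
  by rewrite LR; apply: eq_bigr => p _; apply: eq_bigr => q _; rewrite !phiM.
have jn := tw_normP h4 h5.
have lp := push_is_linear (H1 := H) (H2 := H') f.
split.
  rewrite -quo_unit hunit_be -(jn _ (@gbas F gT)).2 [J in LHS]tens_sum /push (linear_comb lp).
  rewrite (linear_comb (@counitL_is_linear _ H')) mulmx_suml; apply: eq_bigr => p _.
  rewrite (push_tens (H1 := H) (H2 := H')) counitL_tens !be_quo.
  by rewrite be_counit scale1r -scalemxAl be_quo.
rewrite -quo_unit hunit_be -(jn _ (@gbas F gT)).1 [J in LHS]tens_sum /push (linear_comb lp).
rewrite (linear_comb (@counitR_is_linear _ H')) mulmx_suml; apply: eq_bigr => p _.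
rewrite (push_tens (H1 := H) (H2 := H')) counitR_tens !be_quo.
by rewrite be_counit scale1r -scalemxAl be_quo.
Qed.

Let hA : is_bialg A := twisted_bialg hJ S.

Lemma be_central z x : z \in Z -> mulA H (gbas F z) x = mulA H x (gbas F z).
Proof.
move=> zZ; apply: (be_ext (g := mulA H (gbas F z)) (h := fun x => mulA H x (gbas F z))) x.
- exact: mulA_is_linear.
- by move=> a u v; rewrite mulADl.
by move=> x; rewrite !be_mul Zc.
Qed.

Lemma comulA_central z : z \in Z -> comulA A (gbas F z) = tens H (gbas F z) (gbas F z).
Proof.
move=> zZ; have [[h1 h2] _ _] := hJ; rewrite comulA_beE.
have -> : mulT H Jinv (tens H (gbas F z) (gbas F z)) = mulT H (tens H (gbas F z) (gbas F z)) Jinv.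
  apply: (@mx_ext _ H _ (fun X => mulT H X (tens H (gbas F z) (gbas F z)))
    (mulT H (tens H (gbas F z) (gbas F z)))) Jinv => [a u v|a u v|u v].
  - by rewrite mulTDl.
  - by rewrite mulTDr.
  by rewrite !mulT_tens !be_central.
rewrite -(mulTA (@groupalg_mulA F gT)) h2 mulT1 //.
by case: (groupalg_mul1 F gT).
Qed.

Lemma sw_mulT_tens (V : lmodType F) (b : 'rV[F]_n -> 'rV[F]_n -> V) X u v :
  (forall x, linear (b x)) -> (forall y, linear (b^~ y)) ->
  sw (mulT H X (tens H u v)) (fun j k => b (ebas H j) (ebas H k)) =
  sw X (fun j k => b (mulA H (ebas H j) u) (mulA H (ebas H k) v)).
Proof.
move=> lr ll.
apply: (@mx_ext _ H _ (fun X => sw (mulT H X (tens H u v))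
    (fun j k => b (ebas H j) (ebas H k)))
  (fun X => sw X (fun j k => b (mulA H (ebas H j) u) (mulA H (ebas H k) v)))) X.
- by move=> a Y Z'; rewrite mulTDl swP.
- by move=> a Y Z'; rewrite swP.
move=> x y; rewrite mulT_tens sw_tens //.
rewrite (sw_tens _ _ (b := fun x y => b (mulA H x u) (mulA H y v))) //.
  by move=> x' a y' z'; rewrite mulADl lr.
by move=> x' a y' z'; rewrite mulADl ll.
Qed.

Lemma be_mulK z x : mulA H (mulA H x (gbas F z)) (gbas F z^-1%g) = x.
Proof.
rewrite -groupalg_mulA be_mul mulgV -hunit_be.
by case: (groupalg_mul1 F gT).
Qed.

Lemma anti_be_central z : z \in Z -> antiA A (gbas F z) = gbas F z^-1%g.
Proof.
move=> zZ; have := sw_antil hS (gbas F z : 'rV_(hdim A)).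
rewrite comulA_central // [counitA A (gbas F z)]be_counit scale1r.
rewrite (sw_tens (H := A) _ _ (b := fun x y => mulA A (antiA A x) y)); first last.
- by move=> x a u v; rewrite linearP mulADl.
- by move=> x; exact: mulA_is_linear.
move=> E'; have E : mulA H (antiA A (gbas F z)) (gbas F z) = hunit H by exact: E'.
rewrite -[LHS](be_mulK z) E.
by case: (groupalg_mul1 F gT).
Qed.

Lemma anti_mul_central z x : z \in Z ->
  antiA A (mulA H x (gbas F z)) = mulA H (antiA A x) (gbas F z^-1%g).
Proof.
move=> zZ.
pose T (i : 'I_(hdim A)) : 'rV[F]_(hdim A) :=
  mulA A (antiA A (mulA A (ebas A i) (gbas F z))) (gbas F z).
have TE i : sw (hcomul A i) (fun j k => mulA A (T j) (ebas A k)) = hcounit A i *: hunit A.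
  have := sw_antil hS (mulA A (ebas A i) (gbas F z)).
  rewrite counitAM // [counitA A (gbas F z)]be_counit mulr1 counitA_ebas => <-.
  have hD : comulA A (mulA A (ebas A i) (gbas F z)) =
      mulT H (comulA A (ebas A i)) (comulA A (gbas F z)).
    by case: hA => _ _ _ [].
  rewrite hD comulA_ebas comulA_central //.
  have l1 y : linear ((fun x y => mulA A (antiA A x) y) y) by exact: mulA_is_linear.
  have l2 y : linear ((fun x y => mulA A (antiA A x) y) ^~ y).
    by move=> a u v; rewrite linearP mulADl.
  refine (etrans _ (esym (sw_mulT_tens _ _ _ l1 l2))).
  apply: eq_sw => j k; rewrite /T mulAA //; congr (mulA A _ _).
  exact: be_central.
have E (y : 'rV[F]_n) : mulA H (antiA A (mulA H y (gbas F z))) (gbas F z) = antiA A y.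
  pose g (y : 'rV[F]_n) := mulA H (antiA A (mulA H y (gbas F z))) (gbas F z).
  have lg : linear g by move=> a u v; rewrite /g mulADl linearP mulADl.
  rewrite -[LHS]/(g y) [y](@ebas_sum F A) (linear_comb lg).
  rewrite (linear_comb (@antiA_is_linear F A)); apply: eq_bigr => i _; congr (_ *: _).
  exact: (anti_unique hA hS TE).
by rewrite -[LHS](be_mulK z) E.
Qed.

Let fiber g : exists2 z, z \in Z & g = (s (phi g) * z)%g.
Proof.
exists ((s (phi g))^-1 * g)%g; last by rewrite mulKVg.
rewrite -phiZ -(inj_eq (mulgI (phi (s (phi g))))) -phiM mulKVg phis mulg1 eqxx //.
Qed.

Let Sbar (i : 'I_n') : 'rV[F]_n' := antiA A (gbas F (s (enum_val i))) *m f.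
Local Notation A' := (twisted H' (push J) (push Jinv) Sbar).

Lemma quo_anti x : antiA A' (x *m f) = antiA A x *m f.
Proof.
apply: (be_ext (g := fun x => antiA A' (x *m f)) (h := fun x => antiA A x *m f)).
- by move=> a u v; rewrite mulmxDl -scalemxAl (@antiA_is_linear _ A').
- by move=> a u v; rewrite linearP mulmxDl -scalemxAl.
move=> g; rewrite be_quo {1}/gbas (@antiA_ebas _ A') /= /Sbar enum_rankK.
have [z zZ {2}->] := fiber g.
rewrite -be_mul anti_mul_central // -quo_mul be_quo.
have -> : phi z^-1%g = 1%g by apply/eqP; rewrite phiZ groupV.
by rewrite -hunit_be; case: (groupalg_mul1 F hT) => _ ->.
Qed.

Lemma quo_comul x : comulA A' (x *m f) = f^T *m comulA A x *m f.
Proof.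
have lp := push_is_linear (H1 := H) (H2 := H') f.
apply: (be_ext (g := fun x => comulA A' (x *m f)) (h := fun x => f^T *m comulA A x *m f)).
- by move=> a u v; rewrite mulmxDl -scalemxAl (@comulA_is_linear _ A').
- by move=> a u v; rewrite linearP lp.
move=> g; rewrite be_quo !comulA_beE -[RHS]/(push _) -!quo_mulT.
by rewrite [push (tens _ _ _)](push_tens (H1 := H) (H2 := H')) !be_quo.
Qed.

Lemma quo_counit x : counitA A' (x *m f) = counitA A x.
Proof.
apply: (@be_ext F^o (fun x => counitA A' (x *m f)) (counitA A)).
- by move=> a u v; rewrite mulmxDl -scalemxAl (@counitA_is_linear _ A').
- by move=> a u v; rewrite linearP.
by move=> g; rewrite be_quo [LHS]be_counit [RHS]be_counit.
Qed.

Lemma quo_antipode : is_antipode A'.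
Proof.
have key (b : 'rV[F]_n -> 'rV[F]_n -> 'rV[F]_n) (b' : 'rV[F]_n' -> 'rV[F]_n' -> 'rV[F]_n') :
    (forall x, linear (b' x)) -> (forall y, linear (b'^~ y)) ->
    (forall x y, b' (x *m f) (y *m f) = b x y *m f) ->
    (forall x, sw (H := A) (comulA A x) (fun j k => b (ebas A j) (ebas A k)) =
       counitA A x *: hunit A) ->
    forall i, sw (H := A') (hcomul A' i) (fun j k => b' (ebas A' j) (ebas A' k)) =
      hcounit A' i *: hunit A'.
  move=> l1 l2 bb hb i.
  have Ei : ebas A' i = gbas F (s (enum_val i)) *m f.
    by rewrite be_quo phis -ebas_be.
  rewrite -comulA_ebas Ei quo_comul.
  rewrite (sw_push (H1 := A) (H2 := A') f _ l1 l2).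
  under eq_sw => j k do rewrite bb.
  rewrite -(linear_sw (H := A) (f := fun x => x *m f)); last first.
    by move=> a x y; rewrite mulmxDl -scalemxAl.
  by rewrite hb -scalemxAl -[hunit A]/(hunit H) quo_unit [counitA A _]be_counit.
move=> i; split.
  apply: (key (fun x y => mulA A (antiA A x) y) (fun x y => mulA A' (antiA A' x) y)).
  - by move=> x; exact: (@mulA_is_linear _ A').
  - by move=> y a u v; rewrite (@antiA_is_linear _ A') (@mulADl _ A').
  - by move=> x y; rewrite quo_anti -quo_mul.
  - exact: sw_antil.
apply: (key (fun x y => mulA A x (antiA A y)) (fun x y => mulA A' x (antiA A' y))).
- by move=> x a u v; rewrite (@antiA_is_linear _ A') (@mulA_is_linear _ A').
- by move=> y a u v; rewrite (@mulADl _ A').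
- by move=> x y; rewrite quo_anti -quo_mul.
- exact: sw_antir.
Qed.

Let mulA_be x y : mulA A (gbas F x) (gbas F y) = gbas F (x * y)%g.
Proof. exact: be_mul. Qed.

Definition central_sub : 'M[F]_n := (\sum_(z in Z) <<gbas F z>>)%MS.
Local Notation K := central_sub.

Lemma central_sub_in z : z \in Z -> (gbas F z <= K)%MS.
Proof. by move=> zZ; rewrite /K (sumsmx_sup z) // genmxE. Qed.

Lemma central_sub_dec (x : 'rV[F]_n) : (x <= K)%MS ->
  exists c : gT -> F, x = \sum_(z in Z) c z *: gbas F z.
Proof.
case/sub_sumsmxP => u ->.
have /fin_all_exists[c cE] z : exists c, u z *m <<gbas F z>>%MS = c *: gbas F z.
  by apply/sub_rVP; rewrite (submx_trans (submxMl _ _)) // genmxE.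
by exists c; apply: eq_bigr => z _; rewrite cE.
Qed.

Lemma central_sub_hopf : hopf_sub A K.
Proof.
split.
- by rewrite -[hunit A]/(gbas F 1%g) central_sub_in.
- move=> x y /central_sub_dec[c ->] /central_sub_dec[d ->].
  rewrite mulA_suml summx_sub // => z zZ; rewrite linear_sum summx_sub // => t tZ /=.
  rewrite mulAZl scalemx_sub // linearZ scalemx_sub //.
  by rewrite /= mulA_be central_sub_in ?groupM.
- move=> x /central_sub_dec[c ->]; apply: (in_tens_tensSub (H := A)).
  rewrite linear_sum in_tens_bigsum // => z zZ; rewrite linearZ in_tensZ //=.
  by rewrite comulA_central // (tens_in (H := A)) ?central_sub_in.
- move=> x /central_sub_dec[c ->]; rewrite linear_sum summx_sub // => z zZ.
  by rewrite linearZ scalemx_sub //= anti_be_central // central_sub_in ?groupV.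
Qed.

Lemma central_sub_normal : normal_in A K 1%:M.
Proof.
move=> h x _ hx; have xc y : mulA A y x = mulA A x y.
  have [c ->] := central_sub_dec hx; rewrite mulA_suml linear_sum.
  apply: eq_bigr => z zZ; rewrite linearZ mulAZl; congr (_ *: _).
  by apply/esym/be_central.
rewrite [adA _ _ _](_ : _ = counitA A h *: x) ?scalemx_sub //.
transitivity (sw (H := A) (comulA A h)
   (fun j k => mulA A x (mulA A (ebas A j) (antiA A (ebas A k))))).
  by apply: eq_sw => j k; rewrite xc mulAA.
rewrite -linear_sw; last exact: mulA_is_linear.
by rewrite sw_antir // linearZ /= mulA1.
Qed.

Lemma central_quotient : is_quotient A 1%:M (lprod A 1%:M K) A' f.
Proof.
split.
- by split; [exact: (twisted_bialg quo_twist _) | exact: quo_antipode].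
- split=> [x y _ _||x _|x _|x _].
  + exact: quo_mul.
  + exact: quo_unit.
  + exact: quo_comul.
  + exact: quo_counit.
  + exact: quo_anti.
- rewrite mul1mx -sub1mx; apply/row_subP => l; rewrite row1.
  rewrite -[delta_mx 0 l]/(ebas H' l) ebas_be -(phis (enum_val l)) -be_quo.
  exact: submxMl.
apply/andP; split.
  apply/row_subP => i; set x := row i _.
  have : (x <= kermx f)%MS by rewrite (submx_trans (row_sub _ _)) // capmxSr.
  move=> /sub_kermxP x0.
  have -> : x = \sum_g x 0 (enum_rank g) *:
      (gbas F g - gbas F (s (phi g)) : 'rV[F]_n).
    under eq_bigr => g _ do rewrite scalerBr.
    rewrite sumrB -be_sum [X in _ - X](_ : _ = 0) ?subr0 //.
    pose sec_mx : 'M[F]_(n', n) := \matrix_l gbas F (s (enum_val l)).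
    have bs h : gbas F h *m sec_mx = gbas F (s h).
      by rewrite /gbas -rowE rowK enum_rankK.
    transitivity (x *m f *m sec_mx); last by rewrite x0 mul0mx.
    rewrite {2}[x]be_sum !mulmx_suml; apply: eq_bigr => g _.
    by rewrite -!scalemxAl be_quo bs.
  rewrite summx_sub // => g _; rewrite scalemx_sub //.
  have [z zZ {1}->] := fiber g.
  have -> : gbas F (s (phi g) * z)%g - gbas F (s (phi g)) =
      mulA A (gbas F (s (phi g))) (gbas F z - gbas F 1%g).
    by rewrite linearB /= !mulA_be mulg1.
  apply: (lprod_in (H := A)); first exact: submx1.
    by rewrite addmx_sub ?eqmx_opp ?central_sub_in.
  by rewrite linearB /= [counitA A _]be_counit [counitA A _]be_counit subrr.
apply: (lprod_sub (H := A)) => x y _ hy y0; rewrite sub_capmx submx1 /=.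
apply/sub_kermxP; rewrite -[mulA A x y]/(mulA H x y) -quo_mul.
have -> : y *m f = counitA A y *: gbas F 1%g.
  have [c ->] := central_sub_dec hy; rewrite mulmx_suml linear_sum scaler_suml.
  apply: eq_bigr => z zZ; rewrite -scalemxAl be_quo linearZ /=.
  rewrite [counitA A _]be_counit mulr1; congr (_ *: gbas F _).
  by apply/eqP; rewrite phiZ.
by rewrite y0 scale0r linear0.
Qed.

End CentralQuotient.

Lemma central_sub_iso (F : fieldType) (gT : finGroupType)
    (J Jinv : 'M[F]_(hdim (groupalg F gT)))
    (hJ : is_twist (groupalg F gT) J Jinv) S
    (hS : is_antipode (twisted (groupalg F gT) J Jinv S)) (Z : {group gT}) :
  (forall z x, z \in Z -> (z * x)%g = (x * z)%g) -> prime #|Z| ->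
  iso_to_kZp #|Z| (twisted (groupalg F gT) J Jinv S) (central_sub F Z).
Proof.
move=> Zc pr; set A := twisted _ _ _ _; set p := #|Z| in pr *.
have p1 := prime_gt1 pr; have zpE : (Zp_trunc p).+2 = p by rewrite Zp_cast.
have [x xE] : exists x, Z :=: <[x]>%g by apply/cyclicP/prime_cyclic.
have ox : #[x]%g = p by rewrite /order -xE.
have zm m : (m %% (Zp_trunc p).+2 = m %% p)%N by rewrite zpE.
have xZ i : (x ^+ i)%g \in Z by rewrite xE mem_cycle.
have xm i : (x ^+ (i %% p) = x ^+ i)%g.
  by apply/eqP; rewrite eq_expg_mod_order ox modn_mod.
pose e (q : 'Z_p) := gbas F (x ^+ (q : nat))%g.
pose f : 'M[F]_(hdim (groupalg F 'Z_p), hdim A) := \matrix_i e (enum_val i).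
have bf q : gbas F q *m f = e q by rewrite /gbas -rowE rowK enum_rankK.
have eM q s : mulA A (e q) (e s) = e (q * s)%g.
  have -> : e (q * s)%g = gbas F (x ^+ ((q + s) %% p))%g by rewrite -zm.
  by rewrite [LHS]be_mul xm expgD.
have xV q : (x ^+ (q^-1%g : 'Z_p) = (x ^+ (q : nat))^-1)%g.
  apply/eqP; rewrite eq_sym eq_invg_mul -expgD -xm.
  have -> : ((q + q^-1%g) %% p)%N = (q * q^-1)%g :> nat by rewrite -zm.
  by rewrite mulgV expg0.
have ext (V : lmodType F) (g h : 'rV[F]_(hdim (groupalg F 'Z_p)) -> V) :
    linear g -> linear h -> (forall x, g (gbas F x) = h (gbas F x)) -> forall x, g x = h x.
  by apply: span_ext; apply: be_span.
exists f; split.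
- split=> [y z _ _||y _|y _|y _].
  + apply: (ext _ (fun y => mulA A (y *m f) (z *m f)) (fun y => mulA _ y z *m f)) y.
    * by move=> a u v; rewrite mulmxDl -scalemxAl mulADl.
    * by move=> a u v; rewrite mulADl mulmxDl -scalemxAl.
    move=> q.
    apply: (ext _ (fun z => mulA A (gbas F q *m f) (z *m f))
       (fun z => mulA _ (gbas F q) z *m f)) z.
    * by move=> a u v; rewrite mulmxDl -scalemxAl linearP.
    * by move=> a u v; rewrite linearP mulmxDl -scalemxAl.
    by move=> s; rewrite !bf be_mul bf eM.
  + by rewrite hunit_be bf /e expg0.
  + have lp := push_is_linear (H1 := groupalg F 'Z_p) (H2 := A) f.
    apply: (ext _ (fun y => comulA A (y *m f)) (fun y => f^T *m comulA _ y *m f)) y.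
    * by move=> a u v; rewrite mulmxDl -scalemxAl (@comulA_is_linear _ A).
    * by move=> a u v; rewrite linearP lp.
    move=> q; rewrite bf be_comul (push_tens (H2 := A)) bf.
    exact: (comulA_central Zc hJ S (xZ _)).
  + apply: (ext F^o (fun y => counitA A (y *m f)) (fun y => counitA _ y)) y.
    * by move=> a u v; rewrite mulmxDl -scalemxAl (@counitA_is_linear _ A).
    * by move=> a u v; rewrite linearP.
    by move=> q; rewrite bf be_counit; exact: be_counit.
  + apply: (ext _ (fun y => antiA A (y *m f)) (fun y => antiA _ y *m f)) y.
    * by move=> a u v; rewrite mulmxDl -scalemxAl (@antiA_is_linear _ A).
    * by move=> a u v; rewrite linearP mulmxDl -scalemxAl.
    move=> q; rewrite bf be_anti bf /e xV.
    exact: (anti_be_central Zc hJ hS).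
- apply/row_freeP; exists f^T; apply/matrixP => i k.
  rewrite !mxE (bigD1 (enum_rank (x ^+ (enum_val k : nat))%g)) //= !mxE !eqxx mulr1.
  rewrite big1 ?addr0 => [|l ne]; last by rewrite !mxE eqxx (negPf ne) mulr0.
  rewrite (inj_eq enum_rank_inj) eq_sym; congr (nat_of_bool _)%:R.
  rewrite eq_expg_mod_order ox -!zm !modn_small ?ltn_ord //.
  by rewrite (inj_eq val_inj) (inj_eq enum_val_inj).
apply/andP; split.
  apply/row_subP => i; rewrite rowK; exact: central_sub_in.
apply/sumsmx_subP => z zZ; rewrite genmxE.
have : z \in <[x]>%g by rewrite -xE.
case/cyclePmin => i; rewrite ox => hi ->.
have -> : gbas F (x ^+ i)%g = gbas F (inZp i : 'Z_p) *m f.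
  by rewrite bf /e /= modn_small // zpE.
exact: submxMl.
Qed.

Lemma upper_series_cons (F : fieldType) (P : forall B : hopf F, 'M[F]_(hdim B) -> Prop)
    (H H' : hopf F) (K : 'M[F]_(hdim H)) (f : 'M[F]_(hdim H, hdim H')) :
  hopf_sub H K -> normal_in H K 1%:M -> is_quotient H 1%:M (lprod H 1%:M K) H' f ->
  P H K -> upper_series H' P -> upper_series H P.
Proof.
move=> h1 h2 h3 h4 [m [B [L [pi [B0 Bm BS]]]]].
subst H'.
exists m.+1, (fun i => if i is i'.+1 then B i' else H),
  (fun i => match i return 'M[F]_(hdim (if i is i'.+1 then B i' else H)) with
            | 0 => K | i'.+1 => L i' end),
  (fun i => match i return 'M[F]_(hdim (if i is i'.+1 then B i' else H), hdim (B i)) with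
            | 0 => f | i'.+1 => pi i' end).
by split=> // -[|i] hi //=; apply: BS.
Qed.

Lemma upper_series_nilpotent (F : fieldType) c (gT : finGroupType) (N : nat)
    (J Jinv : 'M[F]_(hdim (groupalg F gT))) S :
  (#|gT| <= c)%N -> nilpotent [set: gT] -> (#|gT| %| N)%N ->
  is_twist (groupalg F gT) J Jinv ->
  is_antipode (twisted (groupalg F gT) J Jinv S) ->
  upper_series (twisted (groupalg F gT) J Jinv S)
    (fun B K => exists p : nat, [/\ prime p, (p %| N)%N & iso_to_kZp p B K]).
Proof.
elim: c gT J Jinv S => [|c IH] gT J Jinv S.
  by rewrite leqn0 => /eqP c0; have := cardG_gt0 [set: gT]%G; rewrite cardsT c0.
move=> hc nilG dN hJ hS; have [G1|Gn1] := eqVneq [set: gT] 1%g.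
  exists 0%N, (fun=> twisted (groupalg F gT) J Jinv S), (fun=> 0), (fun=> 0).
  by split=> //=; rewrite -cardsT G1 cards1.
have [Z st] : exists Z : {group gT}, central_step 1%G Z.
  by apply: central_step_exists; rewrite ?normal1 // eq_sym.
have [_ _ nZ cZ pr] := st; rewrite indexg1 in pr.
have Zc z x : z \in Z -> (z * x = x * z)%g.
  move=> zZ; apply/commgP; rewrite -in_set1 (subsetP cZ) //.
  by rewrite mem_commg ?inE.
have nZx x : x \in 'N(Z)%g by rewrite (subsetP (normal_norm nZ)) ?inE.
have quoM x y : coset Z (x * y)%g = (coset Z x * coset Z y)%g by rewrite morphM.
have quoZ x : (coset Z x == 1%g) = (x \in Z).
  by apply/eqP/idP => [|/coset_id //]; apply: coset_idr.
have quos (x : coset_of Z) : coset Z (repr x) = x by rewrite coset_reprK.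
have cQ : #|[set: coset_of Z]| = #|[set: gT] : Z|%g.
  by rewrite -card_quotient ?normal_norm // quotientT.
refine (upper_series_cons _ _ (central_quotient quoM quos quoZ Zc hJ hS) _ _).
- exact: central_sub_hopf.
- exact: central_sub_normal.
- exists #|Z|; split=> //; last exact: central_sub_iso.
  by rewrite (dvdn_trans _ dN) // -cardsT cardSg ?subsetT.
apply: IH.
- rewrite -cardsT cQ -ltnS (leq_trans _ hc) // -divgS ?subsetT // cardsT.
  by rewrite ltn_Pdiv ?prime_gt1 // -cardsT cardG_gt0.
- by rewrite -(quotientT Z) quotient_nil.
- by rewrite -cardsT cQ (dvdn_trans _ dN) // -cardsT dvdn_indexg.
- exact: quo_twist.
- exact: (quo_antipode quoM quos quoZ Zc hJ hS).
Qed.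

Theorem theorem5p2 (F : closedFieldType) (hchar : [pchar F] =i pred0)
  (gT : finGroupType) (hnil : nilpotent [set: gT])
  (J Jinv : 'M[F]_(hdim (groupalg F gT)))
  (hJ : is_twist (groupalg F gT) J Jinv)
  (S : 'I_(hdim (groupalg F gT)) -> 'rV[F]_(hdim (groupalg F gT)))
  (hS : is_antipode (twisted (groupalg F gT) J Jinv S)) :
  let A := twisted (groupalg F gT) J Jinv S in
  [/\ upper_series A (fun B K => exists p : nat,
          [/\ prime p, (p %| hdim A)%N & iso_to_kZp p B K]),
      lower_series A (fun B => cocommutative_hopf B)
    & semisolvable A ].
Proof.
move=> A; have lo := lower_series_nilpotent hchar hJ hS hnil.
split=> //; first exact: (upper_series_nilpotent (leqnn _) hnil (dvdnn _) hJ hS).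
left; case: lo => m [K [K0 Km KS]]; exists m, K; split=> // i hi.
have [h1 h2 h3 [B [f [h4 h5]]]] := KS i hi; split=> //.
by exists B, f; split=> //; right.
Qed.
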